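(* Let $\mathcal T_2$ be the set of all pre-reduced forms of genus one unlabeled circle trees, and $\mathcal T_3$ the set of all reduced forms of genus one unlabeled circle trees, unlabeled circle graphs being considered up to isomorphism. Then $$\mathcal T_2=\{T_2^1,T_2^2,T_2^3,T_2^4,T_2^5,T_2^6\}$$ and $$\mathcal T_3=\{T_3^1[1],\ T_3^2[1],T_3^2[2],T_3^2[3],\ T_3^3[1],\ T_3^4[1],T_3^4[2],\ T_3^5[1],\dots,T_3^5[6],\ T_3^6[1],\dots,T_3^6[6]\},$$ where the unlabeled circle graphs $T_2^i$ and $T_3^i[j]$ are the explicit ones listed in the context.
   Context: Circle graphs. A labeled circle graph (l-c-graph) is a graph without loops or multiple edges whose vertices lie on a circle, labeled $1,\dots,n$ counterclockwise, with edges drawn as straight segments. Two l-c-graphs are isomorphic if they have the same edges in terms of labels. An unlabeled circle graph (u-c-graph) is obtained by deleting the labels; two u-c-graphs are isomorphic if they can be labeled counterclockwise so that the resulting l-c-graphs are isomorphic (i.e. they agree up to rotation). A u-c-tree is a u-c-graph that is a tree. Two edges cross if they share a point other than an endpoint of both; an edge is uncrossed if no edge crosses it, otherwise crossed. Two edges of $G$ are parallel if they cross exactly the same edges of $G$. Genus. For a circle graph with $m\ge1$ edges, split each vertex $v$ of degree $d$ into $d$ nearby points, one for each edge at $v$, so that edges sharing $v$ do not cross. This gives $N=2m$ points numbered $1,\dots,N$ counterclockwise and a fixed-point-free involution $\alpha$ exchanging the endpoints of each edge. With $\sigma=(1\,2\cdots N)$ and $z$ the number of cycles, the genus is $1+\frac12(N-1-z(\alpha)-z(\alpha^{-1}\sigma))$.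 E-graphs. Arc $\widehat{XY}$ is the closed arc from $X$ to $Y$ counterclockwise. Let $AB$ be a crossed edge of $G$. Consider all edges $a_1,\dots,a_l$ of $G$ parallel to $AB$ (including $AB$) which can be joined to $AB$ by a path of edges starting with $AB$ and ending with the given edge, each edge of the path being uncrossed or parallel to $AB$; order them so that $a_i,a_j$ are the outermost among $a_i,\dots,a_j$ for all $i\le j$. Write $a_1=CD$, $a_l=EF$ with $C,D,E,F$ in counterclockwise order (if $l=1$ then $D=E$, $C=F$). The e-graph containing $AB$ consists of all edges of $G$ that have both endpoints in $\widehat{DE}\cup\widehat{FC}$ and are uncrossed or parallel to $AB$. $\widehat{DE},\widehat{FC}$ are its arcs; its crossed edges are its parallel edges. A path $E_1E_2,\dots,E_kE_{k+1}$ connects e-graphs $\mathcal E_1,\mathcal E_2$ if $E_1$ is its only vertex in one of them, $E_{k+1}$ is its only vertex in the other, and it has no vertex in any further e-graph. E-reduction of a u-c-tree $T$. Step 1: for every e-graph of $T$ delete all but one of its parallel edges. Step 2: delete all uncrossed edges and discard vertices of degree zero; the result $T_2$ is the pre-reduced form of $T$. Step 3: for every path of uncrossed edges of $T$ connecting two e-graphs $\mathcal E_1$ (arcs $\mathcal A_1,\mathcal A_2$; remaining edge $A_1A_2$, $A_i\in\mathcal A_i$) and $\mathcal E_2$ (arcs $\mathcal B_1,\mathcal B_2$; remaining edge $B_1B_2$, $B_i\in\mathcal B_i$), with one end of the path in $\mathcal A_j$ and the other in $\mathcal B_i$, add the edge $A_jB_i$. The result $T_3$ is the reduced form of $T$.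 Explicit forms (points $a,b,c,\dots$ in counterclockwise order; $xy$ is the edge joining $x,y$): $T_2^1$: points $a,\dots,d$, edges $ac,bd$. $T_2^2$: points $a,\dots,f$, edges $ad,bf,ce$. $T_2^3$: points $a,\dots,h$, edges $ad,bg,cf,eh$. $T_2^4$: points $a,\dots,f$, edges $ad,be,cf$. $T_2^5$: points $a,\dots,h$, edges $ad,eh,bf,cg$. $T_2^6$: points $a,\dots,j$, edges $af,bh,cg,dj,ei$. $T_3^i[j]$ is $T_2^i$ together with the following added edges: $T_3^1[1]$: $\{ab\}$. $T_3^2[1]$: $\{fa,de\}$; $T_3^2[2]$: $\{fa,cd\}$; $T_3^2[3]$: $\{ab,de\}$. $T_3^3[1]$: $\{ab,cd,ef\}$. $T_3^4[1]$: $\{ab,bc\}$; $T_3^4[2]$: $\{ab,cd\}$. $T_3^5[1]$: $\{ef,ab,fg\}$; $T_3^5[2]$: $\{ef,ab,gh\}$; $T_3^5[3]$: $\{ef,cd,bc\}$; $T_3^5[4]$: $\{ef,cd,fg\}$; $T_3^5[5]$: $\{ef,cd,gh\}$; $T_3^5[6]$: $\{gh,cd,bc\}$. $T_3^6[1]$: $\{ab,cd,ef,fg\}$; $T_3^6[2]$: $\{cd,ef,fg,hi\}$; $T_3^6[3]$: $\{ab,cd,ef,ja\}$; $T_3^6[4]$: $\{ab,cd,fg,hi\}$; $T_3^6[5]$: $\{ab,ef,fg,ja\}$; $T_3^6[6]$: $\{cd,ef,hi,ja\}$. *)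

(* Defs.v *)
From mathcomp Require Import all_boot all_order all_algebra.
From mathcomp Require Import classical_sets.

Set Implicit Arguments.
Unset Strict Implicit.
Unset Printing Implicit Defensive.

Import GRing.Theory.

(** * Circle graphs *)

(** The vertices are the points of ['I_n], placed counterclockwise on the
    circle; edges are the corresponding straight segments. *)
Record lcgraph (n : nat) := LCGraph {
  adj :> rel 'I_n;
  adj_sym : symmetric adj;
  adj_irrefl : irreflexive adj
}.

(** Equality up to a cyclic shift of the labels. *)
Definition uciso m n (G : lcgraph m) (H : lcgraph n) : Prop :=
  m = n /\ exists r : nat, forall (i j : 'I_m) (i' j' : 'I_n),
    i' = i + r %[mod n] -> j' = j + r %[mod n] -> G i j = H i' j'.

(** An unlabeled circle graph is an isomorphism class of labeled ones. *)
Definition ucgraph : Type := set {n : nat & lcgraph n}.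

Definition unlabel n (G : lcgraph n) : ucgraph :=
  fun H => uciso G (projT2 H).

Definition is_tree n (G : lcgraph n) : Prop :=
  [/\ 0 < n, forall x y, connect G x y
    & forall p : seq 'I_n, ucycle G p -> size p <= 2].

(** * Position on the circle *)

(** Number of steps from [x] to [y] counterclockwise. *)
Definition cdist n (x y : 'I_n) : nat := (y + n - x) %% n.

(** The closed arc from [x] to [y] counterclockwise; it is [[set x]] if
    [x = y]. *)
Definition arc n (x y : 'I_n) : {set 'I_n} :=
  [set z | cdist x z <= cdist x y].

Definition open_arc n (x y : 'I_n) : {set 'I_n} :=
  [set z | 0 < cdist x z < cdist x y].

(** Two chords of a circle meet in a point which is not an endpoint of both
    exactly when the endpoints of one lie strictly on different sides of the
    other. *)
Definition crossing n (x y u v : 'I_n) : bool :=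
  (u \in open_arc x y) && (v \in open_arc y x)
  || (v \in open_arc x y) && (u \in open_arc y x).

Section Genus.
Variables (n : nat) (G : lcgraph n).

(** The pair [(x, y)] is the point at [x] created for the edge [xy]. The
    points are listed counterclockwise: those at [x] come in the clockwise
    order x-1, x-2, ... of the opposite endpoints, which is the only order in
    which edges sharing [x] do not cross. *)
Definition split_points : seq ('I_n * 'I_n) :=
  [seq (x, y) | x <- enum 'I_n,
                y <- [seq y <- rev (rot x (enum 'I_n)) | G x y]].

Definition split_alpha (d : 'I_n * 'I_n) := (d.2, d.1).

Definition split_sigma (d : 'I_n * 'I_n) := next split_points d.

Definition ncycles (f : 'I_n * 'I_n -> 'I_n * 'I_n) : nat :=
  fcard f (mem split_points).

(** As [split_alpha] is an involution, [split_alpha \o split_sigma] is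
    alpha^-1 sigma. Without edges the value is 1/2, hence a graph of genus
    one has an edge. *)
Definition genus : rat :=
  (1 + ((size split_points)%:R - 1 - (ncycles split_alpha)%:R
        - (ncycles (split_alpha \o split_sigma))%:R) / 2%:R)%R.

End Genus.

(** * E-graphs *)

Section Egraphs.
Variables (n : nat) (G : lcgraph n).
Implicit Types (A B C D E F x y u v : 'I_n).

Definition crossed x y : bool :=
  G x y && [exists u, exists v, G u v && crossing x y u v].

Definition uncrossed x y : bool := G x y && ~~ crossed x y.

Definition parallel x y x' y' : bool :=
  [&& G x y, G x' y' &
   [forall u, forall v, G u v ==> (crossing x y u v == crossing x' y' u v)]].

(** [q] is the sequence of the vertices of a path of edges. *)
Definition joined A B x y : Prop :=
  exists q : seq 'I_n,
  [/\ uniq q,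
      sorted (fun u v => uncrossed u v || parallel A B u v) q,
      prefix [:: A; B] q || prefix [:: B; A] q
    & suffix [:: x; y] q || suffix [:: y; x] q].

(** The edge [x y] lies between the edges [C D] and [E F], where [C], [D],
    [E], [F] are in counterclockwise order. The order is expressed starting
    from [D], since [D = E] and [F = C] are allowed whereas [C <> D] and
    [E <> F]. *)
Definition outermost C D E F x y : bool :=
  [&& cdist D E <= cdist D F, cdist D F <= cdist D C,
      x \in arc F C & y \in arc D E].

(** [s] is the ordered list a_1, ..., a_l for [A B], where all the edges are
    written in the same direction: a_1 = (C, D), ..., a_l = (F, E). *)
Definition parallel_list A B (s : seq ('I_n * 'I_n)) : Prop :=
  [/\ uniq s,
      forall x y, (parallel A B x y /\ joined A B x y) <->
                  ((x, y) \in s) || ((y, x) \in s)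
    & forall i k j : nat, i <= k <= j -> j < size s ->
        let a i := nth (A, B) s i in
        outermost (a i).1 (a i).2 (a j).2 (a j).1 (a k).1 (a k).2].

End Egraphs.

(** The edge set of an e-graph is stored as a symmetric set of pairs. *)
Record egraph (n : nat) := Egraph {
  earc : bool -> {set 'I_n};
  eedges : {set 'I_n * 'I_n}
}.

Definition evertices n (E : egraph n) : {set 'I_n} :=
  [set x | [exists y, (x, y) \in eedges E]].

Section Reduction.
Variables (n : nat) (T : lcgraph n).
Implicit Types (A B C D x y : 'I_n) (E : egraph n).

(** The e-graph containing the crossed edge [A B]. The list [s] is
    determined up to reversal (with reversal of all its edges), which
    exchanges the two arcs. *)
Definition egraph_containing A B E : Prop :=
  exists s : seq ('I_n * 'I_n), parallel_list T A B s /\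
  let: (C, D) := head (A, B) s in
  let: (F, E') := last (A, B) s in
  [/\ earc E false = arc D E', earc E true = arc F C
    & eedges E = [set e | [&& e.1 \in arc D E' :|: arc F C,
                              e.2 \in arc D E' :|: arc F C
                            & uncrossed T e.1 e.2
                              || parallel T A B e.1 e.2]]].

Definition is_egraph E : Prop :=
  exists A B, crossed T A B /\ egraph_containing A B E.

Definition connects x (p : seq 'I_n) E1 E2 : Prop :=
  [/\ [/\ p != [::], uniq (x :: p) & path (uncrossed T) x p],
      forall v, v \in x :: p -> (v \in evertices E1) = (v == x),
      forall v, v \in x :: p -> (v \in evertices E2) = (v == last x p)
    & forall E, is_egraph E -> eedges E <> eedges E1 ->
        eedges E <> eedges E2 ->
        forall v, v \in x :: p -> v \notin evertices E].

Definition step1 (T1 : lcgraph n) : Prop :=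
  [/\ forall x y, T1 x y -> T x y,
      forall x y, T x y -> ~~ T1 x y -> crossed T x y /\
        (exists2 E, is_egraph E & (x, y) \in eedges E)
    & forall E, is_egraph E -> exists A B,
        [/\ crossed T A B, (A, B) \in eedges E
          & forall x y, crossed T x y -> (x, y) \in eedges E ->
              T1 x y = ((x, y) \in [:: (A, B); (B, A)])]].

(** [f] renumbers, respecting the order, the vertices which have positive
    degree once the uncrossed edges of [T1] are deleted. *)
Definition renumbering (T1 : lcgraph n) m (f : 'I_m -> 'I_n) : Prop :=
  {homo f : i j / (i < j)%N} /\
  forall x, (exists i, f i = x) <-> (exists y, crossed T1 x y).

(** [x] is the endpoint in the arc [earc E b] of the remaining edge of [E]. *)
Definition remaining (T1 : lcgraph n) E (b : bool) x : Prop :=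
  x \in earc E b /\
  exists y, [/\ y \in earc E (~~ b), (x, y) \in eedges E, crossed T x y
              & T1 x y].

Definition step3_edge (T1 : lcgraph n) x y : Prop :=
  exists E1 E2 (i j : bool) u p,
  [/\ is_egraph E1 /\ is_egraph E2,
      connects u p E1 E2,
      u \in earc E1 i /\ last u p \in earc E2 j
    & remaining T1 E1 i x /\ remaining T1 E2 j y].

Definition pre_reduced_form m (G : lcgraph m) : Prop :=
  exists2 T1 : lcgraph n, step1 T1 &
  exists2 f : 'I_m -> 'I_n, renumbering T1 f &
  forall i j, G i j <-> crossed T1 (f i) (f j).

Definition reduced_form m (G : lcgraph m) : Prop :=
  exists2 T1 : lcgraph n, step1 T1 &
  exists2 f : 'I_m -> 'I_n, renumbering T1 f &
  forall i j, G i j <-> [\/ crossed T1 (f i) (f j),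
                            step3_edge T1 (f i) (f j)
                          | step3_edge T1 (f j) (f i)].

End Reduction.

Definition pre_reduced_forms : set ucgraph :=
  fun X => exists n (T : lcgraph n) m (G : lcgraph m),
  [/\ is_tree T, genus T = 1%R, pre_reduced_form T G & X = unlabel G].

Definition reduced_forms : set ucgraph :=
  fun X => exists n (T : lcgraph n) m (G : lcgraph m),
  [/\ is_tree T, genus T = 1%R, reduced_form T G & X = unlabel G].

(** * The explicit graphs *)

Section OfEdges.
Variables (n : nat) (s : seq (nat * nat)).

Definition of_edges_rel : rel 'I_n := fun x y =>
  (x != y) && (((val x, val y) \in s) || ((val y, val x) \in s)).

Fact of_edges_sym : symmetric of_edges_rel.
Proof. by move=> x y; rewrite /of_edges_rel eq_sym orbC. Qed.

Fact of_edges_irrefl : irreflexive of_edges_rel.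
Proof. by move=> x; rewrite /of_edges_rel eqxx. Qed.

Definition of_edges : ucgraph :=
  unlabel (LCGraph of_edges_sym of_edges_irrefl).

End OfEdges.

Local Notation a := 0 (only parsing).
Local Notation b := 1 (only parsing).
Local Notation c := 2 (only parsing).
Local Notation d := 3 (only parsing).
Local Notation e := 4 (only parsing).
Local Notation f := 5 (only parsing).
Local Notation g := 6 (only parsing).
Local Notation h := 7 (only parsing).
Local Notation i := 8 (only parsing).
Local Notation j := 9 (only parsing).

Definition E2_1 : seq (nat * nat) := [:: (a, c); (b, d)].
Definition E2_2 : seq (nat * nat) := [:: (a, d); (b, f); (c, e)].
Definition E2_3 : seq (nat * nat) := [:: (a, d); (b, g); (c, f); (e, h)].
Definition E2_4 : seq (nat * nat) := [:: (a, d); (b, e); (c, f)].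
Definition E2_5 : seq (nat * nat) := [:: (a, d); (e, h); (b, f); (c, g)].
Definition E2_6 : seq (nat * nat) :=
  [:: (a, f); (b, h); (c, g); (d, j); (e, i)].

Definition T2_1 := of_edges 4 E2_1.
Definition T2_2 := of_edges 6 E2_2.
Definition T2_3 := of_edges 8 E2_3.
Definition T2_4 := of_edges 6 E2_4.
Definition T2_5 := of_edges 8 E2_5.
Definition T2_6 := of_edges 10 E2_6.

Definition T3_1_1 := of_edges 4 (E2_1 ++ [:: (a, b)]).

Definition T3_2_1 := of_edges 6 (E2_2 ++ [:: (f, a); (d, e)]).
Definition T3_2_2 := of_edges 6 (E2_2 ++ [:: (f, a); (c, d)]).
Definition T3_2_3 := of_edges 6 (E2_2 ++ [:: (a, b); (d, e)]).

Definition T3_3_1 := of_edges 8 (E2_3 ++ [:: (a, b); (c, d); (e, f)]).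

Definition T3_4_1 := of_edges 6 (E2_4 ++ [:: (a, b); (b, c)]).
Definition T3_4_2 := of_edges 6 (E2_4 ++ [:: (a, b); (c, d)]).

Definition T3_5_1 := of_edges 8 (E2_5 ++ [:: (e, f); (a, b); (f, g)]).
Definition T3_5_2 := of_edges 8 (E2_5 ++ [:: (e, f); (a, b); (g, h)]).
Definition T3_5_3 := of_edges 8 (E2_5 ++ [:: (e, f); (c, d); (b, c)]).
Definition T3_5_4 := of_edges 8 (E2_5 ++ [:: (e, f); (c, d); (f, g)]).
Definition T3_5_5 := of_edges 8 (E2_5 ++ [:: (e, f); (c, d); (g, h)]).
Definition T3_5_6 := of_edges 8 (E2_5 ++ [:: (g, h); (c, d); (b, c)]).

Definition T3_6_1 := of_edges 10 (E2_6 ++ [:: (a, b); (c, d); (e, f); (f, g)]).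
Definition T3_6_2 := of_edges 10 (E2_6 ++ [:: (c, d); (e, f); (f, g); (h, i)]).
Definition T3_6_3 := of_edges 10 (E2_6 ++ [:: (a, b); (c, d); (e, f); (j, a)]).
Definition T3_6_4 := of_edges 10 (E2_6 ++ [:: (a, b); (c, d); (f, g); (h, i)]).
Definition T3_6_5 := of_edges 10 (E2_6 ++ [:: (a, b); (e, f); (f, g); (j, a)]).
Definition T3_6_6 := of_edges 10 (E2_6 ++ [:: (c, d); (e, f); (h, i); (j, a)]).

(* Main.v *)
From mathcomp Require Import all_boot all_order all_algebra.
From mathcomp Require Import boolp zify lra.
Require Import Defs.

(** If f is a function from the split points to F_2 which is invariant under
    alpha^-1 sigma, then w = f + f alpha is a function on the edges, and w
    determines f up to an additive constant since f sigma = f + w sigma; summing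
    along the arc cut off by an edge shows that the w which occur are exactly the
    elements of the kernel of the crossing matrix of the
    edges. Hence the genus is one if and only if this matrix has rank two, that
    is, if and only if the crossed edges fall into two or three classes such that
    two edges cross exactly when they lie in different classes.

    In a tree of genus one the vertices of an e-graph stay on two arcs which no
    other e-graph meets, and every path of uncrossed edges between two e-graphs
    joins two neighbouring arcs of crossing e-graphs. Contracting each e-graph to
    its remaining edge therefore gives again a tree: the reduced form consists of
    a perfect matching with the above crossing pattern and of links between
    neighbouring points of crossing chords, it is connected and each link is a
    bridge. The middle one of three parallel chords could not be linked to
    anything, so there are at most two chords in each class and at most twelve
    points, and the remaining cases are enumerated. Conversely, each of the listed
    graphs T_3^i[j] is a tree of genus one which is its own reduced form. *)

Set Implicit Arguments.
Unset Strict Implicit.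
Unset Printing Implicit Defensive.

(** * Cyclic order and crossings *)

(** Rank two is used as linear algebra over F_2: the crossing matrix is an alternating form, so each
    edge gets a vector of the plane F_2^2, and two edges cross exactly when their vectors are
    linearly independent. The crossed edges carry the three nonzero vectors, hence the two or three
    classes.

    The delicate point about e-graphs is that no crossed edge of another class has an end on their
    arcs. Here the connectivity demanded in their definition enters: a parallel edge lying between
    the outermost ones separates them, so the path that joins them passes through one of its ends.

    Contraction is never carried out as a quotient. Connectedness and bridges are expressed by
    two-colourings: a graph is connected if every colouring that is constant along its edges is
    constant, and an edge is a bridge if some colouring changes along it alone. Colours are attached
    to whole e-graphs, which carries such statements over from the tree to its reduced form. *)

Definition between (x u y : nat) : bool := [|| x < u < y, u < y < x | y < x < u].

Lemma cdistE n (x y : 'I_n) :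
  cdist x y = if x <= y then y - x else y + n - x.
Proof.
rewrite /cdist; have := ltn_ord x; have := ltn_ord y => hy hx.
case: leqP => h; last by rewrite modn_small; lia.
by rewrite -addnBAC // modnDr modn_small; lia.
Qed.

(** The three cases of [between] are the rotations of x < u < y; with them cyclic order becomes
    linear arithmetic on the labels. For x = y both sides are empty. *)
Lemma in_open_arc n (x y u : 'I_n) : (u \in open_arc x y) = between x u y.
Proof.
rewrite inE !cdistE /between; have := ltn_ord x; have := ltn_ord y; have := ltn_ord u.
by case: (leqP x u); case: (leqP x y); lia.
Qed.

Lemma in_arc n (x y u : 'I_n) :
  (u \in arc x y) = [|| u == x, u == y | between x u y].
Proof.
rewrite inE !cdistE /between -!val_eqE /=.
have := ltn_ord x; have := ltn_ord y; have := ltn_ord u.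
by case: (leqP x u); case: (leqP x y); lia.
Qed.

Lemma crossingE n (x y u v : 'I_n) :
  crossing x y u v = between x u y && between y v x || between x v y && between y u x.
Proof. by rewrite /crossing !in_open_arc. Qed.

Lemma crossingC n (x y u v : 'I_n) : crossing x y u v = crossing u v x y.
Proof. rewrite !crossingE /between; lia. Qed.

Lemma crossing_flip n (x y u v : 'I_n) : crossing y x u v = crossing x y u v.
Proof. rewrite !crossingE /between; lia. Qed.

Lemma crossing_flipr n (x y u v : 'I_n) : crossing x y v u = crossing x y u v.
Proof. rewrite !crossingE /between; lia. Qed.

Lemma crossing_irrefl n (x y : 'I_n) : crossing x y x y = false.
Proof. rewrite !crossingE /between; lia. Qed.

Lemma crossing_endl n (x y v : 'I_n) : crossing x y x v = false.
Proof. by rewrite crossingE; apply/negP => /orP[]/andP[]; rewrite /between; lia. Qed.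

(** An invariant function is determined by its values on the roots of the orbits, that is, by a set
    of roots. Used for alpha and for alpha^-1 sigma, it turns numbers of cycles into cardinalities
    of vector spaces over F_2. *)
Lemma card_invariant (T : finType) (phi : T -> T) (a : {pred T}) :
  injective phi -> fclosed phi a ->
  #|[set f : {ffun T -> bool} | [forall d, f d ==> (d \in a)] &&
       [forall d, f (phi d) == f d]]| = 2 ^ fcard phi a.
Proof.
move=> phiI cl; set e := frel phi.
have sym : connect_sym e by exact: fconnect_sym.
pose B := [set x in a | roots e x].
have -> : fcard phi a = #|B|.
  by rewrite /n_comp_mem; apply: eq_card => x; rewrite !inE andbC.
rewrite -card_powerset.
pose h (A : {set T}) := [ffun d => froot phi d \in A].
have hI : {in powerset B &, injective h}.
  move=> A A'; rewrite !inE => /subsetP sA /subsetP sA' /ffunP eqh.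
  apply/setP => x; have [xB|xB] := boolP (x \in B).
    have := eqh x; rewrite !ffunE; move: xB; rewrite inE => /andP[_ /eqP ->].
    by [].
  have /negbTE -> : x \notin A by apply: contra xB; apply: sA.
  by have /negbTE -> : x \notin A' by apply: contra xB; apply: sA'.
rewrite -(card_in_imset hI). apply: eq_card => f; rewrite inE.
have rt d : (froot phi d \in a) = (d \in a).
  by rewrite -(closed_connect cl (connect_root _ d)).
apply/andP/imsetP => [[/forallP fa /forallP fphi]|[A]].
  have froot x y : connect e x y -> f x = f y.
    move=> c; apply/esym; move: c => /connectP[p].
    elim: p x => [x _ -> //|z p IH x /= /andP[/eqP <- pp] ly].
    by rewrite (IH _ pp ly); apply/eqP; exact: fphi.
  exists [set x in B | f x].
    by rewrite inE; apply/subsetP => x; rewrite inE => /andP[].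
  apply/ffunP => d; rewrite ffunE !inE rt roots_root //=.
  rewrite -(froot _ _ (connect_root _ d)) andbT.
  by have := fa d; case: (f d) => /= [->|_]; rewrite ?andbF.
rewrite inE => /subsetP sA ->; split; apply/forallP => d; rewrite !ffunE.
  by apply/implyP => /sA; rewrite inE rt => /andP[].
suff -> : froot phi (phi d) = froot phi d by [].
by apply/(fingraph.rootP sym); rewrite sym; exact: (fconnect1 phi d).
Qed.

(** * The genus and the crossing matrix *)

Lemma pairwise_rev (S : Type) (r : rel S) (s : seq S) :
  pairwise r (rev s) = pairwise (fun x y => r y x) s.
Proof. by elim: s => //= x s IH; rewrite rev_cons pairwise_rcons IH all_rev. Qed.

Section SplitOrder.
Variables (n : nat) (G : lcgraph n).
Local Notation dart := ('I_n * 'I_n)%type.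
Local Notation D := (split_points G).
Implicit Types (d e : dart).

Definition opp d : dart := (d.2, d.1).

Lemma oppK : involutive opp. Proof. by case. Qed.

Lemma mem_split d : (d \in D) = G d.1 d.2.
Proof.
case: d => x y /=; apply/allpairsPdep/idP => [[x' [y' [_ h [-> ->]]]]|h].
  by move: h; rewrite mem_filter => /andP[].
by exists x, y; split; rewrite ?mem_enum // mem_filter h mem_rev mem_rot mem_enum.
Qed.

Lemma opp_split d : (opp d \in D) = (d \in D).
Proof. by rewrite !mem_split /= adj_sym. Qed.

Lemma dart_neq d : d \in D -> d.1 != d.2.
Proof. by rewrite mem_split; apply: contraL => /eqP ->; rewrite adj_irrefl. Qed.

(** The order of [split_points] in closed form. At a common vertex the points run clockwise, so the
    one with the farther opposite endpoint comes first. *)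
Definition dlt d e : bool :=
  (d.1 < e.1) || (d.1 == e.1) && (cdist d.1 e.2 < cdist d.1 d.2).

Lemma pairwise_ltn_enum : pairwise (relpre val ltn) (enum 'I_n).
Proof.
by rewrite -pairwise_map val_enum_ord -sorted_pairwise ?iota_ltn_sorted //; exact: ltn_trans.
Qed.

Lemma pairwise_clockwise x :
  pairwise (fun y z => cdist x z < cdist x y) (rev (rot x (enum 'I_n))).
Proof.
rewrite pairwise_rev -(@pairwise_map _ _ (cdist x) ltn).
suff -> : map (cdist x) (rot x (enum 'I_n)) = iota 0 n.
  by rewrite -sorted_pairwise ?iota_ltn_sorted //; exact: ltn_trans.
have sz : size (rot x (enum 'I_n)) = n by rewrite size_rot size_enum_ord.
apply: (@eq_from_nth _ 0); first by rewrite size_map sz size_iota.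
move=> i; rewrite size_map sz => hi; rewrite (nth_map x) ?sz // nth_iota // add0n.
have hx := ltn_ord x.
rewrite /rot nth_cat size_drop size_enum_ord cdistE.
case: ltnP => h.
  by rewrite nth_drop nth_enum_ord ?leq_addr; lia.
rewrite nth_take; last by lia.
by rewrite nth_enum_ord; [case: leqP; lia | lia].
Qed.

Lemma split_sorted : pairwise dlt D.
Proof.
pose ys (x : 'I_n) := [seq y <- rev (rot x (enum 'I_n)) | G x y].
suff: forall s : seq 'I_n, pairwise (relpre val ltn) s ->
  pairwise dlt [seq (x, y) | x <- s, y <- ys x] by apply; exact: pairwise_ltn_enum.
elim=> //= x s IH /andP[/allP xs /IH {}IH].
rewrite pairwise_cat IH andbT; apply/andP; split.
  apply/allrelP => d e /mapP[y _ ->] /allpairsPdep[x' [y' [/xs xx' _ ->]]].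
  by move: xx'; rewrite /dlt /= => ->.
rewrite pairwise_map /dlt /=.
apply: sub_pairwise (pairwise_filter _ (pairwise_clockwise x)).
by move=> y z /= h; rewrite ltnn eqxx.
Qed.

Lemma dlt_irr d : ~~ dlt d d. Proof. by rewrite /dlt !ltnn eqxx. Qed.

Lemma split_uniq : uniq D.
Proof. by apply: pairwise_uniq split_sorted => d; exact/negbTE/dlt_irr. Qed.

Lemma dlt_asym d e : dlt d e -> ~~ dlt e d.
Proof.
rewrite /dlt; case/orP => [h|/andP[/eqP-> h]].
  have /negbTE -> : e.1 != d.1 by rewrite -val_eqE /=; lia.
  by rewrite orbF; lia.
by rewrite eqxx; lia.
Qed.

Lemma ix_lt d e : d \in D -> e \in D -> (index d D < index e D) = dlt d e.
Proof.
move=> dD eD; have /(pairwiseP d) pw := split_sorted.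
have aux a b : a \in D -> b \in D -> index a D < index b D -> dlt a b.
  move=> aD bD ab; have := pw (index a D) (index b D).
  by rewrite !inE !index_mem aD bD !nth_index //; exact.
apply/idP/idP => [|de]; first exact: aux.
case: (ltngtP (index d D) (index e D)) => // h.
  by have := dlt_asym de; rewrite aux.
have eqde : d = e by rewrite -(nth_index d dD) h nth_index.
by rewrite eqde (negbTE (dlt_irr e)) in de.
Qed.

Lemma ix_next d : d \in D -> index (next D d) D =
  if (index d D).+1 < size D then (index d D).+1 else 0.
Proof.
move=> dD; rewrite next_nth dD; have := split_uniq; move: dD; case: D => // e s.
move=> dD us; set i := index d (e :: s).
have hi : i < size (e :: s) by rewrite index_mem.
case: ifP => h.
  by rewrite (_ : nth e s i = nth e (e :: s) i.+1) // index_uniq.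
by rewrite nth_default //= ?eqxx //; move: h hi => /=; lia.
Qed.

Lemma next_split d : (next D d \in D) = (d \in D). Proof. exact: mem_next. Qed.

Lemma next_id d : d \notin D -> next D d = d.
Proof. by rewrite next_nth => /negbTE ->. Qed.

Lemma next_split_inj : injective (next D).
Proof. exact: (can_inj (prev_next split_uniq)). Qed.

End SplitOrder.

Section Potential.
Variables (n : nat) (G : lcgraph n).
Local Notation dart := ('I_n * 'I_n)%type.
Local Notation D := (split_points G).
Implicit Types (d e : dart) (w f : {ffun dart -> bool}).

(** Functions on the edges are encoded as symmetric functions on pairs. Vanishing off the split
    points makes them countable inside a finite function type. *)
Definition chord_fun w :=
  [forall d, w d ==> (d \in D)] && [forall d, w (opp d) == w d].
Definition face_fun f :=
  [forall d, f d ==> (d \in D)] && [forall d, f (opp (next D d)) == f d].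

Lemma chord_funP w :
  reflect ((forall d, w d -> d \in D) /\ forall d, w (opp d) = w d) (chord_fun w).
Proof.
apply: (iffP andP) => [[/forallP h1 /forallP h2]|[h1 h2]]; split.
- by move=> d; exact/implyP.
- by move=> d; exact/eqP.
- by apply/forallP => d; apply/implyP; exact: h1.
- by apply/forallP => d; rewrite h2.
Qed.

Lemma face_funP f :
  reflect ((forall d, f d -> d \in D) /\ forall d, f (opp (next D d)) = f d)
          (face_fun f).
Proof.
apply: (iffP andP) => [[/forallP h1 /forallP h2]|[h1 h2]]; split.
- by move=> d; exact/implyP.
- by move=> d; exact/eqP.
- by apply/forallP => d; apply/implyP; exact: h1.
- by apply/forallP => d; rewrite h2.
Qed.

(** The row of the crossing matrix at d, applied to w. Of the two orientations of an edge crossing d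
    only one starts in the arc from [d.1] to [d.2], so each edge counts once. *)
Definition interlace w d : bool :=
  \big[addb/false]_e
    ((e.1 \in open_arc d.1 d.2) && (e.2 \in open_arc d.2 d.1) && w e).

(** A discrete primitive of w along the split points; it yields the functions f of the overview up
    to a constant. *)
Definition psum w d : bool :=
  \big[addb/false]_(e : dart) ((index e D <= index d D) && w e).

Lemma sum_opp (F : dart -> bool) :
  \big[addb/false]_e F e = \big[addb/false]_e F (opp e).
Proof. by rewrite (reindex_inj (inv_inj (@oppK n))). Qed.

(** The terms at e and at [opp e] are equal and cancel modulo 2; the diagonal contributes
    nothing. *)
Lemma sum_sym (F : dart -> bool) :
  (forall e, F (opp e) = F e) -> (forall x, F (x, x) = false) ->
  \big[addb/false]_e F e = false.
Proof.
move=> Fs F0; rewrite (bigID (fun e : dart => e.1 < e.2)) /=.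
rewrite [X in _ (+) X](bigID (fun e : dart => e.2 < e.1)) /=.
rewrite [X in _ (+) (_ (+) X)]big1 ?addbF; last first.
  case=> x y /=; rewrite -!leqNgt => /andP[xy yx].
  have /val_inj -> : val x = val y by apply/eqP; rewrite eqn_leq xy yx.
  exact: F0.
rewrite [X in _ (+) X](reindex_inj (inv_inj (@oppK n))) /=.
rewrite [X in _ (+) X](eq_big (fun e : dart => e.1 < e.2) F) ?addbb //.
  by move=> e; case: ltngtP.
Qed.

Lemma interlace_opp w d : (forall e, w (opp e) = w e) ->
  interlace w (opp d) = interlace w d.
Proof.
move=> ws; rewrite /interlace sum_opp; apply: eq_bigr => e _.
by rewrite ws /= [X in X && _]andbC.
Qed.

Lemma psum_opp w d : chord_fun w -> d \in D ->
  psum w d (+) psum w (opp d) = w d (+) interlace w d.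
Proof.
move=> /chord_funP[wD ws].
wlog lt_d : d / d.1 < d.2.
  move=> H dD; have /negP := dart_neq dD; rewrite -val_eqE /=.
  case: (ltngtP d.1 d.2) => // lt _; first exact: H.
  have := H (opp d) lt; rewrite opp_split => /(_ dD).
  by rewrite oppK addbC ws interlace_opp.
move=> dD; case: d lt_d dD => x y /= lt_xy dD.
have dD' : (y, x) \in D by rewrite -[_ \in _]opp_split.
(* [h] marks both orientations of the edges other than d that stay in the closed arc from x to y. By
   the clockwise order at x and at y both of their split points lie between those of d, so they
   cancel. What remains is the point [(y, x)] itself and the edges that cross d. *)
pose h (e : dart) := ((between x e.1 y && between x e.2 y)
  (+) (between x e.1 y && ((e.2 == x) || (e.2 == y))))
  (+) (between x e.2 y && ((e.1 == x) || (e.1 == y))).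
have e1 : \big[addb/false]_e (h e && w e) = false.
  apply: sum_sym => [e|u].
    by rewrite ws /h /= [X in (X (+) _) (+) _]andbC addbAC.
  by case: (boolP (w (u, u))) => [/wD/dart_neq|]; rewrite ?eqxx ?andbF.
have e2 : \big[addb/false]_(e : dart) ((e == (y, x)) && w e) = w (x, y).
  rewrite (bigD1 (y, x)) //= eqxx /= big1 ?addbF; first exact: (ws (x, y)).
  by move=> e /negbTE ->.
transitivity (\big[addb/false]_e (h e && w e) (+)
  (\big[addb/false]_(e : dart) ((e == (y, x)) && w e) (+) interlace w (x, y)));
  last by rewrite e1 e2.
rewrite /psum /interlace /= -!big_split /=; apply: eq_bigr => e _.
case: (boolP (w e)) => [/wD eD|]; rewrite ?andbF ?addbF // !andbT.
rewrite !(leqNgt (index e D)) !ix_lt // !in_open_arc /dlt /h /=.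
have /= := dart_neq eD; case: e {eD} => u v /=; rewrite xpair_eqE => uv.
have cd (z t : 'I_n) : z != v -> (cdist z v < cdist z t) = between z v t.
  rewrite eq_sym -in_open_arc inE cdistE -val_eqE /=.
  by have := ltn_ord z; case: (leqP z v); lia.
have [xu|xu] := eqVneq x u; have [yu|yu] := eqVneq y u.
- by move: lt_xy; rewrite xu yu ltnn.
- subst u; rewrite (cd _ _ uv); move: uv; rewrite -!val_eqE /= /between ?ltnn => uv.
  by case: (ltngtP x v) uv => // ? _; case: (ltngtP y v) => // ?; rewrite ?lt_xy //=; lia.
- subst u; rewrite (cd _ _ uv); move: uv; rewrite -!val_eqE /= /between ?ltnn => uv.
  by case: (ltngtP y v) uv => // ? _; case: (ltngtP x v) => // ?; rewrite ?lt_xy //=; lia.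
move: lt_xy uv xu yu; rewrite -!val_eqE /= /between => lt_xy uv xu yu.
rewrite (ltnNge y x) (ltnW lt_xy) lt_xy /=.
by case: (ltngtP x u) xu => // ? _; case: (ltngtP y u) yu => // ? _;
  case: (ltngtP x v) => // ?; case: (ltngtP y v) => //= ?; lia.
Qed.

End Potential.

Section Genus.
Variables (n : nat) (G : lcgraph n).
Local Notation dart := ('I_n * 'I_n)%type.
Local Notation D := (split_points G).
Implicit Types (d e : dart) (w f : {ffun dart -> bool}).

Lemma psum_next w d : chord_fun G w -> d \in D ->
  psum G w (next D d) = psum G w d (+) w (next D d).
Proof.
move=> wc dD; have [wD ws] := chord_funP _ _ wc.
set d' := next D d; have d'D : d' \in D by rewrite next_split.
have ixd' := ix_next dD; rewrite -/d' in ixd'.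
have e2 : \big[addb/false]_(e : dart) ((e == d') && w e) = w d'.
  by rewrite (bigD1 d') //= eqxx /= big1 ?addbF // => e /negbTE ->.
have inj e : e \in D -> (e == d') = (index e D == index d' D).
  move=> eD; apply/eqP/eqP => [->//|h].
  by rewrite -(nth_index d eD) h nth_index.
have ixD e : e \in D -> index e D < size D by rewrite index_mem.
rewrite -[in RHS]e2 /psum; move: ixd'; case: ifP => [lt ixd'|ge ixd'].
  rewrite -big_split; apply: eq_bigr => e _ /=.
  case: (boolP (w e)) => [/wD eD|]; rewrite ?andbF // !andbT inj // ixd'.
  by rewrite leq_eqVlt ltnS; case: eqP => [->|_]; rewrite ?ltnn ?addbF.
(* At the wrap-around from the last split point to the first, the partial sum runs over all pairs
   and vanishes, since every edge occurs twice. *)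
have -> : \big[addb/false]_(e : dart) ((index e D <= index d D) && w e) = false.
  rewrite -[RHS](@sum_sym n w) //.
    apply: eq_bigr => e _; case: (boolP (w e)) => [/wD /ixD|]; rewrite ?andbF //.
    by have := ixD _ dD; lia.
  by move=> x; apply/negP => /wD /dart_neq; rewrite eqxx.
rewrite addFb; apply: eq_bigr => e _.
case: (boolP (w e)) => [/wD eD|]; rewrite ?andbF // !andbT inj // ixd'.
by rewrite leqn0.
Qed.

Definition ker_fun w := chord_fun G w && [forall d, (d \in D) ==> ~~ interlace w d].

Lemma ker_funP w : reflect (chord_fun G w /\ forall d, d \in D -> interlace w d = false)
  (ker_fun w).
Proof.
apply: (iffP andP) => [[-> /forallP h]|[-> h]]; split=> //.
  by move=> d dD; apply/negbTE; have := h d; rewrite dD.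
by apply/forallP => d; apply/implyP => /h ->.
Qed.

Definition potential (wb : {ffun dart -> bool} * bool) : {ffun dart -> bool} :=
  [ffun d => (d \in D) && (wb.2 (+) psum G wb.1 d)].

(** [next D] runs through the split points in a single cycle. *)
Lemma next_ind (P : pred dart) d0 : d0 \in D ->
  (forall d, d \in D -> P d = P (next D d)) -> forall d, d \in D -> P d = P d0.
Proof.
move=> d0D h d dD.
suff aux : forall e, e \in D -> P e = P (head d0 D).
  by rewrite !aux.
move=> e eD; rewrite -(nth_index d0 eD) -nth0.
have := eD; rewrite -index_mem.
elim: (index e D) => // i IH lt; rewrite -IH ?(ltnW lt) //.
rewrite [RHS]h ?mem_nth ?(ltnW lt) //; congr P.
have hi := ltnW lt; have iD := mem_nth d0 hi.
have := ix_next iD; rewrite index_uniq ?split_uniq // lt => <-.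
by rewrite nth_index ?next_split.
Qed.

Lemma card_face_fun : 0 < size D ->
  #|[set f | face_fun G f]| = #|[set w | ker_fun w]| * 2.
Proof.
move=> D0; have [d0 d0D] : exists d, d \in D.
  by case: D D0 => // d s _; exists d; rewrite mem_head.
rewrite -card_bool -cardsT -cardsX.
have inj : {in setX [set w | ker_fun w] [set: bool] &, injective potential}.
  move=> [w b] [w' b']; rewrite !inE /= !andbT => /ker_funP[wc wk] /ker_funP[wc' wk'].
  move=> /ffunP eq.
  (* On the kernel [psum_opp] reads w = f + f alpha, which recovers w from its potential f. *)
  have rec v c d : chord_fun G v -> (forall d, d \in D -> interlace v d = false) ->
    d \in D -> v d = potential (v, c) d (+) potential (v, c) (opp d).
    move=> vc vk dD; rewrite !ffunE opp_split dD /=.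
    by rewrite addbACA addbb addFb psum_opp // vk // addbF.
  have eqw : w = w'.
    apply/ffunP => d; have [dD|dD] := boolP (d \in D).
      by rewrite (rec w b) // (rec w' b') // !eq.
    have [h _] := chord_funP _ _ wc; have [h' _] := chord_funP _ _ wc'.
    by rewrite (contraNF (h d)) // (contraNF (h' d)).
  by have := eq d0; rewrite eqw !ffunE d0D /= => /addIb ->.
rewrite -(card_in_imset inj); apply: eq_card => f; rewrite inE.
apply/idP/imsetP => [/face_funP[fD fn]|[[w b]]].
  pose w := [ffun d => (d \in D) && (f d (+) f (opp d))].
  have wc : chord_fun G w.
    apply/chord_funP; split=> d; rewrite !ffunE; first by case/andP.
    by rewrite opp_split oppK addbC.
  (* Invariance of f makes its increment along [next D] equal to w, so [P] is constant; its value is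
     the additive constant of the potential. *)
  pose P d := f d (+) psum G w d.
  have Pn d : d \in D -> P d = P (next D d).
    move=> dD; rewrite /P psum_next // ffunE next_split dD /= fn.
    by case: (f d); case: (f _); case: (psum _ _ _).
  have Pc := next_ind d0D Pn.
  have fE d : d \in D -> f d = P d0 (+) psum G w d.
    by move=> dD; rewrite -(Pc d dD) /P addbK.
  exists (w, P d0); last first.
    apply/ffunP => d; rewrite ffunE /=; have [dD|dD] := boolP (d \in D).
      exact: fE.
    by rewrite (contraNF (fD d)).
  rewrite !inE andbT /=; apply/ker_funP; split=> // d dD.
  have := psum_opp wc dD; rewrite [w d]ffunE dD /= fE // fE ?opp_split //.
  rewrite addbACA addbb addFb => h.
  by apply: (@addbI (psum G w d (+) psum G w (opp d))); rewrite addbF -h.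
rewrite !inE /= andbT => /ker_funP[wc wk] ->; apply/face_funP; split=> d.
  by rewrite ffunE => /andP[].
have [dD|dD] := boolP (d \in D); last first.
  by rewrite next_id // !ffunE opp_split (negbTE dD).
rewrite !ffunE opp_split next_split dD /=; congr (_ (+) _).
have dD' : next D d \in D by rewrite next_split.
have := psum_opp wc dD'; rewrite wk // psum_next //.
by case: (psum G w d); case: (w (next D d)); case: (psum G w (opp _)).
Qed.

End Genus.

Definition dcross n (d e : 'I_n * 'I_n) : bool := crossing d.1 d.2 e.1 e.2.

(** An alternating form with value one on the pair a, b has rank two exactly when it is the
    determinant of the coordinates given by pairing with a and b. The last condition is this
    identity on the edges. *)
Definition rank2 n (G : lcgraph n) a b : Prop :=
  [/\ G a.1 a.2, G b.1 b.2, dcross a b &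
    forall c d, G c.1 c.2 -> G d.1 d.2 ->
      dcross c d = (dcross c a && dcross b d) (+) (dcross c b && dcross a d)].

Lemma dcrossC n (d e : 'I_n * 'I_n) : dcross d e = dcross e d.
Proof. exact: crossingC. Qed.

Lemma dcross_oppr n (d e : 'I_n * 'I_n) : dcross d (opp e) = dcross d e.
Proof. exact: crossing_flipr. Qed.

Lemma dcross_irr n (d : 'I_n * 'I_n) : dcross d d = false.
Proof. exact: crossing_irrefl. Qed.

Section GenusOne.
Variables (n : nat) (G : lcgraph n).
Local Notation dart := ('I_n * 'I_n)%type.
Local Notation D := (split_points G).
Implicit Types (d e : dart) (w f : {ffun dart -> bool}).

Lemma opp_cycles : ncycles G (@split_alpha n) * 2 = size D.
Proof.
have closed : fclosed (@opp n) (mem D).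
  by move=> d _ /eqP <-; rewrite [RHS]opp_split.
rewrite -(card_uniqP (split_uniq G)); apply: (@fcard_order_set _ (@opp n)) => //.
  exact: inv_inj (@oppK n).
apply/subsetP => d dD; rewrite inE; apply/eqP.
have neq : d != opp d.
  apply/eqP => h; have := dart_neq dD; rewrite (congr1 fst h : d.1 = d.2).
  by rewrite eqxx.
have := @order_cycle _ (@opp n) [:: d; opp d]; apply.
- by rewrite /= oppK !eqxx.
- by rewrite /= inE neq.
- by rewrite inE eqxx.
Qed.

Lemma card_chord_fun : #|[set w | chord_fun G w]| = 2 ^ ncycles G (@split_alpha n).
Proof.
apply: (@card_invariant _ (@opp n)); first exact: inv_inj (@oppK n).
by move=> d _ /eqP <-; rewrite [RHS]opp_split.
Qed.

Lemma card_face_cycles : #|[set w | face_fun G w]| =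
  2 ^ ncycles G (@split_alpha n \o split_sigma G).
Proof.
apply: (@card_invariant _ (@split_alpha n \o split_sigma G)).
  by apply: inj_comp; [exact: inv_inj (@oppK n)|exact: next_split_inj].
by move=> d _ /eqP <-; rewrite [RHS]opp_split next_split.
Qed.

(** Since N = 2 z(alpha), genus one means z(alpha) = z(alpha^-1 sigma) + 1. After exponentiation,
    and with [card_face_fun], this says that the kernel has index four. *)
Lemma genus1_card : genus G = 1%R <->
  0 < size D /\ #|[set w | chord_fun G w]| = #|[set w | ker_fun G w]| * 4.
Proof.
have zE : (0 < size D /\
  ncycles G (@split_alpha n) = (ncycles G (@split_alpha n \o split_sigma G)).+1) <->
  0 < size D /\ #|[set w | chord_fun G w]| = #|[set w | ker_fun G w]| * 4.
  split=> -[D0 b]; split=> //; move: (card_face_fun D0).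
    by rewrite card_chord_fun card_face_cycles b expnS => ->; lia.
  rewrite card_face_cycles => h.
  have : #|[set w | chord_fun G w]| =
     2 ^ (ncycles G (@split_alpha n \o split_sigma G)).+1 by rewrite expnS; lia.
  by rewrite card_chord_fun => /eqP; rewrite eqn_exp2l // => /eqP.
rewrite -zE /genus -opp_cycles.
move: (ncycles _ _) (ncycles _ _) => z m; rewrite GRing.natrM.
split=> [h|[_ ->]]; last by rewrite -GRing.natr1; lra.
have /eqP : (m%:R = z.+1%:R :> rat)%R by rewrite -GRing.natr1; lra.
by rewrite Num.Theory.eqr_nat => /eqP ->.
Qed.

Definition ind e : {ffun dart -> bool} := [ffun d => (d == e) || (d == opp e)].

Lemma ind_chord e : e \in D -> chord_fun G (ind e).
Proof.
move=> eD; apply/chord_funP; split=> d; rewrite !ffunE.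
  by case/orP => /eqP -> //; rewrite opp_split.
by rewrite orbC -(inj_eq (inv_inj (@oppK n)) _ e) -[d == e]
  (inj_eq (inv_inj (@oppK n))) oppK.
Qed.

Lemma interlaceE w d : chord_fun G w ->
  interlace w d = \big[addb/false]_(e : dart | e.1 < e.2) (dcross d e && w e).
Proof.
move=> /chord_funP[wD ws].
rewrite /interlace (bigID (fun e : dart => e.1 < e.2)) /=.
rewrite [X in _ (+) X](bigID (fun e : dart => e.2 < e.1)) /=.
rewrite [X in _ (+) (_ (+) X)]big1 ?addbF; last first.
  case=> x y /=; rewrite -!leqNgt => /andP[xy yx].
  have /val_inj -> : val x = val y by apply/eqP; rewrite eqn_leq xy yx.
  by apply/negP => /andP[_ /wD/dart_neq]; rewrite eqxx.
rewrite [X in _ (+) X](reindex_inj (inv_inj (@oppK n))) /=.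
rewrite [X in _ (+) X](eq_bigl (fun e : dart => e.1 < e.2)); last first.
  by move=> e /=; case: ltngtP.
rewrite -big_split /=; apply: eq_bigr => e _; rewrite ws.
case: (w e); rewrite ?andbF // !andbT /dcross crossingE !in_open_arc /between.
lia.
Qed.

Lemma interlace_ind d e : e \in D -> interlace (ind e) d = dcross d e.
Proof.
move=> eD; rewrite interlaceE ?ind_chord //.
wlog lt : e eD / e.1 < e.2.
  move=> H; have := dart_neq eD; rewrite -val_eqE /=.
  case: (ltngtP e.1 e.2) => // lt _; first exact: H.
  rewrite -dcross_oppr -H ?opp_split //; apply: eq_bigr => f _.
  by rewrite !ffunE oppK orbC.
rewrite (bigD1 e) //= big1 ?addbF => [|f /andP[lf /negbTE fe]].
  by rewrite ffunE eqxx andbT.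
rewrite ffunE fe /=; case: eqP => [fE|]; rewrite ?andbF //.
by move: lf; rewrite fE /= ltnNge ltnW.
Qed.

Definition addf w w' : {ffun dart -> bool} := [ffun d => w d (+) w' d].

Lemma addf_chord w w' : chord_fun G w -> chord_fun G w' -> chord_fun G (addf w w').
Proof.
move=> /chord_funP[wD ws] /chord_funP[wD' ws']; apply/chord_funP; split=> d.
  by rewrite ffunE; case: (boolP (w d)) => [/wD //|_ /= /wD'].
by rewrite !ffunE ws ws'.
Qed.

Lemma interlace_add w w' d : interlace (addf w w') d = interlace w d (+) interlace w' d.
Proof. by rewrite /interlace -big_split; apply: eq_bigr => e _; rewrite ffunE andb_addr. Qed.

Definition scal (s : bool) w : {ffun dart -> bool} := [ffun d => s && w d].

Lemma scal_chord s w : chord_fun G w -> chord_fun G (scal s w).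
Proof.
move=> /chord_funP[wD ws]; apply/chord_funP; split=> d; rewrite !ffunE ?ws //.
by case/andP => _ /wD.
Qed.

Lemma interlace_scal s w d : interlace (scal s w) d = s && interlace w d.
Proof.
case: s; first by apply: eq_bigr => e _; rewrite ffunE.
by rewrite /interlace big1 // => e _; rewrite ffunE !andbF.
Qed.

Section Pair.
Variables (a b : dart).
Hypotheses (aD : a \in D) (bD : b \in D) (ab : dcross a b).

(** Adds multiples of the edges a and b to a kernel element. As a and b cross, the coefficients are
    read off by [interlace] at b and at a, so the map is injective; the kernel has index four
    exactly when it is onto. *)
Definition shift (u : {ffun dart -> bool} * bool * bool) :=
  addf (addf u.1.1 (scal u.1.2 (ind a))) (scal u.2 (ind b)).

Lemma shift_chord u : chord_fun G u.1.1 -> chord_fun G (shift u).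
Proof. by move=> c; rewrite !addf_chord // scal_chord // ind_chord. Qed.

Lemma interlace_shift u d : interlace (shift u) d =
  interlace u.1.1 d (+) (u.1.2 && dcross d a) (+) (u.2 && dcross d b).
Proof. by rewrite !interlace_add !interlace_scal !interlace_ind. Qed.

Lemma shift_inj : {in setX (setX [set w | ker_fun G w] [set: bool]) [set: bool] &,
  injective shift}.
Proof.
move=> [[w s] t] [[w' s'] t']; rewrite !inE /= !andbT => /ker_funP[wc wk] /ker_funP[wc' wk'] eqs.
have := congr1 (fun f => interlace f a) eqs.
rewrite !interlace_shift /= wk // wk' // dcross_irr ab !andbF !andbT /= => tt; subst t'.
have := congr1 (fun f => interlace f b) eqs.
rewrite !interlace_shift /= wk // wk' // dcross_irr dcrossC ab !andbF !andbT /= !addbF => ss; subst s'.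
congr (_, _, _); apply/ffunP => d; have /ffunP/(_ d) := eqs.
by rewrite !ffunE /= => /addIb/addIb.
Qed.

Lemma rank2_card : rank2 G a b <->
  #|[set w | chord_fun G w]| = #|[set w | ker_fun G w]| * 4.
Proof.
have -> : #|[set w | ker_fun G w]| * 4 =
  #|shift @: setX (setX [set w | ker_fun G w] [set: bool]) [set: bool]|.
  by rewrite (card_in_imset shift_inj) !cardsX !cardsT !card_bool -mulnA.
set I := shift @: _.
have sub : I \subset [set w | chord_fun G w].
  apply/subsetP => f /imsetP[u]; rewrite !inE !andbT => /ker_funP[c _] ->.
  exact: shift_chord.
split=> [[_ _ _ id2]|eqc].
  suff -> : I = [set w | chord_fun G w] by [].
  apply/eqP; rewrite eqEsubset sub; apply/subsetP => v; rewrite inE => vc.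
  (* The kernel part of v is v shifted by its own pairings with b and a; over F_2 shifting twice
     gives v back. *)
  apply/imsetP; pose s := interlace v b; pose t := interlace v a.
  exists (shift (v, s, t), s, t); last first.
    by apply/ffunP => d; rewrite !ffunE /=; case: (v d); case: (_ && _); case: (_ && _).
  rewrite !inE !andbT; apply/ker_funP; split; first exact: shift_chord.
  move=> d dD; rewrite interlace_shift /=.
  suff -> : interlace v d = (s && dcross d a) (+) (t && dcross d b).
    by case: (_ && _); case: (_ && _).
  rewrite /s /t !interlaceE //.
  rewrite ![(\big[_/_]_(_ | _) _) && _]andbC.
  rewrite !big_distrr -big_split /=; apply: eq_bigr => e _.
  case: (boolP (v e)) => [ve|]; rewrite ?andbF // !andbT.
  have [vD _] := chord_funP _ _ vc.
  by apply: id2; [move: dD | move: (vD e ve)]; rewrite mem_split.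
have eqI : I = [set w | chord_fun G w] by apply/eqP; rewrite eqEcard sub eqc leqnn.
split; rewrite -?mem_split // => c d; rewrite -!mem_split => cD dD.
have : ind c \in I by rewrite eqI inE ind_chord.
case/imsetP => -[[w s] t]; rewrite !inE !andbT /= => /ker_funP[wc wk] eqc'.
have E e : e \in D -> dcross e c = (s && dcross e a) (+) (t && dcross e b).
  by move=> eD; rewrite -interlace_ind // eqc' interlace_shift /= wk.
have := E a aD; rewrite dcross_irr ab andbF andbT /= => ta.
have := E b bD; rewrite dcross_irr dcrossC [dcross b a]dcrossC ab andbF andbT addbF => sb.
by rewrite [LHS]dcrossC E // -ta -sb [dcross c a]dcrossC [dcross c b]dcrossC [dcross d a]dcrossC [dcross d b]dcrossC addbC.
Qed.

End Pair.

(** Any crossing pair can serve as a and b. Without crossings the kernel would be everything, and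
    its index one. *)
Theorem genus1P : genus G = 1%R <-> exists a b, rank2 G a b.
Proof.
split=> [/genus1_card[D0 eqc]|[a [b r]]]; last first.
  have [ha hb hab _] := r; rewrite -?mem_split in ha hb.
  apply/genus1_card; split; first by case: (D) ha.
  exact/(rank2_card ha hb hab).
have [/existsP[a /existsP[b /and3P[aD bD ab]]]|nex] :=
  boolP [exists a : dart, exists b : dart, [&& a \in D, b \in D & dcross a b]].
  by exists a, b; apply/(rank2_card aD bD ab).
have eqK : [set w | ker_fun G w] = [set w | chord_fun G w].
  apply/setP => w; rewrite !inE; apply/idP/idP => [/ker_funP[]//|wc].
  apply/ker_funP; split=> // d dD; rewrite interlaceE // big1 // => e _.
  apply/negP => /andP[de we]; case/negP: nex; apply/existsP; exists d.
  apply/existsP; exists e; rewrite dD de andbT.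
  by have [-> ] := chord_funP _ _ wc.
move: eqc; rewrite eqK card_chord_fun.
by have := expn_gt0 2 (ncycles G (@split_alpha n)); lia.
Qed.

End GenusOne.

(** * Crossed edges and parallel classes *)

(** [joined] asks for a path without repetitions that contains both end edges. A mere connection
    from A to x is shortened by induction if it runs through B or y, and is otherwise extended by
    them. *)
Lemma joining_path (V : finType) (R : rel V) (A B x y : V) (p : seq V) :
  symmetric R -> irreflexive R -> R A B -> R x y ->
  path R A p -> x = last A p ->
  exists q : seq V, [/\ uniq q, sorted R q,
     prefix [:: A; B] q || prefix [:: B; A] q
   & suffix [:: x; y] q || suffix [:: y; x] q].
Proof.
move=> Rs Ri; have neq u v : R u v -> u != v.
  by apply: contraTneq => ->; rewrite Ri.
have [k] := ubnP (size p); elim: k A B x y p => // k IH A B x y p0 lt AB xy pp0.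
case/shortenP: pp0 => p pp up sub ex.
have {}lt : size p <= k.
  by rewrite -ltnS; apply: leq_ltn_trans lt; apply: uniq_leq_size sub; case/andP: up.
have [Bp|Bp] := boolP (B \in p).
  case/splitPr: Bp pp up ex lt => p1 p2; rewrite cat_path /= last_cat /=.
  case/and3P => _ _ pp2 _ ex lt.
  have [||q [uq sq pq sfq]] := IH B A x y p2 _ _ xy pp2 ex.
  - by move: lt; rewrite size_cat /=; lia.
  - by rewrite Rs.
  by exists q; split=> //; rewrite orbC.
have [yp|yp] := boolP (y \in A :: p).
  have [p1 pp1 [ey lt1]] : exists2 p1, path R A p1 & y = last A p1 /\ size p1 < size p.
    move: yp; rewrite inE => /orP[/eqP yA|yp].
      exists [::] => //; split=> //; case: (p) ex => //= xA.
      by have := neq _ _ xy; rewrite xA yA eqxx.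
    case/path.splitP: yp pp ex => p1 p2; rewrite cat_path last_cat last_rcons => /andP[pp1 _] ex.
    exists (rcons p1 y) => //; rewrite last_rcons; split=> //.
    rewrite size_cat; case: p2 ex => [/= xyE|]; last by move=> *; rewrite /=; lia.
    by have := neq _ _ xy; rewrite xyE eqxx.
  have [||q [uq sq pq sfq]] := IH A B y x p1 _ AB _ pp1 ey.
  - by apply: leq_trans lt1 _.
  - by rewrite Rs.
  by exists q; split=> //; rewrite orbC.
(* Extending at both ends would use the vertex y = B twice; the path A, B, x contains both edges. *)
have [yB|yB] := eqVneq y B.
  have [xA|xA] := eqVneq x A.
    exists [:: A; B]; split=> //=; first by rewrite inE neq.
    - by rewrite AB.
    - by rewrite !eqxx.
    by rewrite xA yB suffix_refl.
  exists [:: A; B; x]; split=> //=.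
  - by rewrite !inE negb_or neq //= eq_sym xA -yB eq_sym neq.
  - by rewrite AB -yB Rs xy.
  - by rewrite !eqxx.
  by rewrite yB orbC; apply/orP; left; apply/suffixP; exists [:: A].
exists (B :: A :: rcons p y); split.
- have BA : B \notin A :: p by rewrite inE negb_or eq_sym neq.
  by rewrite cons_uniq -rcons_cons mem_rcons inE negb_or (eq_sym B) yB BA rcons_uniq yp up.
- by rewrite /= Rs AB rcons_path pp -ex.
- by apply/orP; right; rewrite /= !eqxx ?prefix0s.
apply/orP; left; apply/suffixP; exists (B :: belast A p).
by rewrite ex cat_cons -cat_rcons -lastI cats1.
Qed.

Section Crossings.
Variables (n : nat) (T : lcgraph n).
Implicit Types (x y z u v : 'I_n).

Lemma crossed_sym x y : crossed T x y = crossed T y x.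
Proof.
rewrite /crossed adj_sym; congr (_ && _).
by apply: eq_existsb => u; apply: eq_existsb => v; rewrite crossing_flip.
Qed.

Lemma uncrossed_sym x y : uncrossed T x y = uncrossed T y x.
Proof. by rewrite /uncrossed crossed_sym adj_sym. Qed.

Lemma crossedP x y :
  reflect (T x y /\ exists u v, T u v /\ crossing x y u v) (crossed T x y).
Proof.
apply: (iffP andP) => [[-> /existsP[u /existsP[v /andP[]]]]|[-> [u [v [uv c]]]]].
  by split=> //; exists u, v.
by split=> //; apply/existsP; exists u; apply/existsP; exists v; rewrite uv.
Qed.

Lemma crossed_edge x y : crossed T x y -> T x y. Proof. by case/andP. Qed.

Lemma edge_neq x y : T x y -> x != y.
Proof. by apply: contraTneq => ->; rewrite adj_irrefl. Qed.

Lemma crossing_crossed x y u v : T x y -> T u v -> crossing x y u v -> crossed T x y.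
Proof. by move=> xy uv c; apply/crossedP; split=> //; exists u, v. Qed.

Lemma uncrossed_nc x y u v : uncrossed T x y -> T u v -> crossing x y u v = false.
Proof.
case/andP => xy nc uv; apply/negP => c; case/negP: nc.
exact: crossing_crossed c.
Qed.

Lemma uncrossed_edge x y : uncrossed T x y -> T x y. Proof. by case/andP. Qed.

Lemma edge_cases x y : T x y -> crossed T x y \/ uncrossed T x y.
Proof. by rewrite /uncrossed => ->; case: crossed; [left|right]. Qed.

Lemma parallelP x y x' y' :
  reflect [/\ T x y, T x' y' &
             forall u v, T u v -> crossing x y u v = crossing x' y' u v]
          (parallel T x y x' y').
Proof.
apply: (iffP and3P) => -[xy xy' h]; split=> //.
  by move=> u v uv; have /forallP/(_ u)/forallP/(_ v) := h; rewrite uv => /eqP.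
by apply/forallP => u; apply/forallP => v; apply/implyP => /h ->.
Qed.

Lemma parallel_refl x y : T x y -> parallel T x y x y.
Proof. by move=> xy; apply/parallelP. Qed.

Lemma parallel_flip x y x' y' : parallel T x y y' x' = parallel T x y x' y'.
Proof.
suff h a b : parallel T x y a b -> parallel T x y b a by apply/idP/idP; exact: h.
case/parallelP => xy ab h; apply/parallelP; split=> //; first by rewrite adj_sym.
by move=> u v uv; rewrite h // crossing_flip.
Qed.

Lemma parallel_sym x y x' y' : parallel T x y x' y' = parallel T x' y' x y.
Proof.
suff h a b c d : parallel T a b c d -> parallel T c d a b by apply/idP/idP; exact: h.
by case/parallelP => ab cd h; apply/parallelP; split=> // u v /h.
Qed.

Lemma parallel_trans x y x' y' x'' y'' :
  parallel T x y x' y' -> parallel T x' y' x'' y'' -> parallel T x y x'' y''.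
Proof.
case/parallelP => ab cd h /parallelP[_ ef h']; apply/parallelP; split=> // u v uv.
by rewrite h // h'.
Qed.

Lemma parallel_nc x y x' y' : parallel T x y x' y' -> crossing x y x' y' = false.
Proof. by case/parallelP => xy xy' h; rewrite h // crossing_irrefl. Qed.

Lemma parallel_crossed x y x' y' :
  parallel T x y x' y' -> crossed T x y -> crossed T x' y'.
Proof.
case/parallelP => xy xy' h /crossedP[_ [u [v [uv c]]]].
by apply/crossedP; split=> //; exists u, v; rewrite -h.
Qed.

Definition jrel A B : rel 'I_n := fun u v => uncrossed T u v || parallel T A B u v.

Lemma jrel_sym A B : symmetric (jrel A B).
Proof. by move=> u v; rewrite /jrel uncrossed_sym parallel_flip. Qed.

Lemma jrel_edge A B u v : jrel A B u v -> T u v.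
Proof. by case/orP => [/uncrossed_edge|/parallelP[]]. Qed.

Lemma jrel_nc A B u v x y : parallel T A B x y -> jrel A B u v ->
  crossing x y u v = false.
Proof.
move=> par /orP[un|par'].
  by rewrite crossingC uncrossed_nc //; case/parallelP: par.
by apply: parallel_nc; apply: parallel_trans par'; rewrite parallel_sym.
Qed.

Lemma jrel_parallel A B A' B' : parallel T A B A' B' -> jrel A B =2 jrel A' B'.
Proof.
move=> par u v; congr (_ || _); apply/idP/idP; last exact: parallel_trans.
by apply: parallel_trans; rewrite parallel_sym.
Qed.

Lemma crossing_move z z' x y w : crossing z z' x y ->
  crossing z z' x w = false -> w != z -> w != z' -> crossing z z' w y.
Proof.
rewrite !crossingE -!val_eqE /between /=.
by case: (ltngtP z z'); case: (ltngtP z x); case: (ltngtP z' x) => //=; lia.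
Qed.

(** A walk whose edges do not cross the chord zz' can change sides only at z or z'. *)
Lemma separate_path (R : rel 'I_n) z z' x p :
  (forall u v, R u v -> crossing z z' u v = false) ->
  path R x p -> crossing z z' x (last x p) -> (z \in p) || (z' \in p).
Proof.
move=> nc; elim: p x => [x _|w p IH x] /=; first by rewrite !crossingE /between; lia.
case/andP => xw wp c; rewrite !inE.
case: (eqVneq z w) => //= zw; case: (eqVneq z' w) => //= zw'; rewrite ?orbT //.
apply: (IH w) => //; apply: crossing_move c (nc _ _ xw) _ _; by rewrite eq_sym.
Qed.

Lemma separate_connect (R : rel 'I_n) z z' x y :
  (forall u v, R u v -> crossing z z' u v = false) ->
  connect R x y -> crossing z z' x y -> connect R x z || connect R x z'.
Proof.
move=> nc /connectP[p pp ->] c.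
case/orP: (separate_path nc pp c) => h; apply/orP; [left|right];
  by apply: (path_connect pp); rewrite inE h orbT.
Qed.

Lemma jconnect_sym A B : connect_sym (jrel A B).
Proof. exact: (sym_connect_sym (@jrel_sym A B)). Qed.

(** The parallel edges of the e-graph of AB. Plain connectivity in place of [joined] makes this
    visibly an equivalence relation on edges. *)
Definition eclass A B x y := parallel T A B x y && connect (jrel A B) A x.

Lemma eclass_refl A B : T A B -> eclass A B A B.
Proof. by move=> AB; rewrite /eclass parallel_refl //=. Qed.

Lemma eclass_flip A B x y : eclass A B y x = eclass A B x y.
Proof.
rewrite /eclass parallel_flip; have [par /=|//] := boolP (parallel T A B x y).
have c : connect (jrel A B) x y by apply: connect1; rewrite /jrel par orbT.
by rewrite (same_connect_r (jconnect_sym A B) c).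
Qed.

Lemma eclass_parallel A B x y : eclass A B x y -> parallel T A B x y.
Proof. by case/andP. Qed.

Lemma eclass_edge A B x y : eclass A B x y -> T x y.
Proof. by case/andP => /parallelP[]. Qed.

Lemma eclass_eq A B x y : eclass A B x y -> eclass A B =2 eclass x y.
Proof.
case/andP => par con u v; rewrite /eclass (eq_connect (jrel_parallel par)).
rewrite (eq_connect (jrel_parallel par)) in con.
rewrite (same_connect (jconnect_sym x y) con); congr (_ && _).
apply/idP/idP; last exact: parallel_trans.
by apply: parallel_trans; rewrite parallel_sym.
Qed.

Lemma eclass_sym A B x y : eclass A B x y -> eclass x y A B.
Proof. by move=> c; rewrite -(eclass_eq c) eclass_refl //; case/andP: c => /parallelP[]. Qed.

Lemma joinedP A B x y : parallel T A B x y ->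
  joined T A B x y <-> connect (jrel A B) A x.
Proof.
move=> par; have [AB xy _] := parallelP _ _ _ _ par.
have JAB : jrel A B A B by rewrite /jrel parallel_refl ?orbT.
have Jxy : jrel A B x y by rewrite /jrel par orbT.
have nAB := edge_neq AB; have nxy := edge_neq xy.
have sy := jconnect_sym A B.
split=> [[q [uq sq pq sfq]]|].
  have in1 : {in q &, forall u v, connect (jrel A B) u v}.
    case: q uq sq {pq sfq} => // u q _ /= pq v w vq wq.
    apply: (connect_trans (y := u)); last exact: (path_connect pq).
    by rewrite sy; apply: (path_connect pq).
  apply: in1.
    by case/orP: pq => /prefixP[s ->]; rewrite !inE eqxx ?orbT.
  by case/orP: sfq => /suffixP[s ->]; rewrite mem_cat !inE eqxx ?orbT.
case/connectP => p pp ex; apply: (joining_path _ _ JAB Jxy pp ex).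
  exact: jrel_sym.
by move=> u; apply/negP => /jrel_edge; rewrite adj_irrefl.
Qed.

End Crossings.

(** * Inequalities for points in cyclic order *)

Definition ncrossing (x y u v : nat) :=
  between x u y && between y v x || between x v y && between y u x.
Definition inarc (x y z : nat) := [|| z == x, z == y | between x z y].

(** The cyclic order C < p < D <= E < q < F <= C, cut open at each of its six places. CD and FE are
    the outermost edges of an e-graph, and p and q are the ends of an edge crossing it, one in each
    gap between the arcs. *)
Definition hexorder (C p D E q F : nat) : Prop :=
  (p < D /\ D <= E /\ E < q /\ q < F /\ F <= C) \/
  (D <= E /\ E < q /\ q < F /\ F <= C /\ C < p) \/
  (E < q /\ q < F /\ F <= C /\ C < p /\ p < D) \/
  (q < F /\ F <= C /\ C < p /\ p < D /\ D <= E) \/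
  (F <= C /\ C < p /\ p < D /\ D <= E /\ E < q) \/
  (C < p /\ p < D /\ D <= E /\ E < q /\ q < F).

Lemma arc_order n (C D E F : 'I_n) : C != D -> F != E ->
  cdist D E <= cdist D F -> cdist D F <= cdist D C ->
  (D <= E /\ E < F /\ F <= C) \/ (E < F /\ F <= C /\ C < D) \/
  (F <= C /\ C < D /\ D <= E) \/ (C < D /\ D <= E /\ E < F).
Proof.
rewrite -!val_eqE /= !cdistE.
have := ltn_ord C; have := ltn_ord D; have := ltn_ord E; have := ltn_ord F.
by case: (ltngtP D E); case: (ltngtP D F); case: (ltngtP D C) => //=; lia.
Qed.

Lemma hexorder_ex (C D E F p q : nat) :
  (D <= E /\ E < F /\ F <= C) \/ (E < F /\ F <= C /\ C < D) \/
  (F <= C /\ C < D /\ D <= E) \/ (C < D /\ D <= E /\ E < F) ->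
  ncrossing C D p q -> ncrossing F E p q ->
  hexorder C p D E q F \/ hexorder C q D E p F.
Proof.
have aux p' q' : between C p' D -> ncrossing F E p' q' ->
    (D <= E /\ E < F /\ F <= C) \/ (E < F /\ F <= C /\ C < D) \/
    (F <= C /\ C < D /\ D <= E) \/ (C < D /\ D <= E /\ E < F) ->
    hexorder C p' D E q' F.
  move=> hp hc ord.
  have {hc} hq : between E q' F.
    by move: hp hc; rewrite /ncrossing /between; case: ord => [?|[?|[?|?]]]; lia.
  rewrite /hexorder; move: hp hq.
  by case: ord => [?|[?|[?|?]]] /or3P[] ? /or3P[] ?; first
    [exfalso; lia | left; lia | right; left; lia | do 2 right; left; lia
    | do 3 right; left; lia | do 4 right; left; lia | do 5 right; lia].
move=> ord /orP[]/andP[hp _] hc; [left|right]; apply: aux => //.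
by move: hc; rewrite /ncrossing orbC.
Qed.

Ltac hexlia := rewrite /ncrossing /inarc /between; move=> [?|[?|[?|[?|[?|?]]]]]; lia.

Section HexOrder.
Variables (C p D E q F : nat).
Hypothesis H : hexorder C p D E q F.

Lemma hex_out z : ~~ inarc D E z -> ~~ inarc F C z -> between C z D || between E z F.
Proof. by move: H; hexlia. Qed.
Lemma hex_nc2 z z' : inarc D E z -> ncrossing C D z z' -> ~~ ncrossing F E z z'.
Proof. by move: H; hexlia. Qed.
Lemma hex_cap_cross z z' : inarc D E z || inarc F C z -> between C z' D ->
  z != C -> z != D -> ncrossing C D z z'.
Proof. by move: H; hexlia. Qed.
Lemma hex_capcap z z' : between C z D -> between E z' F -> ncrossing C D z z'.
Proof. by move: H; hexlia. Qed.
Lemma hex_side z z' : inarc D E z -> inarc D E z' -> ~~ ncrossing p q z z'.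
Proof. by move: H; hexlia. Qed.
Lemma hex_disj z : inarc D E z -> ~~ inarc F C z.
Proof. by move: H; hexlia. Qed.
Lemma hex_chord z z' : inarc D E z -> z != D -> z != E -> inarc F C z' ->
  z' != C -> z' != F -> ncrossing z z' C E.
Proof. by move: H; hexlia. Qed.
Lemma hex_pq z z' : inarc D E z -> inarc F C z' -> ncrossing p q z z'.
Proof. by move: H; hexlia. Qed.
Lemma hex_swap : hexorder E q F C p D.
Proof. by move: H; rewrite /hexorder; lia. Qed.
End HexOrder.

Lemma arc_nc (D E x u s s' : nat) : inarc D E x -> inarc D E u -> ~~ inarc D E s ->
  ~~ inarc D E s' -> ~~ ncrossing s s' x u.
Proof.
rewrite /inarc => hx hu hs hs'; apply/negP => /orP[]/andP[]; move: hx hu hs hs'.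
  by rewrite /between; case: (ltngtP D E); lia.
by rewrite /between; case: (ltngtP D E); lia.
Qed.

(** * E-graphs *)

(** Not crossing is thus transitive among crossed edges: their crossing graph is complete
    multipartite, with the parallel classes as parts. Most of the geometry uses genus one only in
    this form. *)
Definition multipartite n (T : lcgraph n) := forall x y u v z t,
  T x y -> T u v -> crossing x y u v -> crossed T z t ->
  crossing z t x y || crossing z t u v.

Lemma rank2_multipartite n (T : lcgraph n) a b : rank2 T a b -> multipartite T.
Proof.
case=> aT bT _ id2 x y u v z t xy uv c /crossedP[zt [s [r [sr c']]]].
have E := id2 (z, t) (s, r) zt sr; have E1 := id2 (z, t) (x, y) zt xy.
have E2 := id2 (z, t) (u, v) zt uv; have E3 := id2 (x, y) (u, v) xy uv.
move: E E1 E2 E3; rewrite /dcross /= c' c => E -> -> E3; move: E E3.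
rewrite !(crossingC x y).
by case: (crossing z t _ _); case: (crossing z t _ _); case: (crossing _ _ x y);
  case: (crossing _ _ x y); case: (crossing _ _ u v); case: (crossing _ _ u v).
Qed.

(** Four mutually crossing edges would give four pairwise independent vectors in F_2^2, which has
    only three nonzero ones. *)
Lemma rank2_no4 n (T : lcgraph n) a b : rank2 T a b ->
  forall c1 c2 c3 c4, T c1.1 c1.2 -> T c2.1 c2.2 -> T c3.1 c3.2 -> T c4.1 c4.2 ->
  ~~ [&& dcross c1 c2, dcross c1 c3, dcross c1 c4, dcross c2 c3, dcross c2 c4 & dcross c3 c4].
Proof.
case=> aT bT _ id2 c1 c2 c3 c4 h1 h2 h3 h4.
rewrite (id2 c1 c2) // (id2 c1 c3) // (id2 c1 c4) // (id2 c2 c3) // (id2 c2 c4) // (id2 c3 c4) //.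
rewrite (dcrossC c1 a) (dcrossC c1 b) (dcrossC c2 a) (dcrossC c2 b) (dcrossC c3 a) (dcrossC c3 b).
by case: (dcross a c1); case: (dcross a c2); case: (dcross a c3); case: (dcross a c4);
  case: (dcross b c1); case: (dcross b c2); case: (dcross b c3); case: (dcross b c4).
Qed.

Lemma in_arcE n (x y u : 'I_n) : (u \in arc x y) = inarc x y u.
Proof. by rewrite in_arc /inarc -!val_eqE. Qed.

Lemma crossing_ncrossing n (x y u v : 'I_n) : crossing x y u v = ncrossing x y u v.
Proof. exact: crossingE. Qed.

Section EgraphTheory.
Variables (n : nat) (T : lcgraph n).
Hypothesis conn : forall x y, connect T x y.
Hypothesis multi : multipartite T.
Implicit Types (A B C D E F x y z u v p q : 'I_n).

Lemma nc_parallel A B z t : crossed T A B -> crossed T z t ->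
  crossing A B z t = false -> parallel T A B z t.
Proof.
move=> AB zt nc; apply/parallelP; split; rewrite ?crossed_edge // => u v uv.
apply/idP/idP => c.
  by have := multi (crossed_edge AB) uv c zt; rewrite crossingC nc.
by have := multi (crossed_edge zt) uv c AB; rewrite nc.
Qed.

(** What is needed of the ordered list of an e-graph: its outermost edges, an edge pq crossing it,
    and that its parallel edges run from one arc to the other. The description is symmetric under
    exchange of the arcs. *)
Record edesc A B C D E F p q : Prop := EDesc {
  ed_crossed : crossed T A B;
  ed_CD : eclass T A B C D;
  ed_FE : eclass T A B F E;
  ed_pq : T p q;
  ed_hex : hexorder C p D E q F;
  ed_arcs : forall x y, eclass T A B x y ->
    (x \in arc F C) && (y \in arc D E) || (y \in arc F C) && (x \in arc D E) }.

Definition arcs2 C D E F : {set 'I_n} := arc D E :|: arc F C.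

Definition eset A B C D E F : {set 'I_n * 'I_n} :=
  [set e | [&& e.1 \in arcs2 C D E F, e.2 \in arcs2 C D E F
             & uncrossed T e.1 e.2 || parallel T A B e.1 e.2]].

Lemma edesc_swap A B C D E F p q :
  edesc A B C D E F p q -> edesc A B E F C D q p.
Proof.
case=> AB CD FE pq hex arcs; split=> //; rewrite 1?eclass_flip //.
- by rewrite adj_sym.
- exact: hex_swap hex.
by move=> x y /arcs; rewrite orbC ![(_ \in arc F C) && _]andbC.
Qed.

Section Desc.
Variables A B C D E F p q : 'I_n.
Hypothesis ed : edesc A B C D E F p q.
Let AB := ed_crossed ed.
Let CD := ed_CD ed.
Let FE := ed_FE ed.
Let hex := ed_hex ed.
Local Notation J := (jrel T A B).
Local Notation S := (arcs2 C D E F).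

Lemma in_arcs2 z : (z \in S) = inarc D E z || inarc F C z.
Proof. by rewrite inE !in_arcE. Qed.

(** From the arc DE no edge crosses both CD and FE, so zz' does not cross AB and is parallel to it.
    It then crosses pq and ends on the other arc. Unless it shares an end with an outermost edge, it
    separates C from E; these are joined by [jrel] edges, none of which crosses zz', so that path
    meets z or z'. *)
Lemma arc_crossed z z' : crossed T z z' -> z \in arc D E -> eclass T A B z z'.
Proof.
move=> zz'; rewrite in_arcE => zDE.
have pCD := eclass_parallel CD; have pFE := eclass_parallel FE.
have tCD := eclass_edge CD; have tFE := eclass_edge FE; have tz := crossed_edge zz'.
have [c|nc] := boolP (crossing A B z z').
  case/parallelP: pCD => _ _ hCD; case/parallelP: pFE => _ _ hFE.
  have c1 : ncrossing C D z z' by rewrite -crossing_ncrossing -hCD.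
  have c2 : ncrossing F E z z' by rewrite -crossing_ncrossing -hFE.
  by have := hex_nc2 hex zDE c1; rewrite c2.
have par : parallel T A B z z' by apply: nc_parallel => //; apply: negbTE.
rewrite /eclass par /=.
have [cC cF] : connect J A C /\ connect J A F.
  by case/andP: CD => _ ->; case/andP: FE => _ ->.
have cD : connect J A D by apply: connect_trans cC _; apply: connect1; rewrite /jrel pCD orbT.
have cE : connect J A E by apply: connect_trans cF _; apply: connect1; rewrite /jrel pFE orbT.
have cz' : connect J z' z by apply: connect1; rewrite jrel_sym /jrel par orbT.
have [->//|zD] := eqVneq z D; have [->//|zE] := eqVneq z E.
have cpq : crossing z z' p q.
  case/parallelP: par => _ _ <-; last exact: ed_pq ed.
  case/parallelP: pCD => _ _ ->; last exact: ed_pq ed.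
  by rewrite crossingC crossing_flipr crossing_ncrossing; apply: (hex_pq hex);
    rewrite /inarc eqxx ?orbT.
have nCD : ncrossing C D z z' = false.
  rewrite -crossing_ncrossing; apply: parallel_nc; apply: parallel_trans par.
  by rewrite parallel_sym.
have nFE : ncrossing F E z z' = false.
  rewrite -crossing_ncrossing; apply: parallel_nc; apply: parallel_trans par.
  by rewrite parallel_sym.
have z'S : inarc D E z' || inarc F C z'.
  case: (boolP (inarc D E z')) => //= h1; apply: contraT => h2.
  have nz w : w \in [:: C; D; E; F] -> z != w.
    rewrite !inE; have dis := hex_disj hex zDE.
    case/or4P => /eqP -> //; apply: contraNneq dis => ->; by rewrite /inarc eqxx ?orbT.
  case/orP: (hex_out hex h1 h2) => h.
    have := hex_cap_cross hex (z := z) (z' := z') _ h.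
    by rewrite nCD zDE !nz ?inE ?eqxx ?orbT // => /(_ isT isT isT).
  have := hex_cap_cross (hex_swap hex) (z := z) (z' := z') _ h.
  rewrite zDE orbT !nz ?inE ?eqxx ?orbT // => /(_ isT isT isT).
  by rewrite -crossing_ncrossing crossing_flip crossing_ncrossing nFE.
have z'FC : inarc F C z'.
  case/orP: z'S => // h; have := hex_side hex zDE h.
  by rewrite -crossing_ncrossing crossingC cpq.
have [eC|z'C] := eqVneq z' C; first by apply: connect_trans cC _; rewrite -eC.
have [eF|z'F] := eqVneq z' F; first by apply: connect_trans cF _; rewrite -eF.
have CE : connect J C E by apply: connect_trans cE; rewrite jconnect_sym.
have cr := hex_chord hex zDE zD zE z'FC z'C z'F; rewrite -crossing_ncrossing in cr.
have := @separate_connect _ J z z' C E (fun u v => jrel_nc par) CE cr.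
case/orP => h; apply: connect_trans cC _ => //.
exact: connect_trans h cz'.
Qed.

End Desc.
End EgraphTheory.

Lemma arcs_meet (D E D' E' z : nat) : inarc D E z -> inarc D' E' z ->
  inarc D' E' D || inarc D E D'.
Proof.
rewrite /inarc /between; case: (ltngtP D E) => ?; case: (ltngtP D' E') => ?; lia.
Qed.

(** Cyclic order is invariant under rotation, so the circle may be cut at p and distances from p
    used as linear coordinates. *)
Lemma between_cdist n (p x u y : 'I_n) :
  between (cdist p x) (cdist p u) (cdist p y) = between x u y.
Proof.
have := ltn_ord x; have := ltn_ord y; have := ltn_ord u; have := ltn_ord p.
rewrite !cdistE /between.
by case: (leqP p x) => ?; case: (leqP p u) => ?; case: (leqP p y) => ?; lia.
Qed.

Lemma cdist_cdist n (p x y : 'I_n) : cdist x y =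
  if cdist p x <= cdist p y then cdist p y - cdist p x
  else cdist p y + n - cdist p x.
Proof.
have := ltn_ord x; have := ltn_ord y; have := ltn_ord p.
rewrite !cdistE => ? ? ?.
by case: (leqP p x) => ?; case: (leqP p y) => ?; case: (leqP x y) => ?;
  case: leqP => ?; lia.
Qed.

Lemma cdist_inj n (p : 'I_n) : injective (cdist p).
Proof.
move=> x y; have := ltn_ord x; have := ltn_ord y; have := ltn_ord p.
rewrite !cdistE => hp hx hy h; apply: val_inj => /=.
by move: h; case: (leqP p x) => ?; case: (leqP p y) => ?; lia.
Qed.

Lemma cdist_lt n (p x : 'I_n) : cdist p x < n.
Proof. by rewrite /cdist ltn_pmod //; case: n p {x} => [[]|]. Qed.

Lemma cdist0 n (p : 'I_n) : cdist p p = 0.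
Proof. by rewrite cdistE leqnn subnn. Qed.

Lemma hex_cdist n (C p D E q F : 'I_n) : hexorder C p D E q F ->
  [/\ 0 < cdist p D, cdist p D <= cdist p E, cdist p E < cdist p q,
      cdist p q < cdist p F & cdist p F <= cdist p C].
Proof.
have := ltn_ord C; have := ltn_ord D; have := ltn_ord E; have := ltn_ord F.
have := ltn_ord p; have := ltn_ord q.
rewrite !cdistE => ? ? ? ? ? ? h; split;
  do ?case: (leqP p _) => ?; move: h; rewrite /hexorder; lia.
Qed.

Lemma inarc_cdist n (p D E z : 'I_n) : cdist p D <= cdist p E ->
  inarc D E z = (cdist p D <= cdist p z <= cdist p E).
Proof.
move=> le; rewrite -in_arcE inE (cdist_cdist p D z) (cdist_cdist p D E) le.
by have := cdist_lt p E; case: (leqP (cdist p D) (cdist p z)); lia.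
Qed.

(** * Connectedness and disjointness of e-graphs *)

Section EgraphTheory.
Variables (n : nat) (T : lcgraph n).
Hypothesis conn : forall x y, connect T x y.
Hypothesis multi : multipartite T.
Implicit Types (A B C D E F x y z u v p q : 'I_n).

Section Desc.
Variables A B C D E F p q : 'I_n.
Hypothesis ed : edesc T A B C D E F p q.
Local Notation J := (jrel T A B).
Local Notation S := (arcs2 C D E F).
Local Notation es := (eset T A B C D E F).

Lemma arcs2_swap : arcs2 C D E F = arcs2 E F C D.
Proof. by rewrite /arcs2 setUC. Qed.

Lemma S_crossed z z' : crossed T z z' -> z \in S -> eclass T A B z z'.
Proof.
move=> zz'; rewrite in_setU => /orP[|zFC]; first exact: (arc_crossed multi ed).
exact: (arc_crossed multi (edesc_swap ed)).
Qed.

Lemma eclass_arcs x y : eclass T A B x y -> x \in S /\ y \in S.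
Proof.
by move/(ed_arcs ed) => /orP[]/andP[h1 h2]; rewrite !in_setU h1 h2 ?orbT.
Qed.

Lemma A_in : A \in S.
Proof. by have [] := eclass_arcs (eclass_refl (crossed_edge (ed_crossed ed))). Qed.

Lemma eclass_eset x y : eclass T A B x y -> (x, y) \in es.
Proof.
by move=> c; have [xS yS] := eclass_arcs c; rewrite inE xS yS (eclass_parallel c) orbT.
Qed.

Lemma eset_sym x y : ((x, y) \in es) = ((y, x) \in es).
Proof. by rewrite !inE /= uncrossed_sym parallel_flip andbCA. Qed.

Lemma eset_edge x y : (x, y) \in es -> T x y.
Proof. by rewrite inE => /and3P[_ _ /jrel_edge]. Qed.

Lemma eset_eclass x y : crossed T x y -> ((x, y) \in es) = eclass T A B x y.
Proof.
move=> xy; apply/idP/idP; last exact: eclass_eset.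
by rewrite inE => /and3P[xS _ _]; exact: S_crossed.
Qed.

Definition erel : rel 'I_n := fun u v => (u, v) \in es.

Lemma erel_sym : symmetric erel.
Proof. by move=> u v; exact: eset_sym. Qed.

(** An edge entering the gap from anywhere but C or D would cross CD. *)
Lemma cap_exit z w : J z w -> z \in S -> between C w D -> (z == C) || (z == D).
Proof.
move=> Jzw; rewrite in_arcs2 => zS wCD; apply: contraT; rewrite negb_or => /andP[zC zD].
have := hex_cap_cross (ed_hex ed) zS wCD zC zD.
by rewrite -crossing_ncrossing (jrel_nc (eclass_parallel (ed_CD ed)) Jzw).
Qed.

Lemma out_caps z : z \notin S -> between C z D || between E z F.
Proof. by rewrite in_arcs2 negb_or => /andP[]; exact: (hex_out (ed_hex ed)). Qed.

(** Collapses each gap onto an end of the outermost edge closing it. A [jrel] walk can enter or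
    leave a gap only through the ends of that edge, so its excursions are replaced by the edge and
    the walk is pushed into the e-graph. *)
Definition retract z := if z \in S then z else if between C z D then C else E.

End Desc.

Lemma retract_edge A B C D E F p q z w : edesc T A B C D E F p q ->
  jrel T A B z w -> z \in arcs2 C D E F ->
  connect (erel A B C D E F) z (retract C D E F w).
Proof.
move=> ed Jzw zS; rewrite /retract; case: ifP => [wS|/negbT wS].
  by apply: connect1; rewrite /erel inE zS wS.
case: ifP => wCD.
  case/orP: (cap_exit ed Jzw zS wCD) => /eqP -> //.
  by apply: connect1; rewrite erel_sym; apply: (eclass_eset ed); exact: ed_CD ed.
have wEF : between E w F by have := out_caps ed wS; rewrite wCD.
have ed' := edesc_swap ed; rewrite arcs2_swap in zS.
case/orP: (cap_exit ed' Jzw zS wEF) => /eqP -> //.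
by apply: connect1; apply: (eclass_eset ed); exact: ed_FE ed.
Qed.

Section Desc2.
Variables A B C D E F p q : 'I_n.
Hypothesis ed : edesc T A B C D E F p q.
Local Notation J := (jrel T A B).
Local Notation S := (arcs2 C D E F).
Local Notation es := (eset T A B C D E F).
Local Notation er := (erel A B C D E F).
Local Notation rho := (retract C D E F).

Lemma erel_csym : connect_sym er.
Proof. exact: (sym_connect_sym (@erel_sym _ _ _ _ _ _)). Qed.

Lemma retract_connect z w : connect J z w -> connect er (rho z) (rho w).
Proof.
case/connectP => P + ->; elim: P z => //= v P IH z /andP[Jzv /IH c].
apply: connect_trans c => {IH P}.
have [zS|zS] := boolP (z \in S).
  by rewrite {1}/retract zS; apply: (retract_edge ed).
have [vS|vS] := boolP (v \in S).
  rewrite erel_csym {1}/retract vS; apply: (retract_edge ed) => //.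
  by rewrite jrel_sym.
have Jvz : J v z by rewrite jrel_sym.
have CDp := eclass_parallel (ed_CD ed).
rewrite /retract (negbTE zS) (negbTE vS).
have := out_caps ed zS; have := out_caps ed vS.
case: ifP => zCD; case: ifP => vCD //= h1 h2.
  by have := hex_capcap (ed_hex ed) zCD h1; rewrite -crossing_ncrossing (jrel_nc CDp Jzv).
by have := hex_capcap (ed_hex ed) vCD h2; rewrite -crossing_ncrossing (jrel_nc CDp Jvz).
Qed.

Lemma eclass_connect x y : eclass T A B x y -> connect er A x.
Proof.
move=> c; have [xS _] := eclass_arcs ed c; case/andP: c => _ /retract_connect.
by rewrite /retract xS (A_in ed).
Qed.

(** Follow a path of the tree from z towards A. A crossed edge at z puts z on an edge of the class,
    an edge leaving the arcs makes z one of C, D, E, F, and otherwise the path has come closer to A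
    inside the e-graph. *)
Lemma S_connect z : z \in S -> connect er A z.
Proof.
have /connectP[P + eA] := conn z A; elim: P z eA => [z /= <- _ _|w P IH z /= eA /andP[zw pP] zS].
  exact: connect0.
have [cz|uz] := edge_cases zw.
  exact: eclass_connect (S_crossed ed cz zS).
have [wS|wS] := boolP (w \in S).
  apply: connect_trans (IH w eA pP wS) _; apply: connect1.
  by rewrite /erel inE wS zS uncrossed_sym uz.
have Jzw : J z w by rewrite /jrel uz.
have := eclass_connect (ed_CD ed); have := eclass_connect (ed_FE ed).
have := ed_CD ed; rewrite -eclass_flip => /eclass_connect.
have := ed_FE ed; rewrite -eclass_flip => /eclass_connect.
move=> cE cD cF cC.
case/orP: (out_caps ed wS) => h.
  by case/orP: (cap_exit ed Jzw zS h) => /eqP ->.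
have zS' : z \in arcs2 E F C D by rewrite -arcs2_swap.
by case/orP: (cap_exit (edesc_swap ed) Jzw zS' h) => /eqP ->.
Qed.

Lemma S_jconnect z : z \in S -> connect J A z.
Proof.
move/S_connect; apply: connect_sub => u v; rewrite /erel inE => /and3P[_ _ h].
exact: connect1.
Qed.

End Desc2.

(** If two arcs meet, one of them starts on the other. The outermost edge at this starting point is
    crossed, so [arc_crossed] puts it in both classes. *)
Lemma meet_eclass A B C D E F p q A' B' C' D' E' F' p' q' z :
  edesc T A B C D E F p q -> edesc T A' B' C' D' E' F' p' q' ->
  z \in arcs2 C D E F -> z \in arcs2 C' D' E' F' -> eclass T A B A' B'.
Proof.
wlog zDE : A B C D E F p q / z \in arc D E.
  move=> H ed ed' zS; have := zS; rewrite in_setU => /orP[h|h].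
    exact: H h ed ed' zS.
  move=> zS'; rewrite arcs2_swap in zS.
  exact: H h (edesc_swap ed) ed' zS zS'.
wlog zDE' : A' B' C' D' E' F' p' q' / z \in arc D' E'.
  move=> H ed ed' zS zS'; have := zS'; rewrite in_setU => /orP[h|h].
    exact: H h ed ed' zS zS'.
  rewrite arcs2_swap in zS'.
  exact: H h ed (edesc_swap ed') zS zS'.
move=> ed ed' _ _; move: zDE zDE'; rewrite !in_arcE => zDE zDE'.
have CD := ed_CD ed; have CD' := ed_CD ed'.
case/orP: (arcs_meet zDE zDE'); rewrite -in_arcE => h.
  have cr : crossed T D C.
    by rewrite crossed_sym; apply: parallel_crossed (eclass_parallel CD) (ed_crossed ed).
  have c' := arc_crossed multi ed' cr h.
  have c2 : eclass T C D A' B' by rewrite eclass_flip in c'; exact: eclass_sym c'.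
  by rewrite (eclass_eq CD).
have cr : crossed T D' C'.
  by rewrite crossed_sym; apply: parallel_crossed (eclass_parallel CD') (ed_crossed ed').
have c' := arc_crossed multi ed cr h.
rewrite eclass_flip in c'.
by rewrite (eclass_eq c'); apply: eclass_sym.
Qed.

End EgraphTheory.

Lemma outermost_cdist n (p C D E F x y : 'I_n) (Q : nat) :
  cdist p F <= cdist p x <= cdist p C -> cdist p D <= cdist p y <= cdist p E ->
  cdist p C < Q -> Q < cdist p D -> outermost C D E F x y.
Proof.
move=> /andP[Fx xC] /andP[Dy yE] CQ QD.
have FC := leq_trans Fx xC; have DE := leq_trans Dy yE.
rewrite /outermost !in_arcE !(@inarc_cdist _ p) // Fx xC Dy yE.
rewrite (cdist_cdist p D E) (cdist_cdist p D F) (cdist_cdist p D C) DE.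
have := cdist_lt p E; have := cdist_lt p D.
by case: (leqP (cdist p D) (cdist p F)); case: (leqP (cdist p D) (cdist p C)); lia.
Qed.

(** * Ordered lists of parallel edges *)

Section EgraphTheory.
Variables (n : nat) (T : lcgraph n).
Hypothesis conn : forall x y, connect T x y.
Hypothesis multi : multipartite T.
Implicit Types (A B C D E F x y z u v p q : 'I_n).

Record eg (G : egraph n) A B C D E F p q : Prop := Eg {
  eg_desc : edesc T A B C D E F p q;
  eg_false : earc G false = arc D E;
  eg_true : earc G true = arc F C;
  eg_edges : eedges G = eset T A B C D E F }.

Lemma eclassP A B x y : parallel T A B x y /\ joined T A B x y <-> eclass T A B x y.
Proof.
rewrite /eclass; split=> [[par /(joinedP par)]|/andP[par c]]; first by rewrite par.
by split=> //; apply/joinedP.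
Qed.

Lemma egraph_containingP A B G : crossed T A B -> egraph_containing T A B G ->
  exists C D E F p q, eg G A B C D E F p q.
Proof.
move=> AB [s [[us mem out]]]; have tAB := crossed_edge AB.
have ss e : e \in s -> eclass T A B e.1 e.2.
  by case: e => x y es; apply/eclassP; apply/mem; rewrite es.
have s0 : 0 < size s.
  have : eclass T A B A B by exact: eclass_refl.
  by move/eclassP/mem; case: (s) => //.
have lt : (size s).-1 < size s by rewrite prednK.
have hs : head (A, B) s \in s by rewrite -nth0 mem_nth.
have ls : last (A, B) s \in s by rewrite -nth_last mem_nth.
have {}out e : e \in s -> outermost (head (A, B) s).1 (head (A, B) s).2
    (last (A, B) s).2 (last (A, B) s).1 e.1 e.2.
  move=> es; have := out 0 (index e s) (size s).-1; rewrite /= nth_last nth0.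
  by rewrite nth_index //; apply => //; rewrite -ltnS prednK // index_mem.
move: (ss _ hs) (ss _ ls) out.
case: (head _ _) hs => C D _; case: (last _ _) ls => F E ls /= CD FE out [ef et ee].
have /and4P[o1 o2 _ _] := out _ ls.
have ord := arc_order (edge_neq (eclass_edge CD)) (edge_neq (eclass_edge FE)) o1 o2.
have /crossedP[_ [p [q [pq cAB]]]] := AB.
have c1 : ncrossing C D p q.
  by rewrite -crossing_ncrossing; case/andP: CD => /parallelP[_ _ <-].
have c2 : ncrossing F E p q.
  by rewrite -crossing_ncrossing; case/andP: FE => /parallelP[_ _ <-].
have arcs x y : eclass T A B x y ->
    (x \in arc F C) && (y \in arc D E) || (y \in arc F C) && (x \in arc D E).
  by move/eclassP/mem/orP => []/out /and4P[_ _ /= -> ->]; rewrite ?orbT.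
case: (hexorder_ex ord c1 c2) => hex; [exists C, D, E, F, p, q|exists C, D, E, F, q, p].
  by split=> //; split.
by split=> //; split=> //; rewrite adj_sym.
Qed.

Lemma is_egraphP G : is_egraph T G -> exists A B C D E F p q, eg G A B C D E F p q.
Proof. by case=> A [B [AB /(egraph_containingP AB) h]]; exists A, B. Qed.

Lemma egraph_exists A B : crossed T A B -> exists G, egraph_containing T A B G.
Proof.
move=> AB; have /crossedP[tAB [p [q [pq cpq]]]] := AB.
pose k := cdist p.
have kn x : k x < n by exact: cdist_lt.
have kp : k p = 0 by exact: cdist0.
pose l := [seq e <- enum {: 'I_n * 'I_n} | eclass T A B e.1 e.2 && (0 < k e.1 < k q)].
(* The edges of the class cross pq and one another never, so they are nested around p. The distances
   of both ends from p, counterclockwise and clockwise, grow together, and their sum sorts by both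
   ends at once. *)
pose key (e : 'I_n * 'I_n) := k e.1 + (n - k e.2).
pose le (e e' : 'I_n * 'I_n) := key e' <= key e.
pose s := sort le l.
have cl x y : eclass T A B x y -> ncrossing (k x) (k y) 0 (k q).
  case/andP => /parallelP[_ _ h] _; move: cpq; rewrite h // crossing_ncrossing /ncrossing.
  by rewrite -(between_cdist p x) -(between_cdist p y q) -(between_cdist p x q)
    -(between_cdist p y p) cdist0.
have mem x y : ((x, y) \in s) = eclass T A B x y && (0 < k x < k q).
  by rewrite mem_sort mem_filter mem_enum andbT.
have after x y : (x, y) \in s -> k q < k y.
  rewrite mem => /andP[/cl c h]; move: c h (kn y); rewrite /ncrossing /between.
  by move=> /orP[]/andP[]; lia.
have comp e e' : e \in s -> e' \in s -> le e e' -> k e'.1 <= k e.1 /\ k e.2 <= k e'.2.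
  case: e e' => x y [x' y'] es es'; have hy := after _ _ es; have hy' := after _ _ es'.
  move: es es'; rewrite !mem /le /key /= => /andP[c1 h1] /andP[c2 h2].
  have nc : ncrossing (k x) (k y) (k x') (k y') = false.
    have := parallel_nc (parallel_trans _ (eclass_parallel c2)) => /(_ x y).
    rewrite parallel_sym (eclass_parallel c1) => /(_ isT).
    by rewrite crossing_ncrossing /ncrossing !between_cdist.
  move: nc h1 h2 hy hy' (kn y) (kn y').
  move: (k x) (k y) (k x') (k y') (k q) => a b c d r.
  rewrite /ncrossing /between => nc h1 h2 hy hy' kn1 kn2 h3; split; rewrite leqNgt; apply/negP => h4.
    by case: (leqP b d) => h5; [lia|move: nc; case: (ltngtP a c); lia].
  by case: (leqP c a) => h5; [move: nc; case: (ltngtP b d); lia|lia].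
have tot : total le by move=> e e'; exact: leq_total.
have tr : transitive le by move=> e e' e'' h1 h2; exact: leq_trans h2 h1.
have so : sorted le s by apply: sort_sorted.
have srt i j : i <= j -> j < size s -> le (nth (A, B) s i) (nth (A, B) s j).
  move=> ij js; have is_ := leq_ltn_trans ij js.
  by apply: (sorted_leq_nth tr _ _ so) => // e; exact: leqnn.
have pl : parallel_list T A B s.
  split.
  - by rewrite sort_uniq filter_uniq // enum_uniq.
  - move=> x y; rewrite eclassP !mem; split=> [c|/orP[]/andP[]//]; last by rewrite eclass_flip.
    rewrite [eclass T A B y x]eclass_flip c /=; move: (cl _ _ c) (kn x) (kn y).
    by rewrite /ncrossing /between => /orP[]/andP[]; lia.
  move=> i m j /andP[im mj] js; set a := nth _ _.
  have ms := leq_ltn_trans mj js; have is_ := leq_ltn_trans im ms.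
  have [h1 h2] := comp _ _ (mem_nth _ is_) (mem_nth _ ms) (srt _ _ im ms).
  have [h3 h4] := comp _ _ (mem_nth _ ms) (mem_nth _ js) (srt _ _ mj js).
  apply: (@outermost_cdist _ p _ _ _ _ _ _ (k q)); rewrite ?h1 ?h2 ?h3 ?h4 //.
    have := mem_nth (A, B) is_; rewrite -/(a i) => /=.
    by case: (a i) => x y; rewrite mem => /andP[_ /andP[]].
  have := mem_nth (A, B) is_; rewrite -/(a i).
  by case: (a i) => x y; exact: after.
pose C := (head (A, B) s).1; pose D := (head (A, B) s).2.
pose F := (last (A, B) s).1; pose E := (last (A, B) s).2.
exists (Egraph (fun b => if b then arc F C else arc D E)
  [set e | [&& e.1 \in arc D E :|: arc F C, e.2 \in arc D E :|: arc F C
             & uncrossed T e.1 e.2 || parallel T A B e.1 e.2]]).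
exists s; split=> //; rewrite /C /D /E /F.
by case: (head _ _) => ? ?; case: (last _ _).
Qed.

End EgraphTheory.

(** * Deleting an edge of a tree *)

Section Bridges.
Variables (n : nat) (T : lcgraph n).
Hypothesis tree : is_tree T.

Definition cut u w : rel 'I_n :=
  fun a b => T a b && ((a, b) \notin [:: (u, w); (w, u)]).

Lemma cut_sym u w : symmetric (cut u w).
Proof.
by move=> a b; rewrite /cut adj_sym !inE !xpair_eqE orbC ![(b == _) && _]andbC.
Qed.

Lemma cut_connect_sym u w : connect_sym (cut u w).
Proof. exact: (sym_connect_sym (@cut_sym u w)). Qed.

Lemma tree_bridge u w : T u w -> ~~ connect (cut u w) u w.
Proof.
have [_ _ ac] := tree => uw; apply/negP => /connectP[q0].
case/shortenP => q pq uq _ ew {q0}.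
have pT : path T u q by apply: sub_path pq => a b /andP[].
have : ucycle T (u :: q).
  by rewrite /ucycle uq andbT /= rcons_path pT -ew adj_sym.
move/ac; case: q ew uq pq {pT} => [|a [|b q]] //=.
  by move=> ew; rewrite ew adj_irrefl in uw.
by move=> -> _; rewrite /cut !inE eqxx andbF.
Qed.
End Bridges.

Section Egraphs.
Variables (n : nat) (T : lcgraph n).
Hypothesis conn : forall x y, connect T x y.
Hypothesis multi : multipartite T.
Implicit Types (A B C D E F x y z u v p q : 'I_n) (G : egraph n).

Lemma hexorder_linear (C p D E q F : nat) : hexorder C p D E q F ->
  (D <= E /\ E < F /\ F <= C) \/ (E < F /\ F <= C /\ C < D) \/
  (F <= C /\ C < D /\ D <= E) \/ (C < D /\ D <= E /\ E < F).
Proof. by move=> [?|[?|[?|[?|[?|?]]]]]; lia. Qed.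

(** The arcs depend on the class only. D and E are ends of class edges and so lie on the other pair
    of arcs; pq crosses the outermost edges there as well, and its ends mark the gaps that the arc
    from D to E cannot contain. *)
Lemma arcs2_sub A B C D E F p q A' B' C' D' E' F' p' q' :
  edesc T A B C D E F p q -> edesc T A' B' C' D' E' F' p' q' ->
  eclass T A B A' B' -> arcs2 C D E F \subset arcs2 C' D' E' F'.
Proof.
move=> ed ed' c; apply/subsetP => z.
wlog zDE : A B C D E F p q ed c / z \in arc D E.
  move=> H zS; have := zS; rewrite in_setU => /orP[h|h]; first exact: H ed c h zS.
  by rewrite arcs2_swap in zS; exact: H (edesc_swap ed) c h zS.
move=> _; have pq := ed_pq ed; have hex := ed_hex ed.
have inS w w' : eclass T A B w w' -> w \in arcs2 C' D' E' F'.
  by rewrite (eclass_eq c) => /(eclass_arcs ed')[].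
have DS : D \in arcs2 C' D' E' F' by apply: (inS D C); rewrite eclass_flip; exact: ed_CD ed.
have ES : E \in arcs2 C' D' E' F' by apply: (inS E F); rewrite eclass_flip; exact: ed_FE ed.
have cr w w' : parallel T A' B' w w' -> ncrossing w w' p q.
  move=> par; rewrite -crossing_ncrossing.
  have := parallel_trans (eclass_parallel c) par => /parallelP[_ _ <- //].
  have /parallelP[_ _ ->//] := eclass_parallel (ed_CD ed).
  rewrite crossingC crossing_flipr crossing_ncrossing; apply: (hex_pq hex);
    by rewrite /inarc eqxx ?orbT.
case: (hexorder_ex (hexorder_linear (ed_hex ed'))
        (cr _ _ (eclass_parallel (ed_CD ed'))) (cr _ _ (eclass_parallel (ed_FE ed')))).
  clear inS cr c ed ed'.
  move: DS ES zDE; rewrite !in_arcs2 in_arcE => DS ES zDE hex'.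
  have [a1 a2 a3 a4 a5] := hex_cdist hex; have [b1 b2 b3 b4 b5] := hex_cdist hex'.
  move: DS ES zDE; rewrite !(@inarc_cdist _ p) //.
  by move=> DS ES /andP[h1 h2]; apply/orP; left; lia.
clear inS cr c ed ed'.
move: DS ES zDE; rewrite !in_arcs2 in_arcE => DS ES zDE /hex_swap hex'.
have [a1 a2 a3 a4 a5] := hex_cdist hex; have [b1 b2 b3 b4 b5] := hex_cdist hex'.
move: DS ES zDE; rewrite !(@inarc_cdist _ p) //.
by move=> DS ES /andP[h1 h2]; apply/orP; right; lia.
Qed.

Lemma eset_eq A B C D E F p q A' B' C' D' E' F' p' q' :
  edesc T A B C D E F p q -> edesc T A' B' C' D' E' F' p' q' ->
  eclass T A B A' B' -> eset T A B C D E F = eset T A' B' C' D' E' F'.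
Proof.
move=> ed ed' c.
have eqS : arcs2 C D E F = arcs2 C' D' E' F'.
  by apply/eqP; rewrite eqEsubset (arcs2_sub ed ed' c) (arcs2_sub ed' ed (eclass_sym c)).
apply/setP => e; rewrite [LHS]inE [RHS]inE eqS; congr [&& _, _ & _].
exact: (jrel_parallel (eclass_parallel c)).
Qed.

Definition everts G := earc G false :|: earc G true.

Lemma eg_arcs G A B C D E F p q : eg T G A B C D E F p q -> everts G = arcs2 C D E F.
Proof. by case=> _ ef et _; rewrite /everts ef et. Qed.

Lemma evertices_arcs G : is_egraph T G -> evertices G \subset everts G.
Proof.
case/is_egraphP => A [B [C [D [E [F [p [q g]]]]]]]; apply/subsetP => z.
rewrite (eg_arcs g) inE => /existsP[w]; rewrite (eg_edges g) inE.
by case/and3P.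
Qed.

Lemma egraph_meet G G' z : is_egraph T G -> is_egraph T G' ->
  z \in everts G -> z \in everts G' -> eedges G = eedges G'.
Proof.
case/is_egraphP => A [B [C [D [E [F [p [q g]]]]]]].
case/is_egraphP => A' [B' [C' [D' [E' [F' [p' [q' g']]]]]]].
rewrite (eg_arcs g) (eg_arcs g') (eg_edges g) (eg_edges g') => zS zS'.
apply: (eset_eq (eg_desc g) (eg_desc g')).
exact: (meet_eclass multi (eg_desc g) (eg_desc g') zS zS').
Qed.

Lemma egraph_crossed G x y : is_egraph T G -> crossed T x y -> x \in everts G ->
  [/\ (x, y) \in eedges G, y \in everts G &
      forall b, x \in earc G b -> y \in earc G (~~ b)].
Proof.
case/is_egraphP => A [B [C [D [E [F [p [q g]]]]]]] xy.
have ed := eg_desc g; rewrite (eg_arcs g) => xS.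
have c := S_crossed multi ed xy xS; split.
- by rewrite (eg_edges g); exact: (eclass_eset ed c).
- by have [_] := eclass_arcs ed c.
have dis z : z \in arc D E -> z \notin arc F C.
  by rewrite !in_arcE; exact: (hex_disj (ed_hex ed)).
move=> b; have := ed_arcs ed c.
case: b; rewrite /= (eg_false g) (eg_true g) => /orP[]/andP[h1 h2] // h3.
  by have := dis _ h2; rewrite h3.
by have := dis _ h3; rewrite h1.
Qed.

Lemma egraph_containing_edge x y : crossed T x y ->
  exists G, [/\ is_egraph T G, (x, y) \in eedges G & x \in evertices G].
Proof.
move=> xy; have [G eG] := egraph_exists xy.
have isG : is_egraph T G by exists x, y.
have [C [D [E [F [p [q g]]]]]] := egraph_containingP xy eG.
have xyG : (x, y) \in eedges G.
  by rewrite (eg_edges g); apply: (eclass_eset (eg_desc g)); apply/eclass_refl/crossed_edge.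
exists G; split=> //.
by rewrite inE; apply/existsP; exists y.
Qed.

(** An arc is contiguous, so a chord with no end on it leaves it on one side. *)
Lemma earc_nc G b x u s s' : is_egraph T G -> x \in earc G b -> u \in earc G b ->
  s \notin everts G -> s' \notin everts G -> crossing s s' x u = false.
Proof.
case/is_egraphP => A [B [C [D [E [F [p [q g]]]]]]] xb ub.
rewrite !inE !negb_or => /andP[s1 s2] /andP[s1' s2'].
apply/negbTE; rewrite crossing_ncrossing; move: xb ub s1 s2 s1' s2'.
rewrite (eg_false g) (eg_true g).
by case: b; rewrite ?(eg_false g) ?(eg_true g) !in_arcE => *; apply: arc_nc; eassumption.
Qed.

Lemma egraph_jconnect G A B z : is_egraph T G -> crossed T A B -> A \in everts G ->
  z \in everts G -> connect (jrel T A B) A z.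
Proof.
case/is_egraphP => A' [B' [C [D [E [F [p [q g]]]]]]] AB.
have ed := eg_desc g; rewrite (eg_arcs g) => AS zS.
have := S_crossed multi ed AB AS; rewrite /eclass => /andP[par].
have := S_jconnect conn multi ed zS.
rewrite !(eq_connect (jrel_parallel par)) => h1 h2.
by apply: connect_trans h1; rewrite jconnect_sym.
Qed.

Lemma egraph_connect G (R : rel 'I_n) z w : is_egraph T G -> connect_sym R ->
  (forall a b, (a, b) \in eedges G -> R a b) ->
  z \in everts G -> w \in everts G -> connect R z w.
Proof.
case/is_egraphP => A' [B' [C [D [E [F [p [q g]]]]]]] Rs sub.
have ed := eg_desc g; rewrite (eg_arcs g) => zS wS.
have h t : t \in arcs2 C D E F -> connect R A' t.
  move/(S_connect conn multi ed); apply: connect_sub => a b ab.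
  by apply/connect1/sub; rewrite (eg_edges g).
by apply: connect_trans (h _ wS); rewrite Rs h.
Qed.

End Egraphs.

(** * Paths between e-graphs *)

Section Reduced.
Variables (n : nat) (T T1 : lcgraph n).
Hypothesis tree : is_tree T.
Hypothesis multi : multipartite T.
Hypothesis s1 : step1 T T1.
Implicit Types (A B x y z u v s t : 'I_n) (G : egraph n).

Let conn : forall x y, connect T x y. Proof. by case: tree. Qed.

(** The crossed edges that survive step 1; by [crossed_kept] they are the edges of the pre-reduced
    form. *)
Definition kept x y := T1 x y && crossed T x y.

Lemma kept_rep G : is_egraph T G -> exists A B,
  [/\ A \in everts G, kept A B & forall x y, crossed T x y -> x \in everts G ->
     T1 x y = ((x, y) \in [:: (A, B); (B, A)])].
Proof.
move=> isG; have [_ _ /(_ G isG)[A [B [AB ABG h]]]] := s1.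
have AG : A \in everts G.
  have /subsetP := evertices_arcs isG; apply; rewrite inE.
  by apply/existsP; exists B.
exists A, B; split=> //; first by rewrite /kept h // !inE eqxx AB.
by move=> x y xy xG; rewrite h //; case: (egraph_crossed multi isG xy xG).
Qed.

Lemma kept_sym x y : kept x y = kept y x.
Proof. by rewrite /kept adj_sym crossed_sym. Qed.

Lemma kept_edge x y : kept x y -> T x y.
Proof. by case/andP => _ /crossed_edge. Qed.

Lemma egraph_of x y : crossed T x y ->
  exists G, [/\ is_egraph T G, (x, y) \in eedges G, x \in evertices G & x \in everts G].
Proof.
move=> /egraph_containing_edge[G [isG xyG xV]]; exists G; split=> //.
by have /subsetP := evertices_arcs isG; apply.
Qed.

Lemma eedges_everts G x y : is_egraph T G -> (x, y) \in eedges G -> x \in everts G.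
Proof.
move=> isG xyG; have /subsetP := evertices_arcs isG; apply.
by rewrite inE; apply/existsP; exists y.
Qed.

Lemma kept_in G x x' y y' : is_egraph T G -> kept x x' -> kept y y' ->
  x \in everts G -> y \in everts G -> y = x \/ y = x'.
Proof.
move=> isG /andP[t1 c1] /andP[t2 c2] xG yG.
have [A [B [AG _ h]]] := kept_rep isG.
move: t1 t2; rewrite (h _ _ c1 xG) (h _ _ c2 yG) !inE !xpair_eqE.
by case/orP => /andP[/eqP-> /eqP->] /orP[]/andP[/eqP-> _]; auto.
Qed.

Lemma kept_fun x y y' : kept x y -> kept x y' -> y = y'.
Proof.
move=> k1 k2; case/andP: (k1) => t1 c1; case/andP: (k2) => t2 c2.
have [G [isG _ _ xG]] := egraph_of c1.
have [A [B [AG _ h]]] := kept_rep isG.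
have := edge_neq (crossed_edge c1).
move: t1 t2; rewrite (h _ _ c1 xG) (h _ _ c2 xG) !inE !xpair_eqE.
case/orP => /andP[/eqP e1 /eqP e2] /orP[]/andP[/eqP e3 /eqP e4];
  by rewrite e2 e4 // -e1 e3 eqxx.
Qed.

Lemma kept_parallel x y : crossed T x y -> exists x' y', kept x' y' /\ parallel T x y x' y'.
Proof.
move=> c; have [G [isG xyG _ xG]] := egraph_of c.
have [A [B [AG kAB h]]] := kept_rep isG; exists A, B; split=> //.
case/is_egraphP: (isG) => A' [B' [C [D [E [F [p [q g]]]]]]].
have ed := eg_desc g; move: xG AG; rewrite (eg_arcs g) => xS AS.
have cAB : crossed T A B by case/andP: kAB.
have c1 := S_crossed multi ed c xS; have c2 := S_crossed multi ed cAB AS.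
by apply: parallel_trans (eclass_parallel c2); rewrite parallel_sym (eclass_parallel c1).
Qed.

(** An edge of T that crosses a kept edge may have been deleted, but a kept edge parallel to it
    crosses the same edges. *)
Lemma crossed_kept x y : crossed T1 x y = kept x y.
Proof.
have [sub _ _] := s1.
apply/idP/andP => [/crossedP[xy [u [v [uv c]]]]|[t1 /crossedP[xy [u [v [uv c]]]]]].
  by split=> //; apply: crossing_crossed c; apply: sub.
have cuv : crossed T u v by apply: crossing_crossed uv xy _; rewrite crossingC.
have [u' [v' [k /parallelP[_ _ h]]]] := kept_parallel cuv.
apply/crossedP; split=> //; exists u', v'; case/andP: k => -> _; split=> //.
by rewrite crossingC -h // crossingC.
Qed.

Lemma kept_crosses x y : kept x y -> exists u v, kept u v /\ crossing x y u v.
Proof.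
rewrite -crossed_kept => /crossedP[xy [u [v [uv c]]]]; exists u, v; split=> //.
by rewrite -crossed_kept; apply: crossing_crossed uv xy _; rewrite crossingC.
Qed.

Lemma in_everts G z : z \in everts G -> exists b, z \in earc G b.
Proof. by rewrite in_setU => /orP[] h; [exists false|exists true]. Qed.

Lemma earc_everts G b z : z \in earc G b -> z \in everts G.
Proof. by rewrite in_setU; case: b => ->; rewrite ?orbT. Qed.

Lemma remainingP G b x : is_egraph T G ->
  remaining T T1 G b x <-> x \in earc G b /\ exists x', kept x x'.
Proof.
move=> isG; split=> [[xb [y [yb xyG xy t1]]]|[xb [y /andP[t1 xy]]]]; split=> //.
  by exists y; rewrite /kept t1.
have [xyG _ h] := egraph_crossed multi isG xy (earc_everts xb).
by exists y; split=> //; exact: h.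
Qed.

Lemma remaining_ex G b : is_egraph T G -> exists x, x \in earc G b /\ exists x', kept x x'.
Proof.
move=> isG; have [A [B [AG kAB h]]] := kept_rep isG.
have [b' Ab] := in_everts AG; have /andP[t1 cAB] := kAB.
have [ABG _ hB] := egraph_crossed multi isG cAB AG.
have [<-|bb] := eqVneq b' b; first by exists A; split=> //; exists B.
exists B; split; last by exists A; rewrite kept_sym.
by move: bb (hB _ Ab); case: b b' {Ab} => [] [].
Qed.

Definition link x y := step3_edge T T1 x y.

Definition linked G1 G2 i j u P x y :=
  [/\ [/\ is_egraph T G1, is_egraph T G2 & connects T u P G1 G2],
      [/\ u \in earc G1 i, last u P \in earc G2 j, x \in earc G1 i & y \in earc G2 j],
      exists x', kept x x' & exists y', kept y y'].

Lemma linkP x y : link x y <-> exists G1 G2 i j u P, linked G1 G2 i j u P x y.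
Proof.
split=> -[G1 [G2 [i [j [u [P h]]]]]]; exists G1, G2, i, j, u, P.
  case: h => [[is1 is2] c [u1 u2] [/(remainingP _ _ is1)[x1 kx] /(remainingP _ _ is2)[y1 ky]]].
  by split.
case: h => [[is1 is2 c] [u1 u2 x1 y1] kx ky]; split=> //.
by split; apply/remainingP.
Qed.

Lemma connects_rev u P G1 G2 : connects T u P G1 G2 ->
  connects T (last u P) (rev (belast u P)) G2 G1 /\
  last (last u P) (rev (belast u P)) = u.
Proof.
case=> -[P0 uq pt] h1 h2 h3.
have revE : last u P :: rev (belast u P) = rev (u :: P) by rewrite [in RHS]lastI rev_rcons.
have lastE : last (last u P) (rev (belast u P)) = u.
  by case: P P0 {uq pt h1 h2 h3 revE} => // a P _ /=; rewrite rev_cons last_rcons.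
split=> //; split.
- split; rewrite ?revE ?rev_uniq //.
    by case: P P0 {uq pt h1 h2 h3 revE lastE} => // a P _; rewrite -size_eq0 size_rev size_belast.
  by rewrite rev_path; apply: sub_path pt => a b; rewrite uncrossed_sym.
- by move=> v; rewrite revE mem_rev => /h2.
- by move=> v; rewrite revE mem_rev lastE => /h1.
by move=> E isE n2 n1 v; rewrite revE mem_rev; apply: h3.
Qed.

Lemma linked_rev G1 G2 i j u P x y : linked G1 G2 i j u P x y ->
  linked G2 G1 j i (last u P) (rev (belast u P)) y x.
Proof.
case=> [[is1 is2 c] [u1 u2 x1 y1] kx ky].
by have [c' e] := connects_rev c; split; rewrite ?e.
Qed.

Lemma link_sym x y : link x y -> link y x.
Proof.
case/linkP => G1 [G2 [i [j [u [P /linked_rev L]]]]]; apply/linkP.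
by exists G2, G1, j, i, (last u P), (rev (belast u P)).
Qed.

Section Link.
Variables (G1 G2 : egraph n) (i j : bool) (u : 'I_n) (P : seq 'I_n) (x y x' y' : 'I_n).
Hypothesis L : linked G1 G2 i j u P x y.
Hypotheses (kx : kept x x') (ky : kept y y').

Let is1 : is_egraph T G1. Proof. by case: L => -[]. Qed.
Let is2 : is_egraph T G2. Proof. by case: L => -[]. Qed.
Let con : connects T u P G1 G2. Proof. by case: L => -[]. Qed.
Let u1 : u \in earc G1 i. Proof. by case: L => _ []. Qed.
Let v2 : last u P \in earc G2 j. Proof. by case: L => _ []. Qed.
Let x1 : x \in earc G1 i. Proof. by case: L => _ []. Qed.
Let y2 : y \in earc G2 j. Proof. by case: L => _ []. Qed.

Lemma link_path : path T u P.
Proof. by case: con => -[_ _ pt] _ _ _; apply: sub_path pt => a b; exact: uncrossed_edge. Qed.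

(** The path has two different ends, each the only vertex of its e-graph on the path. *)
Lemma link_neq : eedges G1 <> eedges G2.
Proof.
case: con => -[P0 uq pt] h1 h2 h3 eqE.
have eqV : evertices G1 = evertices G2 by apply/setP => z; rewrite !inE eqE.
have := h2 u (mem_head _ _); rewrite -eqV h1 ?mem_head // eqxx => /esym/eqP uE.
case/andP: uq => /negP[]; rewrite uE.
by case: (P) P0 => // a q _ /=; exact: mem_last.
Qed.

Lemma link_disjoint z : z \in everts G1 -> z \notin everts G2.
Proof.
by move=> z1; apply/negP => z2; apply: link_neq; exact: (egraph_meet multi is1 is2 z1 z2).
Qed.

(** If the kept edges did not cross they would be parallel, and the uncrossed path together with the
    two e-graphs would join them into one class, although their arcs are disjoint. *)
Lemma link_crossing : crossing x x' y y'.
Proof.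
apply: contraT => /negbTE nc; case/andP: (kx) => _ cx; case/andP: (ky) => _ cy.
have par := nc_parallel multi cx cy nc.
have c1 := egraph_jconnect conn multi is1 cx (earc_everts x1) (earc_everts u1).
have c2 := egraph_jconnect conn multi is2 cy (earc_everts y2) (earc_everts v2).
rewrite -(eq_connect (jrel_parallel par)) in c2.
have cuv : connect (jrel T x x') u (last u P).
  apply/connectP; exists P => //; case: con => -[_ _ pt] _ _ _.
  by apply: sub_path pt => a b h; rewrite /jrel h.
have cl : eclass T x x' y y'.
  rewrite /eclass par /=; apply: connect_trans c1 _; apply: connect_trans cuv _.
  by rewrite jconnect_sym.
case/is_egraphP: (is1) => A [B [C [D [E [F [p [q g]]]]]]].
have ed := eg_desc g; have xS := earc_everts x1; rewrite (eg_arcs g) in xS.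
have c3 := S_crossed multi ed cx xS.
have [yS _] : y \in arcs2 C D E F /\ y' \in arcs2 C D E F.
  by apply: (eclass_arcs ed); rewrite (eclass_eq c3).
by have := link_disjoint; move/(_ y); rewrite (eg_arcs g) yS (earc_everts y2) => /(_ isT).
Qed.

Lemma kept_off G z s s' : is_egraph T G -> z \in everts G -> forall z', kept z z' ->
  kept s s' -> s != z -> s != z' -> (s \notin everts G) /\ (s' \notin everts G).
Proof.
move=> isG zG z' kz ks sz sz'.
have sG : s \notin everts G.
  apply/negP => sG; case: (kept_in isG kz ks zG sG) => e.
    by rewrite e eqxx in sz.
  by rewrite e eqxx in sz'.
split=> //; apply: contraNN sG => s'G; case/andP: ks => _; rewrite crossed_sym => c.
by have [] := egraph_crossed multi isG c s'G.
Qed.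

(** Go from x to u within an arc, along the uncrossed path to its last vertex, and from there to y
    within an arc. None of these moves changes sides of ss', whose ends lie on a third e-graph and
    hence off the path. *)
Lemma link_free s s' : kept s s' -> s \notin [:: x; x'; y; y'] -> crossing s s' x y = false.
Proof.
move=> ks; rewrite !inE !negb_or => /and4P[sx sx' sy sy'].
have [s1G s1G'] := kept_off is1 (earc_everts x1) kx ks sx sx'.
have [s2G s2G'] := kept_off is2 (earc_everts y2) ky ks sy sy'.
apply/negP => c.
have neq G w t : w \in everts G -> t \notin everts G -> w != t by move=> h; apply: contraNneq => <-.
have cxu := earc_nc is1 x1 u1 s1G s1G'; have cyv := earc_nc is2 y2 v2 s2G s2G'.
have cuy : crossing s s' u y.
  by apply: crossing_move c cxu _ _; apply: neq (earc_everts u1) _.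
have cuv : crossing s s' u (last u P).
  rewrite -crossing_flipr; rewrite -crossing_flipr in cuy.
  by apply: crossing_move cuy cyv _ _; apply: neq (earc_everts v2) _.
case: con => -[P0 uq pt] h1 h2 h3.
have ts := kept_edge ks.
have off t t' : kept t t' -> t \notin everts G1 -> t \notin everts G2 -> t \notin P.
  move=> kt t1 t2; apply/negP => tP; case/andP: kt => _ ct.
  have [G [isG ttG tV tG]] := egraph_of ct.
  have n1 : eedges G <> eedges G1.
    by move=> e; rewrite e in ttG; rewrite (eedges_everts is1 ttG) in t1.
  have n2 : eedges G <> eedges G2.
    by move=> e; rewrite e in ttG; rewrite (eedges_everts is2 ttG) in t2.
  by have := h3 G isG n1 n2 t; rewrite inE tP orbT tV => /(_ isT).
have nc a b : uncrossed T a b -> crossing s s' a b = false.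
  by move=> ab; rewrite crossingC; exact: uncrossed_nc ab ts.
have := separate_path nc pt cuv.
rewrite (negbTE (off _ _ ks s1G s2G)).
by rewrite (negbTE (off s' s _ s1G' s2G')) ?(kept_sym s' s).
Qed.

End Link.

End Reduced.

Lemma quad_linear (x y x' y' : nat) : between x y x' -> ncrossing x x' y y' ->
  (x < y /\ y < x' /\ x' < y') \/ (y < x' /\ x' < y' /\ y' < x) \/
  (x' < y' /\ y' < x /\ x < y) \/ (y' < x /\ x < y /\ y < x').
Proof. rewrite /ncrossing /between => h /orP[]/andP[]; move: h; lia. Qed.

Lemma quad_trapped (x y x' y' s s' : nat) : between x y x' -> ncrossing x x' y y' ->
  between x s y -> s' != x -> s' != y -> ~~ ncrossing s s' x y ->
  ~~ ncrossing s s' x x' && ~~ ncrossing s s' y y'.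
Proof.
move=> h c hs sx sy nc; have q := quad_linear h c.
have hs' : between x s' y.
  move: hs sx sy nc; rewrite /ncrossing /between; case: (ltngtP x y); lia.
clear nc h c sx sy; move: hs hs'; rewrite /ncrossing /between.
by case: q => [?|[?|[?|?]]] => h1 h2; apply/andP; split; lia.
Qed.

Lemma same_side (x x' y z : nat) : between x y x' || between x' y x ->
  between x z x' || between x' z x -> ~~ ncrossing x x' y z -> y != z ->
  (between x y x' && between x z x') && (between x z y || between x y z) ||
  (between x' y x && between x' z x) && (between y z x || between z y x).
Proof.
rewrite /ncrossing /between; case: (ltngtP x x') => h; case: (ltngtP y z) => h' //; lia.
Qed.

(** * Links join neighbouring ends of crossing chords *)

Section Reduced.
Variables (n : nat) (T T1 : lcgraph n).
Hypothesis tree : is_tree T.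
Hypothesis multi : multipartite T.
Hypothesis s1 : step1 T T1.
Implicit Types (A B x y z u v s t : 'I_n) (G : egraph n).
Local Notation kept := (kept T T1).
Local Notation link := (link T T1).

Let conn : forall x y, connect T x y. Proof. by case: tree. Qed.

Lemma link_cross x y x' y' : link x y -> kept x x' -> kept y y' -> crossing x x' y y'.
Proof.
case/(linkP T1 multi) => G1 [G2 [i [j [u [P L]]]]] kx ky.
exact: (link_crossing tree multi L kx ky).
Qed.

(** A kept edge with an end between x and y does not separate them, so it has both ends there and
    crosses neither xx' nor yy'. Since these two cross, this contradicts [multipartite]. *)
Lemma link_next x y x' y' s s' : link x y -> kept x x' -> kept y y' ->
  between x y x' -> kept s s' -> ~~ between x s y.
Proof.
move=> lxy kx ky b ks; have c := link_cross lxy kx ky; have c' := c.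
rewrite crossing_ncrossing in c; apply/negP => hs.
case/(linkP T1 multi): lxy => G1 [G2 [i [j [u [P L]]]]].
have q := quad_linear b c.
have off t t' : kept t t' -> t \notin [:: x; x'; y; y'] -> t' \notin [:: x; x'; y; y'].
  move=> kt; apply: contraNN; rewrite !inE.
  have h w w' : kept w w' -> t' = w -> t = w'.
    by move=> kw e; apply: (kept_fun multi s1 _ kw); rewrite -e kept_sym.
  have kx' : kept x' x by rewrite kept_sym.
  have ky' : kept y' y by rewrite kept_sym.
  by case/or4P => /eqP e; [rewrite (h _ _ kx e)|rewrite (h _ _ kx' e)
    |rewrite (h _ _ ky e)|rewrite (h _ _ ky' e)]; rewrite eqxx ?orbT.
have sn : s \notin [:: x; x'; y; y'].
  rewrite !inE -!val_eqE /= !negb_or; move: hs; rewrite /between.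
  by case: q => [?|[?|[?|?]]] => h; apply/and4P; split; lia.
have := off _ _ ks sn; rewrite !inE !negb_or => /and4P[sx _ sy _].
have nc := link_free multi s1 L kx ky ks sn.
have := @quad_trapped x y x' y' s s' b c hs sx sy.
rewrite -!crossing_ncrossing nc => /(_ isT) /andP[/negbTE n1 /negbTE n2].
have := multi (kept_edge kx) (kept_edge ky) c'.
by case/andP: ks => _ cs /(_ _ _ cs); rewrite n1 n2.
Qed.

Lemma link_prev x y x' y' s s' : link x y -> kept x x' -> kept y y' ->
  between x' y x -> kept s s' -> ~~ between y s x.
Proof.
move=> lxy kx ky b; have c := link_cross lxy kx ky.
apply: (link_next (link_sym multi lxy) ky kx).
move: c b; rewrite crossing_ncrossing /ncrossing /between => /orP[]/andP[]; lia.
Qed.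

(** Of two links from x on the same side of xx', the nearer end would lie between x and the farther
    one. *)
Lemma link_side x y z x' y' z' : link x y -> link x z -> kept x x' -> kept y y' ->
  kept z z' -> crossing x x' y z = false -> y = z.
Proof.
move=> lxy lxz kx ky kz nc.
have cy := link_cross lxy kx ky; have cz := link_cross lxz kx kz.
have side t t' : crossing x x' t t' -> between x t x' || between x' t x.
  by rewrite crossingE => /orP[/andP[-> _]//|/andP[_ ->]]; rewrite orbT.
apply/eqP; apply: contraT; rewrite -val_eqE => yz.
rewrite crossing_ncrossing in nc.
have := same_side (side _ _ cy) (side _ _ cz) (negbT nc) yz.
case/orP => /andP[/andP[b1 b2]].
  rewrite (negbTE (link_next lxy kx ky b1 kz)).
  by rewrite (negbTE (link_next lxz kx kz b2 ky)).
rewrite (negbTE (link_prev lxy kx ky b1 kz)).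
by rewrite (negbTE (link_prev lxz kx kz b2 ky)).
Qed.

End Reduced.

(** * Links are bridges *)

Section Reduced.
Variables (n : nat) (T T1 : lcgraph n).
Hypothesis tree : is_tree T.
Hypothesis multi : multipartite T.
Hypothesis s1 : step1 T T1.
Implicit Types (A B x y z u v s t : 'I_n) (G : egraph n).
Local Notation kept := (kept T T1).
Local Notation link := (link T T1).
Local Notation linked := (linked T T1).

Let conn : forall x y, connect T x y. Proof. by case: tree. Qed.

Lemma eedges_sym G x y : is_egraph T G -> (x, y) \in eedges G -> (y, x) \in eedges G.
Proof.
case/is_egraphP => A [B [C [D [E [F [p [q g]]]]]]].
by rewrite (eg_edges g) eset_sym.
Qed.

Lemma eedges_edge G x y : is_egraph T G -> (x, y) \in eedges G -> T x y.
Proof.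
case/is_egraphP => A [B [C [D [E [F [p [q g]]]]]]].
by rewrite (eg_edges g) => /eset_edge.
Qed.

Lemma eedges_vertex G x y : (x, y) \in eedges G -> x \in evertices G.
Proof. by move=> xy; rewrite inE; apply/existsP; exists y. Qed.

Lemma evertices_eq G G' : eedges G = eedges G' -> evertices G = evertices G'.
Proof. by move=> e; apply/setP => z; rewrite !inE e. Qed.

Lemma evertices_everts G z : is_egraph T G -> z \in evertices G -> z \in everts G.
Proof. by move=> isG; have /subsetP := evertices_arcs isG; apply. Qed.

Lemma kept_vertex G x x' : is_egraph T G -> kept x x' -> x \in everts G ->
  (x, x') \in eedges G.
Proof. by move=> isG /andP[_ c] /(egraph_crossed multi isG c)[]. Qed.

Section Bridge.
Variables (G1 G2 : egraph n) (i j : bool) (u w : 'I_n) (P : seq 'I_n) (x y x' y' : 'I_n).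
Hypothesis L : linked G1 G2 i j u (w :: P) x y.
Hypotheses (kx : kept x x') (ky : kept y y').
Local Notation R := (cut T u w).
Local Notation v := (last w P).

Let is1 : is_egraph T G1. Proof. by case: L => -[]. Qed.
Let is2 : is_egraph T G2. Proof. by case: L => -[]. Qed.
Let con : connects T u (w :: P) G1 G2. Proof. by case: L => -[]. Qed.
Let u1 : u \in earc G1 i. Proof. by case: L => _ []. Qed.
Let v2 : v \in earc G2 j. Proof. by case: L => _ []. Qed.
Let x1 : x \in earc G1 i. Proof. by case: L => _ []. Qed.
Let y2 : y \in earc G2 j. Proof. by case: L => _ []. Qed.

Let uP : u \notin w :: P.
Proof. by case: con => -[_ /andP[]]. Qed.

Let uV : u \in evertices G1.
Proof. by case: con => _ h _ _; rewrite h ?mem_head ?eqxx. Qed.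

(** An e-graph containing uw would have two vertices on the connecting path. Hence deleting uw
    leaves every e-graph connected. *)
Lemma bridge_edge G : is_egraph T G -> (u, w) \notin eedges G.
Proof.
move=> isG; apply/negP => uwG; have wuG := eedges_sym isG uwG.
case: con => -[_ uq _] h1 h2 h3.
have uP0 := mem_head u (w :: P); have wP0 : w \in u :: w :: P by rewrite !inE eqxx orbT.
have := h3 G isG; case: (eqVneq (eedges G) (eedges G1)) => [e _|/eqP n1].
  have := h1 w wP0; rewrite -(evertices_eq e) (eedges_vertex wuG) => /esym/eqP wu.
  by move: uP; rewrite wu mem_head.
case: (eqVneq (eedges G) (eedges G2)) => [e _|/eqP n2 h].
  have := h2 u uP0; rewrite -(evertices_eq e) (eedges_vertex uwG) => /esym/eqP uE.
  by move: uP; rewrite uE /= mem_last.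
by have := h n1 n2 u uP0; rewrite (eedges_vertex uwG).
Qed.

Lemma bridge_everts G a b : is_egraph T G -> a \in everts G -> b \in everts G ->
  connect R u a = connect R u b.
Proof.
move=> isG aG bG; apply: (same_connect_r (@cut_connect_sym _ T u w)).
apply: (egraph_connect conn multi isG _ _ aG bG).
  exact: cut_connect_sym.
move=> c d cd; rewrite /cut (eedges_edge isG cd) !inE !xpair_eqE.
apply/negP => /orP[]/andP[/eqP e /eqP e']; have /negP := bridge_edge isG; apply.
  by rewrite -e -e'.
by apply: eedges_sym => //; rewrite -e -e'.
Qed.

Lemma cut_path a p : path T a p -> u \notin a :: p -> path R a p.
Proof.
move=> pT; rewrite inE negb_or => /andP[ua up].
elim: p a ua pT up => //= b p IH a ua /andP[ab pT]; rewrite inE negb_or => /andP[ub up].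
rewrite IH // andbT /cut ab !inE !xpair_eqE ![_ == u]eq_sym.
by rewrite (negbTE ua) (negbTE ub) andbF.
Qed.

Lemma bridge_far : connect R u v = false.
Proof.
have pT := link_path L; have /= /andP[uw pT'] := pT.
have c : connect R w v by apply/connectP; exists P => //; apply: cut_path.
rewrite -(same_connect_r (@cut_connect_sym _ T u w) c).
exact/negbTE/tree_bridge.
Qed.

Section Other.
Variables (G1' G2' : egraph n) (i' j' : bool) (p : seq 'I_n) (a b a' b' : 'I_n).
Hypothesis L' : linked G1' G2' i' j' u p a b.
Hypotheses (ka : kept a a') (kb : kept b b').
Hypothesis far' : connect R u (last u p) = false.

Let is1' : is_egraph T G1'. Proof. by case: L' => -[]. Qed.
Let is2' : is_egraph T G2'. Proof. by case: L' => -[]. Qed.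

Lemma other_start : eedges G1' = eedges G1.
Proof.
apply: (egraph_meet multi is1' is1 (z := u)).
  by case: L' => _ [h _ _ _] _ _; exact: earc_everts h.
exact: earc_everts u1.
Qed.

(** A path leaving u by another edge never returns to u, hence avoids the deleted edge and stays on
    the near side. *)
Lemma other_head : exists p', p = w :: p'.
Proof.
have := link_path L'; case: L' => -[_ _ [[p0 uq _] _ _ _]] _ _ _.
case: p p0 uq far' => //= w' p' _ /andP[up' _] far'' /andP[uw' pT].
have [->|ww'] := eqVneq w' w; first by exists p'.
suff : connect R u (last w' p') by rewrite far''.
apply/connectP; exists (w' :: p') => //=.
rewrite cut_path // andbT /cut uw' !inE !xpair_eqE eqxx /= (negbTE ww') /=.
by apply: contraNN up' => /andP[_ /eqP ->]; rewrite mem_head.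
Qed.

(** The e-graph has one kept edge, so a is x or x'. It is not x', because yy' separates x from x'
    but does not separate two points of one arc, and u shares an arc with x as well as with a. *)
Lemma other_x : a = x.
Proof.
have [ua aa] : u \in earc G1' i' /\ a \in earc G1' i' by case: L' => _ [].
have xG := earc_everts x1; have aG' := earc_everts aa.
have aG : a \in everts G1.
  by apply: (eedges_everts is1 (y := a')); rewrite -other_start; apply: kept_vertex.
case: (kept_in multi s1 is1 kx ka xG aG) => // ax'.
have cr := link_crossing tree multi L kx ky; rewrite crossingC in cr.
have ky' : kept y' y by rewrite kept_sym.
have yG2 := earc_everts y2.
have y'G2 : y' \in everts G2 by case/andP: (ky) => _ /(egraph_crossed multi is2) => /(_ yG2)[].
have off z : z \in everts G2 -> z \notin everts G1.
  by move=> h; apply: contraL h => h; exact: (link_disjoint multi L).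
have off' z z' : kept z z' -> z \in everts G2 -> z \notin everts G1'.
  move=> kz zG2; apply: contraNN (off _ zG2) => /(kept_vertex is1' kz).
  by rewrite other_start => /(eedges_everts is1).
have n1 := earc_nc is1 x1 u1 (off _ yG2) (off _ y'G2).
have n2 := earc_nc is1' aa ua (off' _ _ ky yG2) (off' _ _ ky' y'G2).
have uG := earc_everts u1.
have := crossing_move cr n1; rewrite crossing_flipr -ax' n2.
by move=> h; symmetry; apply/eqP; apply: contraT => _; apply: h;
  apply: contraTneq uG => ->; apply: off.
Qed.

(** Both y and b are reached from w along uncrossed paths that avoid x and x', followed by a move
    within an arc. They are therefore on the same side of xx', where x has only one link. *)
Lemma other_y : b = y.
Proof.
have [p' pE] := other_head; have ax := other_x.
apply/esym; have lxy : link x y.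
  by apply/(linkP T1 multi); exists G1, G2, i, j, u, (w :: P).
have lxb : link x b.
  by rewrite -ax; apply/(linkP T1 multi); exists G1', G2', i', j', u, p.
apply: (link_side tree multi s1 lxy lxb kx ky kb).
have xV : x \in evertices G1.
  by apply: (eedges_vertex (y := x')); apply: kept_vertex (earc_everts x1).
have xG := earc_everts x1.
have xG' : x' \in everts G1 by case/andP: (kx) => _ /(egraph_crossed multi is1) => /(_ xG)[].
have kx' : kept x' x by rewrite kept_sym.
have x'V : x' \in evertices G1 by apply: (eedges_vertex (y := x)); apply: kept_vertex.
have avoid t : t \in evertices G1 -> t \notin w :: P.
  move=> tV; apply/negP => tP; case: con => _ h _ _.
  have := h t; rewrite inE tP orbT tV => /(_ isT) /esym/eqP tu.
  by move: uP; rewrite -tu tP.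
have avoid' t : t \in evertices G1 -> t \notin w :: p'.
  rewrite -(evertices_eq other_start) => tV; apply/negP => tP.
  case: L' => -[_ _ [[_ uq _] h _ _]] _ _ _.
  have := h t; rewrite pE inE tP orbT tV => /(_ isT) /esym/eqP tu.
  by move: uq; rewrite pE -tu cons_uniq tP.
have nc c d : T c d -> uncrossed T c d -> crossing x x' c d = false.
  by move=> _ cd; rewrite crossingC; apply: uncrossed_nc (kept_edge kx).
have sep q' : path (uncrossed T) w q' -> x \notin w :: q' -> x' \notin w :: q' ->
    crossing x x' w (last w q') = false.
  move=> pq; rewrite !inE !negb_or => /andP[_ xq] /andP[_ xq'].
  apply/negP => /(separate_path _ pq); rewrite (negbTE xq) (negbTE xq').
  by move=> h; apply: notF; apply: h => c d cd; apply: nc (uncrossed_edge cd) cd.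
have pw : path (uncrossed T) w P by case: con => -[_ _ /andP[]].
have pw' : path (uncrossed T) w p'.
  by case: L' => -[_ _ [[_ _]]]; rewrite pE => /andP[].
have n1 := sep _ pw (avoid _ xV) (avoid _ x'V).
have n2 := sep _ pw' (avoid' _ xV) (avoid' _ x'V).
have xG2 := link_disjoint multi L xG; have xG2' := link_disjoint multi L xG'.
have n3 := earc_nc is2 y2 v2 xG2 xG2'.
have toG1' t t' : kept t t' -> t \in everts G1 -> t \in everts G1'.
  move=> kt /(kept_vertex is1 kt); rewrite -other_start; exact: (eedges_everts is1').
have xG3 := link_disjoint multi L' (toG1' _ _ kx xG).
have xG3' := link_disjoint multi L' (toG1' _ _ kx' xG').
have [b2 v2'] : b \in earc G2' j' /\ last w p' \in earc G2' j'.
  by case: L' => _ []; rewrite pE.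
have n4 := earc_nc is2' b2 v2' xG3 xG3'.
have neq t s : t \in evertices G1 -> s \notin evertices G1 -> s != t.
  by move=> tV; apply: contraNneq => ->.
have vV : v \notin evertices G1 by apply/negP => /avoid; rewrite mem_last.
have vV' : last w p' \notin evertices G1 by apply/negP => /avoid'; rewrite mem_last.
have wV : w \notin evertices G1 by apply/negP => /avoid; rewrite mem_head.
apply/negP => c.
have c1 : crossing x x' v b by apply: crossing_move c n3 _ _; apply: neq.
have c2 : crossing x x' w b.
  by apply: crossing_move c1 _ _ _; [rewrite crossing_flipr|apply: neq..].
rewrite -crossing_flipr in c2.
have := crossing_move c2 n4 (neq _ _ xV vV') (neq _ _ x'V vV').
by rewrite crossing_flipr n2.
Qed.

End Other.
End Bridge.
End Reduced.

Section Reduced.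
Variables (n : nat) (T T1 : lcgraph n).
Hypothesis tree : is_tree T.
Hypothesis multi : multipartite T.
Hypothesis s1 : step1 T T1.
Implicit Types (A B x y z u v s t : 'I_n) (G : egraph n).
Local Notation kept := (kept T T1).
Local Notation link := (link T T1).
Local Notation linked := (linked T T1).

Let conn : forall x y, connect T x y. Proof. by case: tree. Qed.

(** Colour the vertices by the side of the first edge uw of the connecting path, a bridge of the
    tree. E-graphs do not contain uw and are monochromatic. A link that changes colour has a path
    through u; as u is a vertex of an e-graph, it is an end of that path, and [other_x] and
    [other_y] identify the link. *)
Lemma link_bridge x y : link x y -> exists chi : pred 'I_n,
  [/\ forall a b, kept a b -> chi a = chi b,
      forall a b, link a b -> chi a != chi b -> (a = x /\ b = y) \/ (a = y /\ b = x)
    & chi x != chi y].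
Proof.
case/(linkP T1 multi) => G1 [G2 [i [j [u [P L]]]]].
have [[is1 is2 con] [u1 v2 x1 y2] [x' kx] [y' ky]] := L.
case: P L con v2 => [|w P] L con v2; first by case: con => -[].
exists (connect (cut T u w) u).
have ev G a b : is_egraph T G -> a \in everts G -> b \in everts G ->
    connect (cut T u w) u a = connect (cut T u w) u b.
  by move=> isG aG bG; exact: (bridge_everts tree multi L isG aG bG).
have far := bridge_far tree L.
split=> [a b kab|a b|].
- case/andP: (kab) => _ cab; have [G [isG _ _ aG]] := egraph_of cab.
  by apply: (ev G) => //; have [] := egraph_crossed multi isG cab aG.
- case/(linkP T1 multi) => G1' [G2' [i' [j' [u2 [p L']]]]].
  have core H1 H2 k k' q c d : linked H1 H2 k k' u q c d ->
      connect (cut T u w) u u != connect (cut T u w) u (last u q) ->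
      c = x /\ d = y.
    move=> L2; rewrite connect0 eq_sym eqb_id => /negbTE far2.
    have [_ _ [c' kc] [d' kd]] := L2; split.
      exact: (other_x tree multi s1 L kx ky L2 kc).
    exact: (other_y tree multi s1 L kx ky L2 kc kd far2).
  have [[is1' is2' con'] [u1' v2' a1 b2] [a' ka] [b' kb]] := L'.
  rewrite (ev _ _ _ is1' (earc_everts a1) (earc_everts u1')).
  rewrite (ev _ _ _ is2' (earc_everts b2) (earc_everts v2')) => ne.
  case: (con') => -[p0 uq pt] h1 h2 h3.
  have [eu|uu] := eqVneq u2 u.
    by left; rewrite eu in L' ne; exact: (core _ _ _ _ _ _ _ L' ne).
  have [el|ul] := eqVneq (last u2 p) u.
    right; have L'' := linked_rev L'; rewrite el in L''.
    have [_ e] := connects_rev con'; rewrite el in e.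
    have := core _ _ _ _ _ _ _ L''; rewrite el in ne; rewrite e eq_sym => /(_ ne).
    by case.
  have uV : u \in evertices G1 by case: con => _ h _ _; rewrite h ?mem_head ?eqxx.
  have uP : u \notin u2 :: p.
    apply/negP => uP; have := h3 G1 is1.
    case: (eqVneq (eedges G1) (eedges G1')) => [e _|/eqP n1].
      have := h1 u uP; rewrite -(evertices_eq e).
      by rewrite uV eq_sym (negbTE uu).
    case: (eqVneq (eedges G1) (eedges G2')) => [e _|/eqP n2 h].
      have := h2 u uP; rewrite -(evertices_eq e).
      by rewrite uV eq_sym (negbTE ul).
    by have := h n1 n2 u uP; rewrite uV.
  case/negP: ne; apply/eqP.
  apply: (same_connect_r (@cut_connect_sym _ T u w)).
  by apply/connectP; exists p => //; apply: (cut_path w (link_path L')).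
rewrite (ev _ _ _ is1 (earc_everts x1) (earc_everts u1)).
by rewrite (ev _ _ _ is2 (earc_everts y2) (earc_everts v2)) connect0 far.
Qed.

(** * Connectedness of the reduced form *)

Section Connected.
Variable chi : pred 'I_n.
Hypothesis chi_kept : forall a b, kept a b -> chi a = chi b.
Hypothesis chi_link : forall a b, link a b -> chi a = chi b.

(** An e-graph takes the colour of its kept edge. Only its vertices are coloured, not its arcs,
    because [connects] restricts paths by vertices. *)
Definition coloured (c : bool) v := exists G z z',
  [/\ is_egraph T G, v \in evertices G, z \in everts G, kept z z' & chi z = c].

Lemma coloured_egraph G z z' t t' : is_egraph T G -> z \in everts G ->
  t \in everts G -> kept z z' -> kept t t' -> chi z = chi t.
Proof.
move=> isG zG tG kz kt; case: (kept_in multi s1 isG kz kt zG tG) => -> //.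
exact: chi_kept.
Qed.

Lemma coloured_uniq v : coloured true v -> coloured false v -> False.
Proof.
case=> G [z [z' [isG vG zG kz cz]]] [H [t [t' [isH vH tH kt ct]]]].
have e := egraph_meet multi isG isH (evertices_everts isG vG) (evertices_everts isH vH).
have zH : z \in everts H.
  by apply: (eedges_everts isH (y := z')); rewrite -e; exact: (kept_vertex multi isG kz zG).
by have := coloured_egraph isH zH tH kz kt; rewrite cz ct.
Qed.

Lemma vertex_coloured G v : is_egraph T G -> v \in evertices G -> exists c, coloured c v.
Proof.
move=> isG vG; have [A [B [AG kAB _]]] := kept_rep multi s1 isG.
by exists (chi A), G, A, B.
Qed.

(** In a shortest counterexample no interior vertex belongs to an e-graph. Its edges are then
    uncrossed, since both ends of a crossed edge have the same colour. So the path connects two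
    e-graphs and gives a link between different colours. *)
Lemma coloured_path v P : path T v P -> coloured true v -> coloured false (last v P) ->
  False.
Proof.
have [k] := ubnP (size P); elim: k v P => // k IH v P0 lt0 pT0.
case/shortenP: pT0 lt0 => P pT uq sub lt0 cv cl.
have {sub lt0} lt : size P <= k.
  by rewrite -ltnS; apply: leq_ltn_trans lt0; apply: uniq_leq_size sub; case/andP: uq.
have interior c w : w \in P -> w != last v P -> coloured c w -> False.
  move=> wP wl cw; case/splitPr: wP lt pT wl cl {uq} => p1 p2.
  rewrite cat_path last_cat /= size_cat => lt /and3P[pp1 ww pp2] wl cl.
  have s2 : 0 < size p2 by case: (p2) wl => //=; rewrite eqxx.
  case: c cw => cw.
    apply: (IH w p2) => //=; move: lt => /=; lia.
  apply: (IH v (rcons p1 w)) => //; rewrite ?last_rcons ?rcons_path ?pp1 //.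
  by rewrite size_rcons; apply: leq_trans lt; rewrite -addn2 leq_add2l.
have P0' : P != [::] by apply/eqP => e; apply: (coloured_uniq cv); rewrite e in cl.
have ends c w : w \in v :: P -> coloured c w -> (w = v /\ c = true) \/ (w = last v P /\ c = false).
  rewrite inE => /orP[/eqP->|wP] cw.
    by left; split=> //; case: c cw => // /(coloured_uniq cv).
  have [wl|wl] := eqVneq w (last v P); last by case: (interior c w).
  by right; split=> //; case: c cw => //; rewrite wl => /coloured_uniq /(_ cl).
have vl : v != last v P.
  apply/eqP => e; case/andP: uq => /negP[]; rewrite {1}e.
  by case: (P) P0' => // a q _ /=; exact: mem_last.
have pU : path (uncrossed T) v P.
  apply: (@sub_in_path _ (mem (v :: P)) T) pT; last exact/allP.
  move=> a b aP bP ab; case: (edge_cases ab) => // cab.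
  have [G [isG abG _ _]] := egraph_of cab.
  have aV := eedges_vertex abG; have bV := eedges_vertex (eedges_sym isG abG).
  have [A [B [AG kAB _]]] := kept_rep multi s1 isG.
  have ca : coloured (chi A) a by exists G, A, B.
  have cb : coloured (chi A) b by exists G, A, B.
  have := edge_neq ab.
  case: (ends _ a aP ca) => -[ea ec]; case: (ends _ b bP cb) => -[eb ec'];
    by [rewrite ea eb eqxx|rewrite ec in ec'].
have [G1 [z1 [z1' [is1 vG1 z1G kz1 cz1]]]] := cv.
have [G2 [z2 [z2' [is2 vG2 z2G kz2 cz2]]]] := cl.
have con : connects T v P G1 G2.
  split=> //.
  - move=> w wP; apply/idP/eqP => [wG|->//].
    have cw : coloured true w by exists G1, z1, z1'.
    by case: (ends _ w wP cw) => -[].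
  - move=> w wP; apply/idP/eqP => [wG|->//].
    have cw : coloured false w by exists G2, z2, z2'.
    by case: (ends _ w wP cw) => -[].
  move=> G isG n1 n2 w wP; apply/negP => wG.
  have [c cw] := vertex_coloured isG wG.
  case: (ends _ w wP cw) => -[wE _].
    apply: n1; apply: (egraph_meet multi isG is1 (evertices_everts isG wG)).
    by apply: (evertices_everts is1); rewrite wE.
  apply: n2; apply: (egraph_meet multi isG is2 (evertices_everts isG wG)).
  by apply: (evertices_everts is2); rewrite wE.
have [i vi] := in_everts (evertices_everts is1 vG1).
have [j lj] := in_everts (evertices_everts is2 vG2).
have [x [xi [x' kx]]] := remaining_ex multi s1 i is1.
have [y [yj [y' ky]]] := remaining_ex multi s1 j is2.
have lxy : link x y.
  apply/(linkP T1 multi); exists G1, G2, i, j, v, P; split=> //; first by exists x'.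
  by exists y'.
have := chi_link lxy.
rewrite -(coloured_egraph is1 z1G (earc_everts xi) kz1 kx) cz1.
by rewrite -(coloured_egraph is2 z2G (earc_everts yj) kz2 ky) cz2.
Qed.

Lemma link_connected a a' b b' : kept a a' -> kept b b' -> chi a = chi b.
Proof.
wlog ca : a a' b b' / chi a = true.
  move=> H ka kb; case ca: (chi a); first by rewrite -(H a a' b b').
  case cb: (chi b) => //.
  by rewrite -ca -cb (H b b' a a').
move=> ka kb; apply/eqP; apply: contraT; rewrite ca => cb.
have cc x x' : kept x x' -> coloured (chi x) x.
  move=> kx; case/andP: (kx) => _ cx; have [G [isG _ xV xG]] := egraph_of cx.
  by exists G, x, x'.
have := cc _ _ ka; have := cc _ _ kb; rewrite ca; case: (chi b) cb => // _ cb cca.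
have /connectP[p pT e] := conn a b; rewrite e in cb.
by case: (coloured_path pT cca cb).
Qed.

End Connected.
End Reduced.

(** * The shape of reduced forms *)

(** What the enumeration uses of a reduced form: [M] stands for the chords of the pre-reduced form
    and [L] for the edges added in step 3. Two-colourings state the tree property without paths. *)
Record skeleton m (M L : rel 'I_m) : Prop := Skeleton {
  sk_sym : symmetric M;
  sk_fun : forall i j k, M i j -> M i k -> j = k;
  sk_total : forall i, exists j, M i j;
  sk_multi : forall i i' j j' k k', M i i' -> M j j' -> M k k' ->
    crossing i i' j j' -> crossing k k' i i' || crossing k k' j j';
  sk_no4 : forall i i' j j' k k' l l', M i i' -> M j j' -> M k k' -> M l l' ->
    ~~ [&& crossing i i' j j', crossing i i' k k', crossing i i' l l',
           crossing j j' k k', crossing j j' l l' & crossing k k' l l'];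
  sk_cross : forall i i', M i i' -> exists j j', M j j' /\ crossing i i' j j';
  sk_linksym : symmetric L;
  sk_link : forall i i' j j', L i j -> M i i' -> M j j' -> crossing i i' j j';
  sk_next : forall i i' j (s : 'I_m), L i j -> M i i' ->
    between i j i' -> ~~ between i s j;
  sk_prev : forall i i' j (s : 'I_m), L i j -> M i i' ->
    between i' j i -> ~~ between j s i;
  sk_bridge : forall i j, L i j -> exists chi : pred 'I_m,
    [/\ forall a b, M a b -> chi a = chi b,
        forall a b, L a b -> chi a != chi b -> (a = i /\ b = j) \/ (a = j /\ b = i)
      & chi i != chi j];
  sk_conn : forall chi : pred 'I_m, (forall a b, M a b -> chi a = chi b) ->
    (forall a b, L a b -> chi a = chi b) -> forall a b, chi a = chi b }.

Lemma ncrossing_linear (a b c c' : nat) : a < b -> ncrossing a b c c' ->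
  (a < c < b) && ((c' < a) || (b < c')) || (a < c' < b) && ((c < a) || (b < c)).
Proof. by rewrite /ncrossing /between => h /orP[]/andP[]; lia. Qed.

Lemma trapped_chord (a1 a2 a3 b1 b2 b3 c c' : nat) :
  a1 < a2 -> a2 < a3 -> a3 < b3 -> b3 < b2 -> b2 < b1 ->
  ncrossing a1 b1 c c' -> ncrossing a2 b2 c c' -> ncrossing a3 b3 c c' ->
  [&& between a2 a3 c, between c a1 a2, between b2 b1 c & between c b3 b2].
Proof.
move=> h1 h2 h3 h4 h5.
have l2 : a2 < b2 by lia.
have l1 : a1 < b1 by lia.
move=> /(ncrossing_linear l1) k1 /(ncrossing_linear l2) k2 /(ncrossing_linear h3) k3.
have hc : (a3 < c < b3) || (c < a1) || (b1 < c) by lia.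
by clear k1 k2 k3; move: hc; rewrite /between => /orP[/orP[]|] h; apply/and4P; split; lia.
Qed.

Section Skeleton.
Variables (m : nat) (M L : rel 'I_m).
Hypothesis sk : skeleton M L.

(** Otherwise the colouring that marks only i and i' would be constant along chords and links, while
    some other chord crosses ii'. *)
Lemma sk_has_link i i' : M i i' -> [exists c, L i c] || [exists c, L i' c].
Proof.
move=> Mi; apply: contraT; rewrite negb_or => /andP[/existsPn n1 /existsPn n2].
have [j [j' [Mj c]]] := sk_cross sk Mi.
have Mi' : M i' i by rewrite (sk_sym sk).
have := @sk_conn _ _ _ sk (fun z => (z == i) || (z == i')) _ _ i j.
rewrite eqxx /= => H; suff : (j == i) || (j == i').
  by case/orP => /eqP e; move: c; rewrite e ?crossing_endl // -crossing_flip crossing_endl.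
rewrite -H // => {H} a b ab.
  apply/idP/idP => /orP[]/eqP e; subst.
  - by rewrite (sk_fun sk ab Mi) eqxx orbT.
  - by rewrite (sk_fun sk ab Mi') eqxx.
  - by rewrite (sk_sym sk) in ab; rewrite (sk_fun sk ab Mi) eqxx orbT.
  by rewrite (sk_sym sk) in ab; rewrite (sk_fun sk ab Mi') eqxx.
have n1' c' : ~~ L c' i by rewrite (sk_linksym sk).
have n2' c' : ~~ L c' i' by rewrite (sk_linksym sk).
by apply/idP/idP => /orP[]/eqP e; subst; move: ab;
  rewrite ?(negbTE (n1 _)) ?(negbTE (n2 _)) ?(negbTE (n1' _)) ?(negbTE (n2' _)).
Qed.

Lemma sk_parallel i i' j j' k k' : M i i' -> M j j' -> M k k' ->
  crossing i i' j j' = false -> crossing i i' k k' -> crossing j j' k k'.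
Proof.
move=> Mi Mj Mk nij ik.
by have := sk_multi sk Mi Mk Mj ik; rewrite crossingC nij.
Qed.

(* the middle one of three parallel chords would not be linked to anything *)
Lemma sk_no3 p q a1 a2 a3 b1 b2 b3 : M p q -> M a1 b1 -> M a2 b2 -> M a3 b3 ->
  cdist p a1 < cdist p a2 -> cdist p a2 < cdist p a3 -> cdist p a3 < cdist p q ->
  crossing a1 b1 p q -> crossing a2 b2 p q -> crossing a3 b3 p q ->
  crossing a1 b1 a2 b2 = false -> crossing a2 b2 a3 b3 = false ->
  crossing a1 b1 a3 b3 = false -> False.
Proof.
move=> Mpq M1 M2 M3 l12 l23 lq c1 c2 c3 n12 n23 n13.
have kE a b c d : crossing a b c d = ncrossing (cdist p a) (cdist p b) (cdist p c) (cdist p d).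
  by rewrite crossing_ncrossing /ncrossing !between_cdist.
have far a b : crossing a b p q -> cdist p a < cdist p q -> cdist p q < cdist p b.
  rewrite kE cdist0; move: (cdist p a) (cdist p b) (cdist p q) => x y z.
  rewrite /ncrossing /between !ltn0 ?andbF ?orbF /= => h lt; move: h lt; clear.
  by case: (ltngtP x y) => hxy; lia.
have nest a b a' b' : crossing a b a' b' = false -> cdist p a < cdist p a' ->
    cdist p a' < cdist p b' -> cdist p a < cdist p b -> cdist p a' < cdist p q ->
    cdist p q < cdist p b -> b != b' -> cdist p b' < cdist p b.
  rewrite kE => h1 h2 h3 h4 h5 h6 bb'.
  have : cdist p b != cdist p b' by apply: contraNneq bb' => /cdist_inj ->.
  case: ltngtP => // lt _; move/negP: h1; case; apply/orP; left.
  rewrite /between; move: h2 h3 h4 h5 h6 lt; clear => *.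
  by apply/andP; split; lia.
have neqb a b a' b' : M a b -> M a' b' -> cdist p a < cdist p a' -> b != b'.
  move=> Ma Ma' lt; apply/eqP => e; rewrite (sk_sym sk) in Ma; rewrite (sk_sym sk) -e in Ma'.
  by move: lt; rewrite (sk_fun sk Ma Ma') ltnn.
have l13 := ltn_trans l12 l23; have l2q := ltn_trans l23 lq; have l1q := ltn_trans l12 l2q.
have f1 := far _ _ c1 l1q; have f2 := far _ _ c2 l2q; have f3 := far _ _ c3 lq.
have b21 := nest _ _ _ _ n12 l12 (ltn_trans l2q f2)
  (ltn_trans l1q f1) l2q f1 (neqb _ _ _ _ M1 M2 l12).
have b32 := nest _ _ _ _ n23 l23 (ltn_trans lq f3)
  (ltn_trans l2q f2) lq f2 (neqb _ _ _ _ M2 M3 l23).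
have trap c c' : M c c' -> crossing a2 b2 c c' ->
    [&& between a2 a3 c, between c a1 a2, between b2 b1 c & between c b3 b2].
  move=> Mc c2c.
  have c1c : crossing a1 b1 c c' by apply: (sk_parallel M2 M1 Mc) => //; rewrite crossingC.
  have c3c : crossing a3 b3 c c' by apply: (sk_parallel M2 M3 Mc).
  rewrite kE in c1c; rewrite kE in c2c; rewrite kE in c3c.
  by have := trapped_chord l12 l23 (ltn_trans lq f3) b32 b21 c1c c2c c3c; rewrite !between_cdist.
have side c c' : crossing a2 b2 c c' -> between a2 c b2 || between b2 c a2.
  by rewrite crossingE => /orP[/andP[-> _]//|/andP[_ ->]]; rewrite orbT.
case/orP: (sk_has_link M2) => /existsP[c Lc]; have [c' Mc] := sk_total sk c.
  have cr := sk_link sk Lc M2 Mc; have /and4P[t1 t2 _ _] := trap _ _ Mc cr.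
  case/orP: (side _ _ cr) => h.
    by have := sk_next sk a3 Lc M2 h; rewrite t1.
  by have := sk_prev sk a1 Lc M2 h; rewrite t2.
have M2' : M b2 a2 by rewrite (sk_sym sk).
have cr := sk_link sk Lc M2' Mc; rewrite crossing_flip in cr.
have /and4P[_ _ t1 t2] := trap _ _ Mc cr.
case/orP: (side _ _ cr) => h.
  by have := sk_prev sk b3 Lc M2' h; rewrite t2.
by have := sk_next sk b1 Lc M2' h; rewrite t1.
Qed.

Definition mate i := odflt i [pick j | M i j].

Lemma mateP i : M i (mate i).
Proof.
rewrite /mate; case: pickP => //= h.
by have [j] := sk_total sk i; rewrite h.
Qed.

Definition mcross i j := crossing i (mate i) j (mate j).

Lemma card_side (t : pred 'I_m) p : (forall i j, t i -> t j -> mcross i j = false) ->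
  (forall i, t i -> mcross i p) ->
  #|[pred i | t i && (cdist p i < cdist p (mate p))]| <= 2.
Proof.
move=> nc cr; rewrite leqNgt; apply/negP => lt.
set Z := [pred i | _ & _] in lt.
pose s := sort (relpre (cdist p) leq) (enum Z).
have us : uniq s by rewrite sort_uniq enum_uniq.
have so : sorted (relpre (cdist p) leq) s by apply: sort_sorted => a b; exact: leq_total.
have sz : 2 < size s by rewrite size_sort -cardE.
have mem : {subset s <= Z} by move=> z; rewrite mem_sort mem_enum.
case: s us so sz mem => // a1 [|a2 [|a3 s]] //= us so _ mem.
case/and3P: so => l12 l23 _.
have [/mem/andP[t1 q1] /mem/andP[t2 q2] /mem/andP[t3 q3]] :
  [/\ a1 \in a1 :: a2 :: a3 :: s, a2 \in a1 :: a2 :: a3 :: s & a3 \in a1 :: a2 :: a3 :: s].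
  by rewrite !inE !eqxx !orbT.
move: us; rewrite !inE !negb_or => /and3P[/and3P[n12 n13 _] /andP[n23 _] _].
have st a b : a != b -> cdist p a <= cdist p b -> cdist p a < cdist p b.
  by move=> ab; rewrite leq_eqVlt => /orP[/eqP/cdist_inj e|//]; rewrite e eqxx in ab.
exact: (sk_no3 (mateP p) (mateP a1) (mateP a2) (mateP a3) (st _ _ n12 l12) (st _ _ n23 l23)
  q3 (cr _ t1) (cr _ t2) (cr _ t3) (nc _ _ t1 t2) (nc _ _ t2 t3) (nc _ _ t1 t3)).
Qed.

Lemma mate_mate i : mate (mate i) = i.
Proof. by apply: (sk_fun sk (mateP _)); rewrite (sk_sym sk) mateP. Qed.

(** The points of a class are divided between the two sides of the chord at p, and [card_side]
    bounds each side. Points are counted, so four stands for two chords. *)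
Lemma card_type (t : pred 'I_m) p : (forall i j, t i -> t j -> mcross i j = false) ->
  (forall i, t i -> mcross i p) -> #|t| <= 4.
Proof.
move=> nc cr; have cr' i : t i -> mcross i (mate p).
  by move=> ti; rewrite /mcross mate_mate crossing_flipr; exact: cr.
apply: leq_trans (leq_add (card_side nc cr) (card_side nc cr')).
rewrite -cardUI; apply: leq_trans (leq_addr _ _); apply/subset_leq_card/subsetP => i ti.
rewrite !inE; rewrite unfold_in in ti; rewrite ti /= mate_mate.
have := cr _ ti; rewrite /mcross -[crossing _ _ _ _]crossingC crossingE.
rewrite -(between_cdist p) -(between_cdist p (mate p) (mate i) p) -(between_cdist (mate p) (mate p) i).
rewrite -(between_cdist p p (mate i)) !cdist0 /between.
by lia.
Qed.

(** For crossing chords at i0 and j0 the three classes are: not crossing the first, crossing only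
    the first, crossing both. Chords of the last class do not cross one another by [sk_no4]. *)
Lemma sk_bound : m <= 12.
Proof.
case: (posnP m) => [->//|m0]; pose i0 : 'I_m := Ordinal m0.
have [j0 [j0' [Mj c]]] := sk_cross sk (mateP i0).
have {}c : mcross i0 j0 by rewrite /mcross (sk_fun sk (mateP j0) Mj).
have XC i j : mcross i j = mcross j i by exact: crossingC.
have multi i j k : mcross i j -> mcross k i || mcross k j.
  by move=> h; apply: (sk_multi sk (mateP i) (mateP j) (mateP k) h).
have no4 i j k l : ~~ [&& mcross i j, mcross i k, mcross i l, mcross j k, mcross j l & mcross k l].
  by apply: (sk_no4 sk (mateP i) (mateP j) (mateP k) (mateP l)).
have := card_type (t := [pred i | ~~ mcross i i0]) (p := j0).
have := card_type (t := [pred i | mcross i i0 && ~~ mcross i j0]) (p := i0).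
have := card_type (t := [pred i | mcross i i0 && mcross i j0]) (p := i0).
move=> H2 H1 H0.
have {}H0 : #|[pred i | ~~ mcross i i0]| <= 4.
  apply: H0 => [i j /= /negbTE hi /negbTE hj|i /= /negbTE hi].
    by apply/negP => /multi h; have := h i0; rewrite !(XC i0) hi hj.
  by have := multi _ _ i c; rewrite hi.
have {}H1 : #|[pred i | mcross i i0 && ~~ mcross i j0]| <= 4.
  apply: H1 => [i j /= /andP[_ /negbTE hi] /andP[_ /negbTE hj]|i /= /andP[]//].
  by apply/negP => /multi h; have := h j0; rewrite !(XC j0) hi hj.
have {}H2 : #|[pred i | mcross i i0 && mcross i j0]| <= 4.
  apply: H2 => [i j /= /andP[h1 h2] /andP[h3 h4]|i /= /andP[]//].
  apply/negP => h; have := no4 i j i0 j0.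
  by rewrite h h1 h2 h3 h4 c.
rewrite -[m]card_ord -(cardID (fun i => mcross i i0)).
rewrite -(cardID (fun i => mcross i j0)).
apply: (@leq_trans (4 + 4 + 4)) => //; apply: leq_add; first apply: leq_add.
- apply: leq_trans H2; apply/subset_leq_card/subsetP => i.
  by rewrite !inE; case: (mcross i i0); case: (mcross i j0).
- by apply: leq_trans H1; apply/subset_leq_card/subsetP => i /andP[h1 /andP[_ h2]]; apply/andP.
by apply: leq_trans H0; apply/subset_leq_card/subsetP => i /andP[h1 _].
Qed.

End Skeleton.

(** * Enumeration *)

(* [&&], [==>], [all] and [has] are strict under [vm_compute]; the conditionals below
   are not *)
Fixpoint every (A : Type) (a : A -> bool) (s : seq A) : bool :=
  if s is x :: s' then if a x then every a s' else false else true.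

Fixpoint some (A : Type) (a : A -> bool) (s : seq A) : bool :=
  if s is x :: s' then if a x then true else some a s' else false.

Lemma everyE (A : Type) (a : A -> bool) (s : seq A) : every a s = all a s.
Proof. by elim: s => //= x s ->; case: (a x). Qed.

Lemma someE (A : Type) (a : A -> bool) (s : seq A) : some a s = has a s.
Proof. by elim: s => //= x s ->; case: (a x). Qed.

Definition prefix_ok m (s : seq nat) (x : nat) : bool :=
  let k := size s in let j := index k s in
  if j < k then x == j else (k < x < m) && (x \notin s).

Fixpoint matchings m k : seq (seq nat) :=
  if k is k'.+1 then
    flatten [seq [seq rcons s x | x <- iota 0 m & prefix_ok m s x] | s <- matchings m k']
  else [:: [::]].

Definition chords_cross (pt : seq nat) (i j : nat) : bool :=
  ncrossing i (nth 0 pt i) j (nth 0 pt j).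

(** The three tests are [sk_cross], [sk_multi] and [sk_no4]. *)
Definition shape_ok m (pt : seq nat) : bool :=
  let I := iota 0 m in let X := chords_cross pt in
  if every (fun i => some (X i) I) I then
  if every (fun i => every (fun j => if X i j then
       every (fun k => if X k i then true else X k j) I else true) I) I then
  every (fun i => every (fun j => if X i j then every (fun k =>
      if X i k then if X j k then
        every (fun l => if X i l then if X j l then ~~ X k l else true else true) I
      else true else true) I else true) I) I
  else false else false.

Fixpoint masks (g : seq bool) : seq (seq bool) :=
  if g is b :: g' then
    let ms := masks g' in
    (if b then [seq true :: l | l <- ms] else [::]) ++ [seq false :: l | l <- ms]
  else [:: [::]].

(** Entry i allows a link between i and its successor: links occur only between neighbouring ends of
    crossing chords. *)
Definition gaps m pt := [seq chords_cross pt i (i.+1 %% m) | i <- iota 0 m].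

Definition graph_rel m (pt : seq nat) (lk : seq bool) : rel nat := fun i j =>
  [|| nth 0 pt i == j, nth false lk i && (j == i.+1 %% m)
    | nth false lk j && (i == j.+1 %% m)].

Definition expand m (r : rel nat) (s : seq nat) : seq nat :=
  [seq j <- iota 0 m | (j \in s) || has (fun i => r i j) s].

Definition component m r i := iter m (expand m r) [:: i].

(** Testing that a computed component is closed replaces a proof that enough rounds of [expand] were
    made. Where only reachability matters, as in the bridge test of [refuted], no such test is
    made. *)
Definition stable m (r : rel nat) (s : seq nat) :=
  every (fun i => every (fun j => if r i j then (i \in s) == (j \in s) else true)
    (iota 0 m)) (iota 0 m).

Definition edge_rel (s : seq (nat * nat)) (x y : nat) :=
  (x != y) && (((x, y) \in s) || ((y, x) \in s)).

Definition rotates m (r : rel nat) (s : seq (nat * nat)) k :=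
  every (fun i => every (fun j => r i j == edge_rel s ((i + k) %% m) ((j + k) %% m)) (iota 0 m))
    (iota 0 m).

Definition forms : seq (nat * seq (nat * nat) * seq (nat * nat)) :=
  [:: (4, E2_1, [:: (0, 1)]);
      (6, E2_2, [:: (5, 0); (3, 4)]); (6, E2_2, [:: (5, 0); (2, 3)]);
      (6, E2_2, [:: (0, 1); (3, 4)]);
      (8, E2_3, [:: (0, 1); (2, 3); (4, 5)]);
      (6, E2_4, [:: (0, 1); (1, 2)]); (6, E2_4, [:: (0, 1); (2, 3)]);
      (8, E2_5, [:: (4, 5); (0, 1); (5, 6)]); (8, E2_5, [:: (4, 5); (0, 1); (6, 7)]);
      (8, E2_5, [:: (4, 5); (2, 3); (1, 2)]); (8, E2_5, [:: (4, 5); (2, 3); (5, 6)]);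
      (8, E2_5, [:: (4, 5); (2, 3); (6, 7)]); (8, E2_5, [:: (6, 7); (2, 3); (1, 2)]);
      (10, E2_6, [:: (0, 1); (2, 3); (4, 5); (5, 6)]);
      (10, E2_6, [:: (2, 3); (4, 5); (5, 6); (7, 8)]);
      (10, E2_6, [:: (0, 1); (2, 3); (4, 5); (9, 0)]);
      (10, E2_6, [:: (0, 1); (2, 3); (5, 6); (7, 8)]);
      (10, E2_6, [:: (0, 1); (4, 5); (5, 6); (9, 0)]);
      (10, E2_6, [:: (2, 3); (4, 5); (7, 8); (9, 0)])].

(** The matching is compared separately, since the union does not show which edges are chords; a
    single rotation has to fit both. *)
Definition matches m pt lk (e : nat * seq (nat * nat) * seq (nat * nat)) :=
  if m == e.1.1 then some (fun k =>
    if rotates m (fun i j => nth 0 pt i == j) e.1.2 k then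
    rotates m (graph_rel m pt lk) (e.1.2 ++ e.2) k else false) (iota 0 m) else false.

Definition refuted m pt lk :=
  let r := graph_rel m pt lk in
  let s := component m r 0 in
  if (if stable m r s then ~~ every (mem s) (iota 0 m) else false) then true else
  some (fun i => if nth false lk i then
        ((i.+1 %% m) \in component m (graph_rel m pt (set_nth false lk i false)) i)
      else false) (iota 0 m).

Definition check m := every (fun pt => if shape_ok m pt then
   every (fun lk => if refuted m pt lk then true else some (matches m pt lk) forms)
     (masks (gaps m pt)) else true)
  (matchings m m).

(** The sizes are those left by [sk_bound]; zero is excluded because genus one provides a kept
    edge. *)
Lemma check_bounded : every check (iota 1 12).
Proof. by vm_compute. Qed.

Lemma masks_map (A : eqType) (f g : A -> bool) (s : seq A) :
  (forall x, x \in s -> f x -> g x) -> map f s \in masks (map g s).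
Proof.
elim: s => //= x s IH h; rewrite mem_cat.
have {}IH : map f s \in masks (map g s) by apply: IH => y ys; apply: h; rewrite inE ys orbT.
have := h x (mem_head _ _); case: (f x) => [-> //|_].
  by apply/orP; left; apply/mapP; exists (map f s).
by apply/orP; right; apply/mapP; exists (map f s).
Qed.

(** * A skeleton as a candidate of the enumeration *)

Section Classify.
Variables (m : nat) (M L : rel 'I_m).
Hypothesis sk : skeleton M L.
Local Notation mate := (mate M).

Definition pts := [seq val (mate i) | i <- enum 'I_m].
Definition lks := [seq L i (ordS i) | i <- enum 'I_m].

Lemma size_pts : size pts = m. Proof. by rewrite size_map size_enum_ord. Qed.

Lemma nth_pts (i : 'I_m) : nth 0 pts i = mate i.
Proof. by rewrite (nth_map i) ?size_enum_ord // nth_ord_enum. Qed.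

Lemma nth_lks (i : 'I_m) : nth false lks i = L i (ordS i).
Proof. by rewrite (nth_map i) ?size_enum_ord // nth_ord_enum. Qed.

Lemma mate_eq (i j : 'I_m) : (mate i == j) = M i j.
Proof.
apply/eqP/idP => [<-|]; first exact: mateP sk i.
exact: (sk_fun sk (mateP sk i)).
Qed.

Lemma mate_neq (i : 'I_m) : mate i != i.
Proof.
apply/eqP => e; have [j [j' [_ c]]] := sk_cross sk (mateP sk i).
by move: c; rewrite e crossingE /between; lia.
Qed.

Lemma pts_matching : pts \in matchings m m.
Proof.
suff h k : k <= m -> take k pts \in matchings m k.
  by have := h m (leqnn m); rewrite -{1}size_pts take_size.
elim: k => [|k IH] km; first by rewrite take0.
rewrite (take_nth 0) ?size_pts //=; apply/flatten_mapP; exists (take k pts).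
  by apply: IH; lia.
pose i := Ordinal km; rewrite (nth_pts i : nth 0 pts k = _).
apply/mapP; exists (val (mate i)) => //; rewrite mem_filter mem_iota /= ltn_ord andbT.
have sz : size (take k pts) = k by rewrite size_takel // size_pts ltnW.
have nt (j : 'I_m) : j < k -> nth 0 (take k pts) j = mate j.
  by move=> jk; rewrite nth_take // nth_pts.
rewrite /prefix_ok sz; case: ifP => h.
  have jm : index k (take k pts) < m by lia.
  have := nth_index 0 (_ : k \in take k pts); rewrite -index_mem sz => /(_ h).
  have := nt (Ordinal jm) h; rewrite /= => -> e.
  have {}e : mate (Ordinal jm) = i by exact: val_inj.
  by rewrite -e (mate_mate sk).
have kn : k \notin take k pts by rewrite -index_mem sz h.
apply/andP; split; last first.
  apply/negP => /(nthP 0)[j]; rewrite sz => jk; have jm : j < m by lia.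
  rewrite -[j]/(val (Ordinal jm)) nt // => /val_inj e.
  have := mate_mate sk (Ordinal jm); rewrite e (mate_mate sk) => /(congr1 val) /= ij.
  by move: jk; rewrite -ij ltnn.
rewrite ltn_ord andbT ltn_neqAle leqNgt; apply/andP; split.
  by have := mate_neq i; rewrite -val_eqE /= eq_sym.
apply: contra kn => lt; apply/(nthP 0); exists (val (mate i)); rewrite ?sz // nt //.
by rewrite (mate_mate sk).
Qed.

Lemma cross_pts (i j : 'I_m) : chords_cross pts i j = mcross M i j.
Proof. by rewrite /chords_cross !nth_pts /mcross crossing_ncrossing. Qed.

Lemma pts_shape : shape_ok m pts.
Proof.
have multi (i j k : 'I_m) : mcross M i j -> mcross M k i || mcross M k j.
  by move=> h; apply: (sk_multi sk (mateP sk i) (mateP sk j) (mateP sk k) h).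
rewrite /shape_ok !everyE.
have -> : all (fun i => some (chords_cross pts i) (iota 0 m)) (iota 0 m).
  apply/allP => i; rewrite mem_iota /= => hi; rewrite someE; apply/hasP.
  have [j [j' [Mj c]]] := sk_cross sk (mateP sk (Ordinal hi)).
  exists (val j); first by rewrite mem_iota /=.
  by rewrite -[i]/(val (Ordinal hi)) cross_pts /mcross (sk_fun sk (mateP sk j) Mj).
have -> : all (fun i => every (fun j => if chords_cross pts i j then
    every (fun k => if chords_cross pts k i then true else chords_cross pts k j) (iota 0 m)
    else true) (iota 0 m)) (iota 0 m).
  apply/allP => i; rewrite mem_iota /= => hi; rewrite everyE.
  apply/allP => j; rewrite mem_iota /= => hj; case: ifP => // ij; rewrite everyE.
  apply/allP => k; rewrite mem_iota /= => hk.
  move: ij; rewrite -[i]/(val (Ordinal hi)) -[j]/(val (Ordinal hj)) -[k]/(val (Ordinal hk)).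
  by rewrite !cross_pts => /multi h; have := h (Ordinal hk); case: (mcross M _ _).
apply/allP => i; rewrite mem_iota /= => hi; rewrite everyE.
apply/allP => j; rewrite mem_iota /= => hj; case: ifP => // ij; rewrite everyE.
apply/allP => k; rewrite mem_iota /= => hk; case: ifP => // ik; case: ifP => // jk; rewrite everyE.
apply/allP => l; rewrite mem_iota /= => hl; case: ifP => // il; case: ifP => // jl.
move: ij ik jk il jl; rewrite -[i]/(val (Ordinal hi)) -[j]/(val (Ordinal hj)).
rewrite -[k]/(val (Ordinal hk)) -[l]/(val (Ordinal hl)) !cross_pts => ij ik jk il jl.
have := sk_no4 sk (mateP sk (Ordinal hi)) (mateP sk (Ordinal hj)) (mateP sk (Ordinal hk))
  (mateP sk (Ordinal hl)).
by rewrite -!/(mcross M _ _) ij ik jk il jl.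
Qed.

Lemma lks_mask : lks \in masks (gaps m pts).
Proof.
rewrite /gaps -val_enum_ord -map_comp; apply: masks_map => i _ /= Li.
rewrite -[_ %% m]/(val (ordS i)) cross_pts /mcross.
exact: (sk_link sk Li (mateP sk i) (mateP sk (ordS i))).
Qed.

Lemma between_succ (i j : nat) : i < m -> j < m -> i != j -> j != i.+1 %% m ->
  between i (i.+1 %% m) j.
Proof.
move=> hi hj ij; have [lt|ge] := ltnP i.+1 m; first by rewrite modn_small // /between; lia.
have e : i.+1 = m by lia.
by rewrite e modnn /between => j0; lia.
Qed.

Lemma add2_mod (i : nat) : 2 < m -> i < m -> i.+2 %% m <> i.
Proof.
move=> m2 im; have [lt|ge] := ltnP i.+2 m; first by rewrite modn_small //; lia.
rewrite (_ : i.+2 = i.+2 - m + m); last by lia.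
by rewrite modnDr modn_small; lia.
Qed.

(** Every point is the end of a chord, so nothing at all may lie between two linked points. *)
Lemma link_succ (i j : 'I_m) : L i j -> j = ordS i \/ i = ordS j.
Proof.
move=> Lij; have Mi := mateP sk i; have c := sk_link sk Lij Mi (mateP sk j).
have ij : val i != val j.
  by apply: contraTneq c => /val_inj ->; rewrite crossing_irrefl.
move: c; rewrite crossingE => /orP[/andP[b _]|/andP[_ b]].
  left; apply/eqP; rewrite -val_eqE; apply/negPn/negP => ne.
  have /negP := sk_next sk (ordS i) Lij Mi b; apply.
  exact: between_succ.
right; apply/eqP; rewrite -val_eqE; apply/negPn/negP => ne.
have /negP := sk_prev sk (ordS j) Lij Mi b; apply.
by apply: between_succ => //; rewrite eq_sym.
Qed.

Lemma graph_relE (i j : 'I_m) : graph_rel m pts lks i j = M i j || L i j.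
Proof.
rewrite /graph_rel nth_pts !nth_lks -mate_eq; congr (_ || _).
rewrite -[i.+1 %% m]/(val (ordS i)) -[j.+1 %% m]/(val (ordS j)) !val_eqE.
apply/idP/idP => [/orP[]/andP[h /eqP e]|Lij].
- by rewrite e.
- by rewrite (sk_linksym sk) e.
case: (link_succ Lij) => e; [rewrite -e Lij eqxx //|].
by rewrite -[ordS j]e (sk_linksym sk j) Lij eqxx orbT.
Qed.

Lemma component_start r i : i < m -> i \in component m r i.
Proof.
move=> im; rewrite /component; elim: {1}m => [|k IH] /=; first by rewrite inE.
by rewrite mem_filter mem_iota /= im IH.
Qed.

Lemma component_ind (P : nat -> Prop) (r : rel nat) i : i < m -> P i ->
  (forall a b, a < m -> b < m -> P a -> r a b -> P b) ->
  forall j, j \in component m r i -> P j.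
Proof.
move=> im Pi h.
suff H k j : j \in iter k (expand m r) [:: i] -> j < m /\ P j.
  by move=> j /H[].
elim: k j => [|k IH] j /=; first by rewrite inE => /eqP ->.
rewrite mem_filter mem_iota /= => /andP[/orP[/IH //|/hasP[a /IH[am Pa] raj]] jm].
by split=> //; exact: h raj.
Qed.

Lemma not_refuted : 0 < m -> refuted m pts lks = false.
Proof.
move=> m0; rewrite /refuted everyE.
case: ifP => [|_].
  case: ifP => // st; set s := component _ _ _ in st *.
  pose chi (z : 'I_m) := val z \in s.
  have stE (a b : 'I_m) : graph_rel m pts lks a b -> chi a = chi b.
    move: st; rewrite /stable everyE => /allP/(_ (val a)).
    rewrite mem_iota /= ltn_ord everyE => /(_ isT) /allP/(_ (val b)).
    by rewrite mem_iota /= ltn_ord => /(_ isT); case: ifP => // _ /eqP.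
  have cc := @sk_conn _ _ _ sk chi.
  have all0 a : chi a = chi (Ordinal m0).
    by apply: cc => x y xy; apply: stE; rewrite graph_relE xy ?orbT.
  case/negP; apply/allP => z; rewrite mem_iota /= => zm.
  by have := all0 (Ordinal zm); rewrite /chi /= component_start.
rewrite someE; apply/negbTE/hasPn => i; rewrite mem_iota /= => im.
pose I := Ordinal im; rewrite -[i]/(val I) nth_lks; case: ifP => // LI.
have [chi [cM cL cne]] := sk_bridge sk LI.
(* For m = 2 the gaps after a point and after its successor join the same pair, and clearing one
   entry of [lks] would not delete the link. *)
have m2 : 2 < m.
  have := sk_link sk LI (mateP sk I) (mateP sk (ordS I)); rewrite crossing_ncrossing /ncrossing /between.
  have := ltn_ord I; have := ltn_ord (mate I); have := ltn_ord (ordS I).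
  have := ltn_ord (mate (ordS I)).
  move: (val I) (val (mate I)) (val (ordS I)) (val (mate (ordS I))).
  by clear => a b c d ? ? ? ? /orP[]/andP[]; lia.
apply/negP => hin.
have : forall t : 'I_m, val t = (val I).+1 %% m -> chi t = chi I.
  move: hin; apply: (@component_ind (fun z => forall t : 'I_m, val t = z -> chi t = chi I)) => //.
    by move=> t /val_inj ->.
  move=> a b am bm Pa rab t tb.
  rewrite -(Pa (Ordinal am) erefl); move: rab; rewrite -tb -[a]/(val (Ordinal am)).
  set A := Ordinal am.
  rewrite /graph_rel nth_pts !nth_set_nth /=.
  rewrite -[a]/(val A) val_eqE mate_eq -[_.+1 %% m]/(val (ordS A)) -[t.+1 %% m]/(val (ordS t)).
  rewrite !val_eqE !nth_lks.
  have key (u : 'I_m) : u != I -> L u (ordS u) -> chi u = chi (ordS u).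
    move=> uI Lu; apply/eqP; apply: contraT => ne; case: (cL _ _ Lu ne) => -[e1 e2].
      by rewrite e1 eqxx in uI.
    have : ordS (ordS I) = I by rewrite -e1 e2.
    move/(congr1 val) => /=; rewrite -addn1 modnDml addn1.
    by move/(add2_mod m2 (ltn_ord I)).
  case/or3P => [/cM ->//||].
    by case: eqVneq => // AI /andP[LA /eqP ->]; rewrite -key.
  by case: eqVneq => // tI /andP[Lt /eqP ->]; rewrite -key.
move/(_ (ordS I) erefl) => e; by rewrite e eqxx in cne.
Qed.

Lemma classification : 0 < m -> exists2 e, e \in forms & m = e.1.1 /\
  exists k, (forall i j : 'I_m, M i j = edge_rel e.1.2 ((i + k) %% m) ((j + k) %% m)) /\
  forall i j : 'I_m, M i j || L i j = edge_rel (e.1.2 ++ e.2) ((i + k) %% m) ((j + k) %% m).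
Proof.
move=> m0; have m12 := sk_bound sk.
have := check_bounded; rewrite everyE => /allP/(_ m).
rewrite mem_iota m0 /= ltnS m12 => /(_ isT).
rewrite /check everyE => /allP/(_ _ pts_matching); rewrite pts_shape everyE.
move/allP/(_ _ lks_mask); rewrite not_refuted // someE => /hasP[e ef].
rewrite /matches; case: eqP => // me; rewrite someE => /hasP[k _].
case: ifP => // r1 r2; exists e => //; split=> //; exists k.
have rot r s : rotates m r s k -> forall i j : 'I_m,
    r i j = edge_rel s ((i + k) %% m) ((j + k) %% m).
  rewrite /rotates everyE => /allP h i j; have := h (val i).
  rewrite mem_iota /= ltn_ord => /(_ isT); rewrite everyE => /allP/(_ (val j)).
  by rewrite mem_iota /= ltn_ord => /(_ isT) /eqP.
split=> i j; first by rewrite -(rot _ _ r1) nth_pts val_eqE mate_eq.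
by rewrite -(rot _ _ r2) graph_relE.
Qed.

End Classify.

(** * The forms of a tree of genus one *)

Section Transfer.
Variables (n : nat) (T T1 : lcgraph n) (a b : 'I_n * 'I_n).
Hypothesis tree : is_tree T.
Hypothesis r2 : rank2 T a b.
Hypothesis s1 : step1 T T1.
Variables (m : nat) (f : 'I_m -> 'I_n).
Hypothesis fP : renumbering T1 f.

Let multi := rank2_multipartite r2.

Definition kept_rel : rel 'I_m := fun i j => kept T T1 (f i) (f j).
Definition link_rel : rel 'I_m := fun i j => `[< link T T1 (f i) (f j) >].

Lemma f_lt i j : (f i < f j) = (i < j).
Proof.
have [h _] := fP; case: (ltngtP i j) => [/h -> //|/h lt|/val_inj ->]; last by rewrite ltnn.
by apply/negbTE; rewrite -leqNgt ltnW.
Qed.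

Lemma f_inj : injective f.
Proof.
move=> i j e; apply: val_inj; apply/eqP; rewrite eqn_leq (leqNgt i j) (leqNgt j i) -!f_lt.
by rewrite e ltnn.
Qed.

Lemma f_between i j k : between (f i) (f j) (f k) = between i j k.
Proof. by rewrite /between !f_lt. Qed.

Lemma f_crossing i j k l : crossing (f i) (f j) (f k) (f l) = crossing i j k l.
Proof. by rewrite !crossingE !f_between. Qed.

Lemma f_onto x y : kept T T1 x y -> exists i, f i = x.
Proof.
move=> k; have [_ h] := fP; apply/h; exists y.
by rewrite (crossed_kept multi s1).
Qed.

Lemma f_kept i : exists j, kept_rel i j.
Proof.
have [_ h] := fP; have [|y] := (h (f i)).1; first by exists i.
rewrite (crossed_kept multi s1) => k; have k' := k; rewrite kept_sym in k'.
by have [j e] := f_onto k'; exists j; rewrite /kept_rel e.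
Qed.

Lemma transfer_skeleton : skeleton kept_rel link_rel.
Proof.
split.
- by move=> i j; rewrite /kept_rel kept_sym.
- by move=> i j k h1 h2; apply: f_inj; exact: (kept_fun multi s1 h1 h2).
- exact: f_kept.
- move=> i i' j j' k k' Mi Mj Mk; rewrite -!f_crossing => c.
  by case/andP: Mk => _ ck; exact: (multi (kept_edge Mi) (kept_edge Mj) c ck).
- move=> i i' j j' k k' l l' Mi Mj Mk Ml; rewrite -!f_crossing.
  exact: (rank2_no4 r2 (c1 := (f i, f i')) (c2 := (f j, f j')) (c3 := (f k, f k'))
    (c4 := (f l, f l')) (kept_edge Mi) (kept_edge Mj) (kept_edge Mk) (kept_edge Ml)).
- move=> i i' /(kept_crosses multi s1)[u [v [k c]]].
  have [j ej] := f_onto k; have k' := k; rewrite kept_sym in k'.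
  have [j' ej'] := f_onto k'; exists j, j'; rewrite /kept_rel ej ej' -f_crossing ej ej'.
  by split.
- by move=> i j; apply/asboolP/asboolP => /(link_sym multi).
- move=> i i' j j' /asboolP lij Mi Mj; rewrite -f_crossing.
  exact: (link_cross tree multi lij Mi Mj).
- move=> i i' j s /asboolP lij Mi; rewrite -!f_between => h.
  have [j' Mj] := f_kept j; have [s' Ms] := f_kept s.
  exact: (link_next tree multi s1 lij Mi Mj h Ms).
- move=> i i' j s /asboolP lij Mi; rewrite -!f_between => h.
  have [j' Mj] := f_kept j; have [s' Ms] := f_kept s.
  exact: (link_prev tree multi s1 lij Mi Mj h Ms).
- move=> i j /asboolP /(link_bridge tree multi s1)[chi [h1 h2 h3]].
  exists (chi \o f); split=> //= [c d /h1 //|c d /asboolP l ne].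
  by case: (h2 _ _ l ne) => -[/f_inj -> /f_inj ->]; [left|right].
move=> chi h1 h2 c d.
(* [g] inverts [f], so a colouring of the points extends to the vertices of the tree. The default is
   immaterial: ends of kept edges and links lie in the image of [f]. *)
pose g x := odflt c [pick i | f i == x].
have gf i : g (f i) = i.
  rewrite /g; case: pickP => /= [j /eqP/f_inj //|/(_ i)]; by rewrite eqxx.
have [c' Mc] := f_kept c; have [d' Md] := f_kept d.
have := @link_connected _ _ _ tree multi s1 (chi \o g) _ _ _ _ _ _ Mc Md.
rewrite /= !gf; apply=> x y.
  move=> k; have [i ei] := f_onto k; have k' := k; rewrite kept_sym in k'.
  have [j ej] := f_onto k'; subst; rewrite !gf; exact: h1.
move=> l; have := l; case/(linkP T1 multi) => G1 [G2 [i0 [j0 [u [P [_ _ [x' kx] [y' ky]]]]]]].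
have [i ei] := f_onto kx; have [j ej] := f_onto ky; subst; rewrite !gf.
by apply: h2; apply/asboolP.
Qed.

Lemma transfer_pos : 0 < m.
Proof.
have [aT bT ab _] := r2.
have ca : crossed T a.1 a.2 by apply: crossing_crossed ab.
have [x [y [k _]]] := kept_parallel multi s1 ca.
by have [i _] := f_onto k; have := ltn_ord i; lia.
Qed.

End Transfer.

Lemma uciso_rotation m n (G : lcgraph m) (H : lcgraph n) k : m = n ->
  (forall (i j : 'I_m) (i' j' : 'I_n), val i' = (i + k) %% m -> val j' = (j + k) %% m ->
     G i j = H i' j') -> uciso G H.
Proof.
move=> mn; subst m => h; split=> //; exists k => i j i' j' ei ej.
by apply: h; rewrite -?ei -?ej modn_small.
Qed.

Lemma uciso_sym m n (G : lcgraph m) (H : lcgraph n) : uciso G H -> uciso H G.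
Proof.
case=> mn; subst m => -[r h]; split=> //; exists (n - r %% n) => i j i' j' e1 e2.
have n0 : 0 < n by case: (n) i {h i' j' j e1 e2} => // -[].
have back (x x' : 'I_n) : x' = x + (n - r %% n) %[mod n] -> x = x' + r %[mod n].
  move=> e; rewrite -modnDml e modnDml -addnA -modnDmr -(modnDmr _ r).
  by rewrite subnK ?(ltnW (ltn_pmod _ _)) // modnn addn0.
by symmetry; apply: h; apply: back.
Qed.

Lemma uciso_trans m n p (G : lcgraph m) (H : lcgraph n) (K : lcgraph p) :
  uciso G H -> uciso H K -> uciso G K.
Proof.
case=> mn; subst m => -[r h] [np]; subst p => -[s h']; split=> //.
exists (r + s) => i j i' j' e1 e2.
have n0 : 0 < n by case: (n) i {h h' i' j' j e1 e2} => // -[].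
pose x (t : 'I_n) : 'I_n := Ordinal (ltn_pmod (t + r) n0).
rewrite (h i j (x i) (x j)) ?modn_mod //; apply: h' => /=.
  by rewrite modnDml -addnA.
by rewrite modnDml -addnA.
Qed.

Lemma unlabel_eq m n (G : lcgraph m) (H : lcgraph n) : uciso G H -> unlabel G = unlabel H.
Proof.
move=> iso; apply: funext => K; apply: propext; split; apply: uciso_trans => //.
exact: uciso_sym.
Qed.

Definition form_graph m (s : seq (nat * nat)) : lcgraph m :=
  LCGraph (@of_edges_sym m s) (@of_edges_irrefl m s).

Lemma of_edgesE m s : of_edges m s = unlabel (form_graph m s). Proof. by []. Qed.

Lemma form_graphE m s (i j : 'I_m) : form_graph m s i j = edge_rel s i j.
Proof. by rewrite /= /of_edges_rel /edge_rel -val_eqE. Qed.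

Section Forms.
Variables (n : nat) (T T1 : lcgraph n).
Hypothesis tree : is_tree T.
Hypothesis gen1 : genus T = 1%R.
Hypothesis s1 : step1 T T1.
Variables (m : nat) (f : 'I_m -> 'I_n).
Hypothesis fP : renumbering T1 f.

Lemma forms_complete : exists2 e, e \in forms &
  (forall G : lcgraph m, (forall i j, G i j <-> crossed T1 (f i) (f j)) ->
     unlabel G = of_edges e.1.1 e.1.2) /\
  (forall G : lcgraph m, (forall i j, G i j <-> [\/ crossed T1 (f i) (f j),
        step3_edge T T1 (f i) (f j) | step3_edge T T1 (f j) (f i)]) ->
     unlabel G = of_edges e.1.1 (e.1.2 ++ e.2)).
Proof.
have /genus1P[a [b r2]] := gen1; have multi := rank2_multipartite r2.
have sk := transfer_skeleton tree r2 s1 fP.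
have [e ef [me [k [h1 h2]]]] := classification sk (transfer_pos r2 s1 fP).
exists e => //; move: me h1 h2 => me; rewrite -{}me => h1 h2; split=> G hG.
  apply/unlabel_eq/(uciso_rotation (k := k)) => // i j i' j' ei ej.
  rewrite form_graphE ei ej -h1; apply/idP/idP => [/hG|h]; first by rewrite (crossed_kept multi s1).
  by apply/hG; rewrite (crossed_kept multi s1).
apply/unlabel_eq/(uciso_rotation (k := k)) => // i j i' j' ei ej.
rewrite form_graphE ei ej -h2 /kept_rel -(crossed_kept multi s1); apply/idP/idP.
  case/hG => [->//|l|l]; apply/orP; right; apply/asboolP => //.
  exact: (link_sym multi l).
case/orP => [c|/asboolP l]; apply/hG; first by constructor 1.
by constructor 2.
Qed.

End Forms.

(** * Trees which are their own reduced form *)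

(** Descending ranks connect every vertex to the root. On a cycle of length at least three the
    vertex of largest rank would have two neighbours of smaller rank. *)
Lemma ranked_tree n (T : lcgraph n) (g : 'I_n -> nat) (x0 : 'I_n) :
  injective g -> (forall x, x = x0 \/ exists2 y, T x y & g y < g x) ->
  (forall x y z, T x y -> T x z -> g y < g x -> g z < g x -> y = z) -> is_tree T.
Proof.
move=> gI par uni; split.
- exact: leq_ltn_trans (ltn_ord x0).
- have sT : connect_sym T by apply: sym_connect_sym => x y; exact: adj_sym.
  suff h x : connect T x x0 by move=> x y; apply: connect_trans (h x) _; rewrite sT h.
  have [k] := ubnP (g x); elim: k x => // k IH x lt.
  case: (par x) => [->//|[y xy gy]]; apply: connect_trans (connect1 xy) (IH y _).
  by apply: leq_trans gy _.
move=> p /andP[cp up]; rewrite leqNgt; apply/negP => sz.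
have [x xp xmax] : exists2 x, x \in p & forall y, y \in p -> g y <= g x.
  case: p sz {cp up} => // z p _; exists [arg max_(i > z in z :: p) g i].
    by case: arg_maxnP; rewrite ?mem_head.
  by case: arg_maxnP => [|i _ h]; rewrite ?mem_head.
case/rot_to: xp => k q rq.
have {}cp : cycle T (x :: q) by rewrite -rq rot_cycle.
have {}up : uniq (x :: q) by rewrite -rq rot_uniq.
have {}xmax y : y \in q -> g y < g x.
  move=> yq; have yp : y \in p by rewrite -(mem_rot k) rq inE yq orbT.
  rewrite ltn_neqAle xmax // andbT.
  by apply: contraTneq yq => /gI ->; case/andP: up.
have {sz} : 1 < size q by move: sz; rewrite -(size_rot k) rq.
case: q cp up xmax {rq} => [|y [|z q]] //= cp up xmax _.
case/and3P: cp => xy _; rewrite rcons_path => /andP[_ lx].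
have e : y = last z q.
  apply: (uni x) => //; first by rewrite adj_sym.
    by apply: xmax; rewrite mem_head.
  by apply: xmax; rewrite inE mem_last orbT.
by move: up; rewrite e mem_last andbF.
Qed.

Section SelfReduced.
Variables (n : nat) (T : lcgraph n) (a b : 'I_n * 'I_n).
Hypothesis tree : is_tree T.
Hypothesis r2 : rank2 T a b.
Hypothesis all_crossed : forall x, exists y, crossed T x y.
Hypothesis single : forall A B x y, crossed T A B -> eclass T A B x y ->
  (x, y) \in [:: (A, B); (B, A)].

Let multi := rank2_multipartite r2.

Lemma self_step1 : step1 T T.
Proof.
split=> // [x y -> //|G isG].
case/is_egraphP: (isG) => A [B [C [D [E [F [p [q g]]]]]]].
have ed := eg_desc g; exists A, B; split; first exact: ed_crossed ed.
  by rewrite (eg_edges g); apply: (eclass_eset ed); apply/eclass_refl/crossed_edge/(ed_crossed ed).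
move=> x y xy; rewrite (eg_edges g) (eset_eclass multi ed xy) => c.
by rewrite crossed_edge // single // (ed_crossed ed).
Qed.

Lemma self_renumbering : renumbering T (@id 'I_n).
Proof. by split=> [//|x]; split=> // _; exists x. Qed.

Lemma self_kept x y : kept T T x y = crossed T x y.
Proof. by rewrite /kept; case: (boolP (crossed T x y)) => [/crossed_edge ->|]; rewrite ?andbF. Qed.

Lemma earc_disjoint G c z : is_egraph T G -> z \in earc G c -> z \notin earc G (~~ c).
Proof.
case/is_egraphP => A [B [C [D [E [F [p [q g]]]]]]].
have hex := ed_hex (eg_desc g).
have dis : z \in arc D E -> z \notin arc F C by rewrite !in_arcE; exact: hex_disj hex z.
case: c => /=; rewrite (eg_false g) (eg_true g); last exact: dis.
by apply: contraL; exact: dis.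
Qed.

(** Every vertex is an end of a kept edge, and an e-graph has only one, whose ends are on different
    arcs; so each arc is a single point. *)
Lemma earc_inj G c z w : is_egraph T G -> z \in earc G c -> w \in earc G c -> z = w.
Proof.
move=> isG zc wc; have [z' kz] := all_crossed z; have [w' kw] := all_crossed w.
case: (kept_in multi self_step1 isG (x := w) (x' := w') (y := z) (y' := z')) => //;
  rewrite ?self_kept ?(earc_everts zc) ?(earc_everts wc) // => e.
have [_ _ h] := egraph_crossed multi isG kw (earc_everts wc).
by have := earc_disjoint isG zc; rewrite e h.
Qed.

(** An interior vertex of the connecting path would belong to a further e-graph, so the path is one
    edge; its ends are x and y because arcs are points. *)
Lemma self_link x y : link T T x y -> T x y.
Proof.
case/(linkP T multi) => G1 [G2 [i [j [u [P [[is1 is2 con] [u1 v2 x1 y2] _ _]]]]]].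
rewrite -(earc_inj is1 u1 x1) -(earc_inj is2 v2 y2).
case: con => -[]; case: P {v2} => [|w [|w' P]] // _ uq pt h1 h2 h3.
  by case/andP: pt => /uncrossed_edge.
have wP : w \in [:: u, w, w' & P] by rewrite !inE eqxx orbT.
have [z wz] := all_crossed w; have [G [isG _ wV _]] := egraph_of wz.
have n1 : eedges G <> eedges G1.
  move=> /evertices_eq e; rewrite e h1 // in wV.
  by move: uq; rewrite (eqP wV) /= mem_head.
have n2 : eedges G <> eedges G2.
  move=> /evertices_eq e; rewrite e h2 // in wV.
  by move: uq; rewrite (eqP wV) /= mem_last andbF.
by have := h3 G isG n1 n2 w wP; rewrite wV.
Qed.

Lemma self_uncrossed_link x y : uncrossed T x y -> link T T x y.
Proof.
move=> xy; have [x' kx] := all_crossed x; have [y' ky] := all_crossed y.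
have [G1 [is1 _ xV xG]] := egraph_of kx; have [G2 [is2 _ yV yG]] := egraph_of ky.
have off G z w : is_egraph T G -> uncrossed T z w -> z \in everts G -> w \notin everts G.
  move=> isG zw zG; apply/negP => wG.
  have [z' kz] := all_crossed z; have [w' kw] := all_crossed w.
  case: (kept_in multi self_step1 isG (x := z) (x' := z') (y := w) (y' := w')) => //;
    rewrite ?self_kept // => e.
    by have := edge_neq (uncrossed_edge zw); rewrite e eqxx.
  by move: zw; rewrite /uncrossed e kz andbF.
have yx : uncrossed T y x by rewrite uncrossed_sym.
have y1 : y \notin evertices G1.
  by apply: contra (off _ _ _ is1 xy xG); exact: (evertices_everts is1).
have x2 : x \notin evertices G2.
  by apply: contra (off _ _ _ is2 yx yG); exact: (evertices_everts is2).
have nxy := edge_neq (uncrossed_edge xy).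
have [i xi] := in_everts xG; have [j yj] := in_everts yG.
apply/(linkP T multi); exists G1, G2, i, j, x, [:: y]; split=> //; first split=> //.
  split=> //=.
  - by rewrite !inE nxy xy.
  - move=> v; rewrite in_cons mem_seq1 => /orP[]/eqP->;
      by rewrite ?eqxx ?xV // (negbTE y1) eq_sym (negbTE nxy).
  - move=> v; rewrite in_cons mem_seq1 => /orP[]/eqP->;
      by rewrite ?eqxx ?yV // (negbTE x2) (negbTE nxy).
  move=> G isG n1 n2 v; rewrite in_cons mem_seq1 => /orP[]/eqP->; apply/negP => vV.
    by apply: n1; apply: (egraph_meet multi isG is1 (evertices_everts isG vV)).
  by apply: n2; apply: (egraph_meet multi isG is2 (evertices_everts isG vV)).
  by exists x'; rewrite self_kept.
by exists y'; rewrite self_kept.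
Qed.

Lemma self_reduced : reduced_form T T.
Proof.
exists T; first exact: self_step1.
exists id; first exact: self_renumbering.
move=> x y; split=> [xy|[/crossed_edge //|/self_link //|/self_link]]; last by rewrite adj_sym.
by case: (edge_cases xy) => [|/self_uncrossed_link]; [constructor 1|constructor 2].
Qed.

Lemma self_pre_reduced (G : lcgraph n) : (forall x y, G x y = crossed T x y) ->
  pre_reduced_form T G.
Proof.
move=> h; exists T; first exact: self_step1.
by exists id => [|x y]; [exact: self_renumbering|rewrite h].
Qed.

End SelfReduced.

(** * Certificates for the listed graphs *)

Section Certificate.
Variables (m : nat) (E2 E3 : seq (nat * nat)).
Local Notation I := (iota 0 m).
Local Notation E := (edge_rel (E2 ++ E3)).
Local Notation C := (edge_rel E2).

Definition crossed_chord x y : bool :=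
  if E x y then some (fun u => some (fun v => if E u v then ncrossing x y u v else false) I) I
  else false.

Definition crossed_ok := every (fun x => every (fun y => C x y == crossed_chord x y) I) I.

Definition cover_ok := every (fun x => some (C x) I) I.

Definition rank2_ok p q r s := every (fun x => every (fun y => if E x y then
  every (fun z => every (fun t => if E z t then
    ncrossing x y z t == (ncrossing x y p q && ncrossing r s z t) (+) (ncrossing x y r s && ncrossing p q z t)
  else true) I) I else true) I) I.

Definition rank2_some := some (fun p => some (fun q => if E p q then
  some (fun r => some (fun s => if E r s then if ncrossing p q r s then rank2_ok p q r s
    else false else false) I) I else false) I) I.

(** A breadth-first listing from point 0. Nothing is proved about it: [tree_ok] tests that positions
    in it satisfy the hypotheses of [ranked_tree]. *)
Definition search_order : seq nat :=
  iter m (fun s => s ++ [seq j <- I | (j \notin s) && has (fun i => E i j) s]) [:: 0].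

Definition tree_ok (o : seq nat) :=
  if every (mem o) I then
  if every (fun x => if x == 0 then true else
    some (fun y => if E x y then index y o < index x o else false) I) I then
  every (fun x => every (fun y => if E x y then if index y o < index x o then
    every (fun z => if E x z then if index z o < index x o then y == z else true else true) I
    else true else true) I) I
  else false else false.

(** Contains [jrel] for the chord pq, with not crossing pq in place of parallel. The larger relation
    is cheaper to compute and still certifies that no second chord joins the class. *)
Definition joining (p q : nat) : rel nat := fun u v =>
  if E u v then if C u v then ~~ ncrossing p q u v else true else false.

Definition single_ok p q :=
  let s := component m (joining p q) p in
  if stable m (joining p q) s then
  every (fun x => every (fun y => if C x y then if ncrossing p q x y then true else
    if x \in s then (x == p) && (y == q) || (x == q) && (y == p) else true else true) I) I
  else false.

Definition certificate : bool :=
  if 0 < m then if crossed_ok then if cover_ok then if rank2_some then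
  if tree_ok search_order then
  every (fun p => every (fun q => if C p q then single_ok p q else true) I) I
  else false else false else false else false else false.

Lemma everyP (P : pred nat) : reflect (forall i : 'I_m, P i) (every P I).
Proof.
rewrite everyE; apply: (iffP allP) => [h i|h i]; first by apply: h; rewrite mem_iota /= ltn_ord.
by rewrite mem_iota /= => hi; exact: (h (Ordinal hi)).
Qed.

Lemma someP (P : pred nat) : reflect (exists i : 'I_m, P i) (some P I).
Proof.
rewrite someE; apply: (iffP hasP) => [[i]|[i Pi]].
  by rewrite mem_iota /= => hi Pi; exists (Ordinal hi).
by exists (val i) => //; rewrite mem_iota /= ltn_ord.
Qed.

Hypothesis cert : certificate.
Local Notation T := (form_graph m (E2 ++ E3)).

Lemma TE (x y : 'I_m) : T x y = E x y. Proof. exact: form_graphE. Qed.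

Lemma certificates : [/\ 0 < m, crossed_ok, cover_ok, rank2_some & tree_ok search_order]
  /\ forall p q : 'I_m, C p q -> single_ok p q.
Proof.
move: cert; rewrite /certificate; do 5![case: ifP => // ?] => /everyP h; split=> // p q.
by have /everyP/(_ q) := h p; case: ifP.
Qed.

Lemma form_crossed (x y : 'I_m) : crossed T x y = C x y.
Proof.
have [[_ /everyP/(_ x)/everyP/(_ y)/eqP -> _ _ _] _] := certificates.
have -> : crossed_chord x y =
    E x y && some (fun u => some (fun v => if E u v then ncrossing x y u v else false) I) I.
  by rewrite /crossed_chord; case: (E x y).
rewrite /crossed TE; congr (_ && _).
apply/existsP/someP => -[u h]; exists u; move: h.
  by case/existsP => v; rewrite TE => /andP[uv c]; apply/someP; exists v; rewrite uv -crossing_ncrossing.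
by case/someP => v; case: ifP => // uv c; apply/existsP; exists v; rewrite TE uv crossing_ncrossing.
Qed.

Lemma form_cover (x : 'I_m) : exists y, crossed T x y.
Proof.
have [[_ _ /everyP/(_ x)/someP[y h] _ _] _] := certificates.
by exists y; rewrite form_crossed.
Qed.

Lemma form_rank2 : exists a b, rank2 T a b.
Proof.
have [[_ _ _ /someP[p /someP[q h]] _] _] := certificates.
move: h; case: ifP => // pq /someP[r /someP[s]]; case: ifP => // rs; case: ifP => // c ok.
exists (p, q), (r, s); split; rewrite /dcross ?TE ?crossing_ncrossing //.
move=> [x y] [z t]; rewrite !TE => xy zt; rewrite !crossing_ncrossing.
have /everyP/(_ x)/everyP/(_ y) := ok; rewrite xy => /everyP/(_ z)/everyP/(_ t).
by rewrite zt => /eqP.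
Qed.

Lemma form_tree : is_tree T.
Proof.
have [[m0 _ _ _ h] _] := certificates; move: h; rewrite /tree_ok.
case: ifP => // /everyP io; case: ifP => // /everyP par /everyP uni.
apply: (@ranked_tree _ _ (fun x => index (val x) search_order) (Ordinal m0)).
- move=> x y e; apply: val_inj.
  have := nth_index 0 (io x); have := nth_index 0 (io y).
  by rewrite /= -e => -> <-.
- move=> x; have := par x; case: eqVneq => [e _|_ /someP[y]]; first by left; exact: val_inj.
  by case: ifP => // xy lt; right; exists y; rewrite ?TE.
move=> x y z; rewrite !TE => xy xz ly lz; apply: val_inj; apply/eqP.
have /everyP/(_ y) := uni x; rewrite xy ly => /everyP/(_ z).
by rewrite xz lz.
Qed.

Lemma form_single (A B x y : 'I_m) : crossed T A B -> eclass T A B x y ->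
  (x, y) \in [:: (A, B); (B, A)].
Proof.
have [_ sg] := certificates; move=> AB; have AB' := AB; rewrite form_crossed in AB'.
have := sg _ _ AB'; rewrite /single_ok; set s := component _ _ _.
case: ifP => // st /everyP h /andP[par con].
have Cxy : C x y by rewrite -form_crossed; exact: parallel_crossed par AB.
have /everyP/(_ y) := h x; rewrite Cxy -crossing_ncrossing (parallel_nc par).
suff -> : val x \in s by rewrite !inE !xpair_eqE -!val_eqE.
have As : val A \in s by exact: component_start (ltn_ord A).
have stE (u v : 'I_m) : jrel T A B u v -> (val u \in s) = (val v \in s).
  move=> Juv; have Euv := jrel_edge Juv; rewrite TE in Euv.
  have /everyP/(_ u)/everyP/(_ v) := st.
  rewrite /joining Euv; case: ifP => [_ /eqP //|].
  case: ifP => // Cuv; rewrite -crossing_ncrossing => /negbFE c.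
  by case/orP: Juv => [|/parallel_nc]; rewrite ?c // /uncrossed form_crossed Cuv andbF.
have walk P (z : 'I_m) : val z \in s -> path (jrel T A B) z P -> val (last z P) \in s.
  by elim: P z => //= w P IH z zs /andP[/stE zw /IH]; apply; rewrite -zw.
by case/connectP: con => P pP ->; exact: walk.
Qed.

End Certificate.

Lemma forms_certified : every (fun e => certificate e.1.1 e.1.2 e.2) forms.
Proof. by vm_compute. Qed.

Lemma forms_exist e : e \in forms -> exists n (T : lcgraph n),
  [/\ is_tree T, genus T = 1%R,
     exists2 G : lcgraph e.1.1, pre_reduced_form T G & of_edges e.1.1 e.1.2 = unlabel G &
     exists2 G : lcgraph e.1.1, reduced_form T G & of_edges e.1.1 (e.1.2 ++ e.2) = unlabel G].
Proof.
have := forms_certified; rewrite everyE => /allP h /h {h} cert.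
have [a [b r2]] := form_rank2 cert; have tree := form_tree cert.
have cover := form_cover cert; have single := form_single cert.
exists e.1.1, (form_graph e.1.1 (e.1.2 ++ e.2)); split=> //.
- by apply/genus1P; exists a, b.
- exists (form_graph e.1.1 e.1.2); last exact: of_edgesE.
  by apply: (self_pre_reduced r2 cover single) => x y; rewrite (form_crossed cert) form_graphE.
exists (form_graph e.1.1 (e.1.2 ++ e.2)); last exact: of_edgesE.
exact: (self_reduced r2 cover single).
Qed.

(* The two equalities of sets *)
From mathcomp Require Import classical_sets.
Local Open Scope classical_set_scope.

Lemma forms_pre_reduced X : pre_reduced_forms X ->
  exists2 e, e \in forms & X = of_edges e.1.1 e.1.2.
Proof.
case=> n [T [m [G [tree gen [T1 s1 [f fP hG]] ->]]]].
have [e ef [h _]] := forms_complete tree gen s1 fP.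
by exists e => //; exact: h.
Qed.

Lemma forms_reduced X : reduced_forms X ->
  exists2 e, e \in forms & X = of_edges e.1.1 (e.1.2 ++ e.2).
Proof.
case=> n [T [m [G [tree gen [T1 s1 [f fP hG]] ->]]]].
have [e ef [_ h]] := forms_complete tree gen s1 fP.
by exists e => //; exact: h.
Qed.

Theorem theorem2 :
  pre_reduced_forms = [set T2_1; T2_2; T2_3; T2_4; T2_5; T2_6] /\
  reduced_forms =
    [set T3_1_1;
         T3_2_1; T3_2_2; T3_2_3;
         T3_3_1;
         T3_4_1; T3_4_2;
         T3_5_1; T3_5_2; T3_5_3; T3_5_4; T3_5_5; T3_5_6;
         T3_6_1; T3_6_2; T3_6_3; T3_6_4; T3_6_5; T3_6_6].
Proof.
have pre e : e \in forms -> pre_reduced_forms (of_edges e.1.1 e.1.2).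
  by case/forms_exist => n [T [tree gen [G h ->] _]]; exists n, T, e.1.1, G.
have red e : e \in forms -> reduced_forms (of_edges e.1.1 (e.1.2 ++ e.2)).
  by case/forms_exist => n [T [tree gen _ [G h ->]]]; exists n, T, e.1.1, G.
have nthf k : k < size forms -> nth (0, [::], [::]) forms k \in forms by exact: mem_nth.
split; apply/seteqP; split=> X.
- case/forms_pre_reduced => e + ->.
  rewrite /forms !in_cons in_nil orbF.
  by do ?[case/orP]; move/eqP=> -> /=; rewrite /T2_1 /T2_2 /T2_3 /T2_4 /T2_5 /T2_6; tauto.
- do ?[case]; move=> ->.
  (* Each pre-reduced form is obtained from the first entry of [forms] with its matching. *)
  + exact: (pre _ (nthf 0 isT)).
  + exact: (pre _ (nthf 1 isT)).
  + exact: (pre _ (nthf 4 isT)).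
  + exact: (pre _ (nthf 5 isT)).
  + exact: (pre _ (nthf 7 isT)).
  + exact: (pre _ (nthf 13 isT)).
- case/forms_reduced => e + ->.
  rewrite /forms !in_cons in_nil orbF.
  by do ?[case/orP]; move/eqP=> -> /=; tauto.
do ?[case]; move=> ->.
- exact: (red _ (nthf 0 isT)).
- exact: (red _ (nthf 1 isT)).
- exact: (red _ (nthf 2 isT)).
- exact: (red _ (nthf 3 isT)).
- exact: (red _ (nthf 4 isT)).
- exact: (red _ (nthf 5 isT)).
- exact: (red _ (nthf 6 isT)).
- exact: (red _ (nthf 7 isT)).
- exact: (red _ (nthf 8 isT)).
- exact: (red _ (nthf 9 isT)).
- exact: (red _ (nthf 10 isT)).
- exact: (red _ (nthf 11 isT)).
- exact: (red _ (nthf 12 isT)).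
- exact: (red _ (nthf 13 isT)).
- exact: (red _ (nthf 14 isT)).
- exact: (red _ (nthf 15 isT)).
- exact: (red _ (nthf 16 isT)).
- exact: (red _ (nthf 17 isT)).
- exact: (red _ (nthf 18 isT)).
Qed.
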